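(* (i) For every $\phi\in B_{nA}$ there is a uniquely determined map $y=y^{\phi}:[-h,\infty)\to\mathbb{C}^n$ with $y_0=\phi$ such that all restrictions of $y$ to compact intervals and all segments $y_s$, $s\ge 0$, have property (A), all weak-star integrals $\int_{(0,t)}R_Ey_s\,dm(s)$, $t>0$, exist, and $$\iota(y(t))-L_Ey_t=\iota(\phi(0))-L_E\phi+\int_{(0,t)}R_Ey_s\,dm(s)\quad\text{for all } t>0.$$ (ii) For each $t\ge0$ there exists a constant $c(t)\ge0$ such that for all $\phi\in B_{nA}$ $$\sup_{-h\le s\le t}|y^{\phi}(s)|\le c(t)|\phi|.$$ (iii) For every bounded sequence of maps $\phi_j\in B_{nA}$, $j\in\mathbb{N}$, which converges pointwise to a map $\phi\in B_{nA}$, we have $y^{\phi_j}(t)\to y^{\phi}(t)$ as $j\to\infty$, for each $t\ge-h$.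
   Context: Let $n\in\mathbb{N}$, $h>0$, $I=[-h,0]$; $|\cdot|$ is a fixed norm on $\mathbb{C}^n$. $C_c$ is the space of continuous functions $I\to\mathbb{C}$ and $C_{cn}$ the Banach space of continuous maps $I\to\mathbb{C}^n$, with $|\phi|=\max_{t\in I}|\phi(t)|$. For a map $v$ on $M\subset\mathbb{R}$ and $t$ with $[t-h,t]\subset M$, the segment $v_t$ is the map on $I$ given by $v_t(s)=v(t+s)$. A map $w:J\to X$ from an interval $J\subset\mathbb{R}$ into a normed linear space has property (A) if it is the (everywhere) pointwise limit of a sequence of continuous maps $w_m:J\to X$ with $\sup_{m,t}|w_m(t)|<\infty$. $B_{nA}$ is the space of maps $I\to\mathbb{C}^n$ whose components have property (A), normed by $|\phi|=\sup_{t\in I}|\phi(t)|$. $L_c(X,Y)$ is the space of continuous linear maps $X\to Y$ with the operator norm, $X^{\ast}=L_c(X,\mathbb{C})$, and $\iota:X\to X^{\ast\ast}$, $\iota(x)x^{\ast}=x^{\ast}x$. Extensions. For $\lambda\in C_{cn}^{\ast}$ and $k=1,\dots,n$ let $E_k:C_c\to C_{cn}$ be the embedding into the $k$-th component, and let $\mu_k$ be the unique complex Borel measure on $I$ with $|\mu_k|$ regular and $\lambda(E_k\chi)=\int\chi\,d\mu_k$ for all $\chi\in C_c$ (Riesz). Set $\lambda_e\phi=\sum_{k=1}^n\int\phi_k\,d\mu_k$ for bounded Borel $\phi:I\to\mathbb{C}^n$. For a normed linear space $Y$ over $\mathbb{C}$ and $\Lambda\in L_c(C_{cn},Y)$, the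 map $\Lambda_E:B_{nA}\to Y^{\ast\ast}$ is given by $(\Lambda_E\phi)y^{\ast}=(y^{\ast}\circ\Lambda)_e\phi$. Weak-star integral. $m$ is Lebesgue measure on $\mathbb{R}$. For an interval $J$ and $F:J\to Y^{\ast\ast}$, the weak-star integral $\int_JF\,dm$ exists if $J\ni t\mapsto F(t)y^{\ast}\in\mathbb{C}$ is Lebesgue-integrable for every $y^{\ast}\in Y^{\ast}$; it is the map $Y^{\ast}\to\mathbb{C}$ given by $\left(\int_JF\,dm\right)y^{\ast}=\int_JF(t)y^{\ast}\,dm(t)$. Standing assumption: $L,R\in L_c(C_{cn},\mathbb{C}^n)$, and ($\Delta$): there is $\Delta\in(0,h)$ with $L\phi=0$ for all $\phi\in C_{cn}$ with $\phi(t)=0$ on $[-h,-\Delta]$. (Here $L_E,R_E:B_{nA}\to(\mathbb{C}^n)^{\ast\ast}$.) *)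

(* Defs.v *)
From HB Require Import structures.
From mathcomp Require Import all_boot all_order all_algebra complex.
From mathcomp Require Import all_classical all_reals all_analysis.

Set Implicit Arguments.
Unset Strict Implicit.
Unset Printing Implicit Defensive.

Import Order.TTheory GRing.Theory Num.Theory.
Import numFieldNormedType.Exports.
Local Open Scope classical_set_scope.
Local Open Scope ring_scope.
Local Open Scope complex_scope.

(* The library topologizes the complex numbers through the regular module. *)
Notation Cplx R := (R[i]^o).

(* In a normed module over [R[i]] the library norm [`|x|] is itself an element
   of [R[i]]; [rnorm] is the same norm, with values in [R]. *)
Definition rnorm (R : realType) (X : normedModType R[i]) (x : X) : R :=
  complex.Re `|x|.

Section rnorm_theory.
Context (R : realType) (X : normedModType R[i]).
Implicit Types x y : X.

Lemma rnormE x : (rnorm x)%:C = `|x|.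
Proof.
have := normr_ge0 x; rewrite /rnorm lecE /= => /andP[/eqP hI _].
by case: `|x| hI => a b /= ->.
Qed.

Lemma rnorm_ge0 x : 0 <= rnorm x.
Proof. by rewrite -ler0c rnormE. Qed.

Lemma rnormD x y : rnorm (x + y) <= rnorm x + rnorm y.
Proof. by rewrite -lecR rmorphD /= !rnormE ler_normD. Qed.

Lemma rnormZ (a : R[i]) x : rnorm (a *: x) = Normc.normc a * rnorm x.
Proof.
by apply: complexI; rewrite rmorphM /= !rnormE normrZ; congr (_ * _).
Qed.

Lemma rnorm_dist x y : `|rnorm x - rnorm y| <= rnorm (x - y).
Proof.
have h (u v : X) : rnorm u - rnorm v <= rnorm (u - v).
  by have := rnormD (u - v) v; rewrite subrK lerBlDr.
rewrite ler_norml h andbT lerNl opprB (le_trans (h y x)) //.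
by rewrite -opprB /rnorm normrN.
Qed.

End rnorm_theory.

(* An arbitrary norm on the complex vector space C^n, with values in [R];
   nonnegativity and [N 0 = 0] follow from these axioms. *)
Record cnorm (R : realType) (n : nat) := CNorm {
  cnorm_fun :> 'rV[R[i]]_n -> R ;
  cnormD : forall x y, cnorm_fun (x + y) <= cnorm_fun x + cnorm_fun y ;
  cnormZ : forall a x, cnorm_fun (a *: x) = Normc.normc a * cnorm_fun x ;
  cnorm_eq0 : forall x, cnorm_fun x = 0 -> x = 0 }.

Definition Cn (R : realType) (n : nat) (N : cnorm R n) : Type := 'rV[R[i]]_n.

Section Cn_normed.
Context (R : realType) (n : nat) (N : cnorm R n).

HB.instance Definition _ := GRing.Lmodule.on (Cn N).

Let nrm (x : Cn N) : R[i] := (N x)%:C.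

Let nrmD x y : nrm (x + y) <= nrm x + nrm y.
Proof. by rewrite /nrm -rmorphD lecR cnormD. Qed.

Let nrmZ (a : R[i]) x : nrm (a *: x) = `|a| * nrm x.
Proof. by rewrite /nrm cnormZ rmorphM. Qed.

Let nrm_eq0 x : nrm x = 0 -> x = 0.
Proof. by move/complexI/cnorm_eq0. Qed.

HB.instance Definition _ :=
  @Lmodule_isNormed.Build R[i] (Cn N) nrm nrmD nrmZ nrm_eq0.

Lemma rnorm_CnE (x : Cn N) : rnorm x = N x.
Proof. by []. Qed.

End Cn_normed.

Definition I_ (R : realType) (h : {posnum R}) : Type :=
  set_type `[- h%:num, 0]%classic.

Section interval.
Context (R : realType) (h : {posnum R}).

HB.instance Definition _ :=
  Topological.copy (I_ h) (set_type `[- h%:num, 0]%classic).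

Lemma Izero_subproof : (0 : R) \in `[- h%:num, 0]%classic.
Proof. by rewrite inE /= in_itv /= lexx oppr_le0 ge0. Qed.

Definition Izero : I_ h := exist _ 0 Izero_subproof.

HB.instance Definition _ := isPointed.Build (I_ h) Izero.

End interval.
Arguments Izero {R h}.

Definition Ival (R : realType) (h : {posnum R}) (s : I_ h) : R := \val s.

Definition cfun (R : realType) (h : {posnum R}) (X : normedModType R[i]) :
  Type := continuousType (I_ h) X.

Section cfun_normed.
Context (R : realType) (h : {posnum R}) (X : normedModType R[i]).
Local Notation cfun := (cfun h X).

HB.instance Definition _ := Choice.on cfun.

Let mk (f : I_ h -> X) (cf : continuous f) : cfun := mkcts cf.

Let cfun_eq (f g : cfun) : f =1 g -> f = g.
Proof. by move=> fg; apply/continuousEP. Qed.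

Let cts0 : continuous (fun _ : I_ h => 0 : X).
Proof. by move=> s; apply: cst_continuous. Qed.

Let ctsD (f g : cfun) : continuous (fun s => f s + g s).
Proof.
by move=> s; apply: (@cvgD _ _ _ (nbhs s));
  [exact: (@cts_fun _ _ f)|exact: (@cts_fun _ _ g)].
Qed.

Let ctsN (f : cfun) : continuous (fun s => - f s).
Proof. by move=> s; apply: (@cvgN _ _ _ (nbhs s)); exact: (@cts_fun _ _ f). Qed.

Let ctsZ (a : R[i]) (f : cfun) : continuous (fun s => a *: f s).
Proof.
move=> s; apply: (@cvgZl_tmp _ _ _ (nbhs s) (nbhs_filter s)).
exact: (@cts_fun _ _ f).
Qed.

Let add (f g : cfun) : cfun := mk (@ctsD f g).
Let opp (f : cfun) : cfun := mk (@ctsN f).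
Let scale (a : R[i]) (f : cfun) : cfun := mk (@ctsZ a f).

Let addA : associative add.
Proof. by move=> f g k; apply: cfun_eq => s; exact: addrA. Qed.
Let addC : commutative add.
Proof. by move=> f g; apply: cfun_eq => s; exact: addrC. Qed.
Let add0 : left_id (mk cts0) add.
Proof. by move=> f; apply: cfun_eq => s; exact: add0r. Qed.
Let addN : left_inverse (mk cts0) opp add.
Proof. by move=> f; apply: cfun_eq => s; exact: addNr. Qed.

HB.instance Definition _ := GRing.isZmodule.Build cfun addA addC add0 addN.

Let scaleA a b f : scale a (scale b f) = scale (a * b) f.
Proof. by apply: cfun_eq => s; exact: scalerA. Qed.
Let scale1 : left_id 1 scale.
Proof. by move=> f; apply: cfun_eq => s; exact: scale1r. Qed.
Let scaleDr : right_distributive scale +%R.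
Proof. by move=> a f g; apply: cfun_eq => s; exact: scalerDr. Qed.
Let scaleDl f : {morph scale^~ f : a b / a + b}.
Proof. by move=> a b; apply: cfun_eq => s; exact: scalerDl. Qed.

HB.instance Definition _ :=
  GRing.Zmodule_isLmodule.Build R[i] cfun scaleA scale1 scaleDr scaleDl.

Lemma cfun0E s : (0 : cfun) s = 0. Proof. by []. Qed.
Lemma cfunDE (f g : cfun) s : (f + g) s = f s + g s. Proof. by []. Qed.
Lemma cfunZE (a : R[i]) (f : cfun) s : (a *: f) s = a *: f s.
Proof. by []. Qed.

(* [cfun_supnorm f] is in fact a maximum, see [cfun_supnorm_max]. *)
Definition cfun_supnorm (f : cfun) : R := sup (range (fun s => rnorm (f s))).

Lemma cfun_rnorm_max (f : cfun) :
  exists s0, forall s, rnorm (f s) <= rnorm (f s0).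
Proof.
pose A := `[- h%:num, 0]%classic : set R.
pose g : A -> R := fun s => rnorm (f s).
have cg : continuous g.
  move=> s; apply/(@cvgrPdist_lt _ _ _ (nbhs s) (nbhs_filter s)) => e e0.
  have e0' : (0 : R[i]) < e%:C by rewrite (ltcR 0 e).
  have /(@cvgrPdist_lt _ _ _ (nbhs s) (nbhs_filter s)) /(_ _ e0') :=
    @cts_fun _ _ f s.
  apply: filterS => t; rewrite -rnormE ltcR.
  by apply: le_lt_trans; exact: rnorm_dist.
have h0 : - h%:num <= 0 :> R by rewrite oppr_le0 ge0.
have [|c cI cmax] := @EVT_max R (valL_ 0 g) (- h%:num) 0 h0.
  exact/subspace_valL_continuousP'.
have cA : c \in A by rewrite inE.
exists (exist _ c cA) => s.
have /cmax : set_val s \in `[- h%:num, 0] by have /= := set_valP s.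
suff E (u : A) : valL_ 0 g (set_val u) = g u.
  by rewrite E (E (exist _ c cA)).
by have /(congr1 (fun k => k u)) := valLK 0 g.
Qed.

Lemma cfun_le_supnorm (f : cfun) s : rnorm (f s) <= cfun_supnorm f.
Proof.
have [s0 hs0] := cfun_rnorm_max f.
apply: ub_le_sup; last by exists s.
by exists (rnorm (f s0)) => _ [t _ <-].
Qed.

Lemma cfun_supnorm_le (f : cfun) M :
  (forall s, rnorm (f s) <= M) -> cfun_supnorm f <= M.
Proof.
by move=> hM; apply: ge_sup => [|_ [t _ <-]//]; exists (rnorm (f Izero)), Izero.
Qed.

Lemma cfun_supnorm_max (f : cfun) : exists s0, cfun_supnorm f = rnorm (f s0).
Proof.
have [s0 hs0] := cfun_rnorm_max f; exists s0; apply/eqP.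
by rewrite eq_le cfun_le_supnorm cfun_supnorm_le.
Qed.

Let nrm (f : cfun) : R[i] := (cfun_supnorm f)%:C.

Let nrmD f g : nrm (f + g) <= nrm f + nrm g.
Proof.
rewrite /nrm -rmorphD lecR; apply: cfun_supnorm_le => s.
by rewrite (le_trans (rnormD _ _))// lerD// cfun_le_supnorm.
Qed.

Let nrmZ (a : R[i]) f : nrm (a *: f) = `|a| * nrm f.
Proof.
have -> : `|a| = (Normc.normc a)%:C by [].
rewrite /nrm -rmorphM; congr (_ %:C).
have [s0 hs0] := cfun_supnorm_max f; apply/eqP; rewrite eq_le; apply/andP; split.
  apply: cfun_supnorm_le => s; rewrite cfunZE rnormZ ler_wpM2l ?cfun_le_supnorm//.
  by rewrite -ler0c; exact: (normr_ge0 a).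
by rewrite hs0 -rnormZ -cfunZE cfun_le_supnorm.
Qed.

Let nrm_eq0 f : nrm f = 0 -> f = 0.
Proof.
move/complexI => f0; apply: cfun_eq => s; rewrite cfun0E; apply: normr0_eq0.
rewrite -rnormE; congr (_ %:C); apply/eqP.
by rewrite eq_le rnorm_ge0 andbT -f0 cfun_le_supnorm.
Qed.

HB.instance Definition _ :=
  @Lmodule_isNormed.Build R[i] cfun nrm nrmD nrmZ nrm_eq0.

Lemma rnorm_cfunE (f : cfun) : rnorm f = cfun_supnorm f.
Proof. by []. Qed.

End cfun_normed.

Notation C_c h := (cfun h (Cplx _)).
Notation C_cn h N := (cfun h (Cn N)).

Record Lc (R : realType) (X Y : normedModType R[i]) := mkLc {
  Lc_fun :> {linear X -> Y} ;
  Lc_continuous : continuous Lc_fun }.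

Definition dual (R : realType) (X : normedModType R[i]) := Lc X (Cplx R).

Section Lc_comp.
Context (R : realType) (X Y Z : normedModType R[i]).

Lemma Lc_comp_subproof (g : Lc Y Z) (f : Lc X Y) : continuous (g \o f).
Proof.
by move=> x; apply: continuous_comp; exact: Lc_continuous.
Qed.

Definition Lc_comp (g : Lc Y Z) (f : Lc X Y) : Lc X Z :=
  @mkLc R X Z (GRing.Linear.clone _ _ _ _ (g \o f) _) (@Lc_comp_subproof g f).

End Lc_comp.

(* Elements of the bidual, as well as weak-star integrals, are represented by
   their values on the dual, i.e. by functions [dual Y -> R[i]]. *)
Definition iota (R : realType) (Y : normedModType R[i]) (y : Y) :
  dual Y -> Cplx R := fun ys => ys y.

Definition BorelI (R : realType) (h : {posnum R}) :=
  g_sigma_algebraType (@open (I_ h)).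

Record cmeasure (R : realType) (h : {posnum R}) := CMeasure {
  cm_Re : {charge set (BorelI h) -> \bar R} ;
  cm_Im : {charge set (BorelI h) -> \bar R} }.

HB.instance Definition _ (R : realType) (h : {posnum R}) :=
  gen_eqMixin (cmeasure h).
HB.instance Definition _ (R : realType) (h : {posnum R}) :=
  gen_choiceMixin (cmeasure h).

Section complex_measures.
Context (R : realType) (h : {posnum R}).
Implicit Types (mu : cmeasure h) (A : set (I_ h)).

Definition cm_zero : cmeasure h := CMeasure czero czero.

Definition cm_val mu A : R[i] := fine (cm_Re mu A) +i* fine (cm_Im mu A).

Definition total_variation mu A : \bar R :=
  ereal_sup [set (\sum_(0 <= k <oo) (Normc.normc (cm_val mu (F k)))%:E)%E |
    F in [set F : nat -> set (BorelI h) | [/\ forall k, measurable (F k),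
      trivIset setT F & \bigcup_k F k = A]]].

Definition regular_measure (nu : set (I_ h) -> \bar R) : Prop :=
  forall A : set (BorelI h), measurable A ->
    nu A = ereal_inf [set nu U | U in [set U : set (I_ h) | open U /\ A `<=` U]]
    /\
    nu A = ereal_sup [set nu K | K in [set K : set (I_ h) | compact K /\ K `<=` A]].

(* Integral of a real function against a signed measure, through the Jordan
   decomposition (which does not depend on the chosen Hahn decomposition). *)
Definition charge_integral (nu : {charge set (BorelI h) -> \bar R})
    (f : BorelI h -> R) : R :=
  let HP := cid (Hahn_decomposition nu) in
  let HN := cid (projT2 HP) in
  \int[jordan_pos (projT2 HN)]_(x in setT) f x
  - \int[jordan_neg (projT2 HN)]_(x in setT) f x.

Definition cm_integral mu (f : I_ h -> R[i]) : R[i] :=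
  (charge_integral (cm_Re mu) (fun s => complex.Re (f s))
   - charge_integral (cm_Im mu) (fun s => complex.Im (f s)))
  +i* (charge_integral (cm_Re mu) (fun s => complex.Im (f s))
       + charge_integral (cm_Im mu) (fun s => complex.Re (f s))).

End complex_measures.

Section extension.
Context (R : realType) (n : nat) (N : cnorm R n) (h : {posnum R}).

Lemma Ek_subproof (k : 'I_n) (chi : C_c h) :
  continuous (fun s => (chi s : R[i]) *: (delta_mx 0 k : Cn N)).
Proof.
move=> s; apply: (@cvgZr_tmp _ _ _ (nbhs s) (nbhs_filter s)).
exact: (@cts_fun _ _ chi).
Qed.

Definition Ek (k : 'I_n) (chi : C_c h) : C_cn h N := mkcts (@Ek_subproof k chi).

Definition riesz_representing (lam : dual (C_cn h N)) (k : 'I_n) :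
    set (cmeasure h) :=
  [set mu | regular_measure (total_variation mu) /\
            forall chi : C_c h, lam (Ek k chi) = cm_integral mu chi].

(* The measure of the Riesz representation theorem; the default value
   [cm_zero] only serves to make the definition total. *)
Definition riesz_measure (lam : dual (C_cn h N)) (k : 'I_n) : cmeasure h :=
  xget (cm_zero h) (riesz_representing lam k).

(* Meaningful for bounded Borel maps [phi] only. *)
Definition ext_functional (lam : dual (C_cn h N)) (phi : I_ h -> Cn N) : R[i] :=
  \sum_(k < n) cm_integral (riesz_measure lam k) (fun s => phi s 0 k).

Definition ext_operator (Y : normedModType R[i]) (Lam : Lc (C_cn h N) Y)
    (phi : I_ h -> Cn N) : dual Y -> Cplx R :=
  fun ys => ext_functional (Lc_comp ys Lam) phi.

End extension.

(* [J] is an interval of real numbers (with [T = R]), or all of [T = I]. *)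
Definition propertyA (R : realType) (T : topologicalType)
    (X : normedModType R[i]) (J : set T) (w : T -> X) : Prop :=
  exists w_ : nat -> T -> X,
    [/\ forall m, {within J, continuous (w_ m)},
        exists M : R, forall m t, J t -> rnorm (w_ m t) <= M
      & forall t, J t -> w_ ^~ t @ \oo --> w t].

Definition B_nA (R : realType) (n : nat) (N : cnorm R n) (h : {posnum R}) :
    set (I_ h -> Cn N) :=
  [set phi | forall k : 'I_n,
     propertyA setT (fun s => (phi s 0 k : Cplx R))].

Definition sup_norm (R : realType) (T : Type) (X : normedModType R[i])
    (J : set T) (w : T -> X) : \bar R :=
  ereal_sup [set (rnorm (w s))%:E | s in J].

(* Maps on a half-line [-h, oo[ are represented by total maps on [R], whose
   values outside of the half-line are irrelevant. *)
Definition segment (R : realType) (h : {posnum R}) (X : Type) (v : R -> X)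
    (t : R) : I_ h -> X := fun s => v (t + Ival s).

(* [lebesgue_measure] lives on the Borel sigma-algebra; along the segments of a
   map with property (A) the integrands below are pointwise limits of
   continuous functions, hence Borel. *)
Section weak_star_integral.
Context (R : realType) (Y : normedModType R[i]).
Implicit Types (J : set R) (F : R -> dual Y -> Cplx R).

Definition weak_star_integrable J F : Prop :=
  forall ys : dual Y,
    (@lebesgue_measure R).-integrable J (fun t => (complex.Re (F t ys))%:E) /\
    (@lebesgue_measure R).-integrable J (fun t => (complex.Im (F t ys))%:E).

Definition weak_star_integral J F : dual Y -> Cplx R := fun ys =>
  (\int[@lebesgue_measure R]_(t in J) complex.Re (F t ys))
  +i* (\int[@lebesgue_measure R]_(t in J) complex.Im (F t ys)).

End weak_star_integral.

Definition condition_Delta (R : realType) (n : nat) (N : cnorm R n)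
    (h : {posnum R}) (L : Lc (C_cn h N) (Cn N)) : Prop :=
  exists Delta : R, 0 < Delta < h%:num /\
    forall phi : C_cn h N,
      (forall s : I_ h, Ival s <= - Delta -> phi s = 0) -> L phi = 0.

Definition is_solution (R : realType) (n : nat) (N : cnorm R n)
    (h : {posnum R}) (Lop Rop : Lc (C_cn h N) (Cn N)) (phi : I_ h -> Cn N)
    (y : R -> Cn N) : Prop :=
  let LE := ext_operator Lop in
  let RE := ext_operator Rop in
  [/\ segment y 0 = phi,
      forall a b, - h%:num <= a -> a <= b -> propertyA `[a, b]%classic y,
      forall s, 0 <= s -> propertyA setT (segment y s : I_ h -> Cn N),
      forall t, 0 < t ->
        weak_star_integrable `]0, t[%classic (fun s => RE (segment y s))
    & forall t, 0 < t ->
        iota (y t) \- LE (segment y t) =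
        iota (phi Izero) \- LE phi
        \+ weak_star_integral `]0, t[%classic (fun s => RE (segment y s))].

(* Main.v *)
(* On C^n-valued Baire-one maps the extensions [L_E], [R_E] are determined by
   dominated convergence from their values on continuous maps, once the Riesz
   measures are known to represent the functionals. So everything rests on the
   Riesz representation theorem on the compact interval, which is obtained from
   Daniell's outer measure of a positive functional.

   By ([Delta]) the value [L_E y_t] only sees [y] up to time [t - Delta]; hence in
   the norm weighted by [expR (a * t)], with [a] large, the right-hand side of the
   integrated equation is a contraction in [y]. Its Picard iterates converge
   geometrically, uniformly over initial maps with a common bound. Each iterate
   depends continuously on the initial map for bounded pointwise convergence, so
   the limit does too; approximating Baire-one initial maps by continuous ones then
   gives property (A) of the solution, and (ii), (iii). The same contraction
   estimate, iterated, yields uniqueness. *)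

Require Import Defs.
From HB Require Import structures.
From mathcomp Require Import all_boot all_order all_algebra complex.
From mathcomp Require Import all_classical all_reals all_analysis.
From mathcomp Require Import measurable_realfun.
From mathcomp Require Import ring lra.

Set Implicit Arguments.
Unset Strict Implicit.
Unset Printing Implicit Defensive.

Import Order.TTheory GRing.Theory Num.Theory.
Import numFieldNormedType.Exports.
Local Open Scope classical_set_scope.
Local Open Scope ring_scope.

(** * Measures of positive functionals *)

(** The measures behind [L_E] and [R_E] are chosen separately for each functional, so relations
    between functionals cannot be read off the measures. Differences, expansions in coordinates and
    the effect of the delay are therefore proved on continuous approximants and transferred by
    uniqueness of limits. The approximants must obey the bound of the map that they approximate,
    whence the truncation in the norm. A locally uniform limit of iterates has no evident continuous
    approximants when the initial map is discontinuous. Extending initial maps by constants to the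
    line, with an evolution term that vanishes at 0, keeps the iterates of continuous initial maps
    continuous across 0; the approximants of a general solution come from there. It also lets
    estimates be stated on half-lines [s <= T]. The equation lives in the bidual, the contraction in
    C^n: testing with the n coordinate functionals passes from one to the other. *)

Record positive_functional (R : realType) (T : topologicalType) := PositiveFunctional {
  posf_fun :> (T -> R) -> R ;
  posfD : forall f g : T -> R, continuous f -> continuous g ->
    (forall x, 0 <= f x) -> (forall x, 0 <= g x) ->
    posf_fun (fun x => f x + g x) = posf_fun f + posf_fun g ;
  posfZ : forall (c : R) (f : T -> R), 0 <= c -> continuous f ->
    (forall x, 0 <= f x) -> posf_fun (fun x => c * f x) = c * posf_fun f ;
  posf_ge0 : forall f : T -> R, continuous f -> (forall x, 0 <= f x) ->
    0 <= posf_fun f }.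

Section continuous_combinators.
Context (R : realType) (T : topologicalType).
Implicit Types f g : T -> R.

Lemma ctsD f g : continuous f -> continuous g -> continuous (fun x => f x + g x).
Proof. by move=> cf cg x; apply: cvgD; [exact: cf|exact: cg]. Qed.

Lemma ctsB f g : continuous f -> continuous g -> continuous (fun x => f x - g x).
Proof. by move=> cf cg x; apply: cvgB; [exact: cf|exact: cg]. Qed.

Lemma ctsM f g : continuous f -> continuous g -> continuous (fun x => f x * g x).
Proof. by move=> cf cg x; apply: cvgM; [exact: cf|exact: cg]. Qed.

Lemma cts_cst (c : R) : continuous (fun _ : T => c).
Proof. by move=> x; exact: cst_continuous. Qed.

Lemma cts_min f g : continuous f -> continuous g ->
  continuous (fun x => Num.min (f x) (g x)).
Proof. by move=> cf cg x; apply: (@continuous_min _ _ f g); [exact: cf|exact: cg]. Qed.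

Lemma cts_max f g : continuous f -> continuous g ->
  continuous (fun x => Num.max (f x) (g x)).
Proof. by move=> cf cg x; apply: (@continuous_max _ _ f g); [exact: cf|exact: cg]. Qed.

Lemma cts_sum (I : Type) (s : seq I) (F : I -> T -> R) :
  (forall i, continuous (F i)) -> continuous (fun x => \sum_(i <- s) F i x).
Proof.
move=> cF; elim: s => [|i s IH].
  by under eq_fun do rewrite big_nil; exact: cts_cst.
by under eq_fun do rewrite big_cons; exact: ctsD.
Qed.

Lemma open_gt f (c : R) : continuous f -> open [set x | c < f x].
Proof.
move=> cf; have := @open_comp _ _ f [set y | c < y].
by apply; [move=> x _; exact: cf|exact: open_gt].
Qed.

End continuous_combinators.
Arguments cts_cst {R T} c.

Section posf_theory.
Context (R : realType) (T : topologicalType) (p : positive_functional R T).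
Implicit Types f g : T -> R.

Lemma posf_le f g : continuous f -> continuous g -> (forall x, 0 <= f x) ->
  (forall x, f x <= g x) -> p f <= p g.
Proof.
move=> cf cg f0 fg; have -> : g = (fun x => f x + (g x - f x)).
  by apply/funext => x; rewrite addrC subrK.
rewrite posfD//; last by move=> x; rewrite subr_ge0.
  by rewrite lerDl posf_ge0// => [|x]; [exact: ctsB|rewrite subr_ge0].
exact: ctsB.
Qed.

Lemma posf0 : p (fun=> 0) = 0.
Proof.
rewrite -[RHS](mul0r (p (fun=> 0))) -posfZ//; last exact: cts_cst.
by congr (p _); apply/funext => x; rewrite mul0r.
Qed.

Lemma posf_sum (F : nat -> T -> R) n : (forall i, continuous (F i)) ->
  (forall i x, 0 <= F i x) ->
  p (fun x => \sum_(i < n) F i x) = \sum_(i < n) p (F i).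
Proof.
move=> cF F0; elim: n => [|n IH].
  by rewrite big_ord0 -[RHS]posf0; congr (p _); apply/funext => x; rewrite big_ord0.
rewrite big_ord_recr /= -IH -posfD//.
- by congr (p _); apply/funext => x; rewrite big_ord_recr.
- exact: cts_sum.
- by move=> x; exact: sumr_ge0.
Qed.

(* Daniell's outer measure: [A] is covered at cost [C] when an increasing sequence
   of continuous functions of [p]-value at most [C] exceeds [1] somewhere along the
   sequence at each point of [A]. Increasing sequences replace countable sums, which
   keeps subadditivity and the Caratheodory criterion free of double series; the
   strict inequality makes outer regularity immediate. *)
Definition posf_cover (A : set T) (C : R) := exists f : nat -> T -> R,
  [/\ forall k, continuous (f k), forall k x, 0 <= f k x,
      forall k x, f k x <= f k.+1 x, forall k, p (f k) <= C
    & forall x, A x -> exists k, 1 < f k x].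

(** The constant 2 covers every set and costs are nonnegative, so the infimum is over a nonempty set
    bounded below, and the outer measure is finite by its very form. *)
Definition posf_outer (A : set T) : \bar R := (inf [set C | posf_cover A C])%:E.

Lemma posf_cover_ge0 A C : posf_cover A C -> 0 <= C.
Proof. by move=> [f [cf f0 _ fC _]]; apply: le_trans (fC 0%N); exact: posf_ge0. Qed.

Lemma posf_cover_cts A f : continuous f -> (forall x, 0 <= f x) ->
  (forall x, A x -> 1 < f x) -> posf_cover A (p f).
Proof. by move=> cf f0 fA; exists (fun=> f); split=> // x /fA; exists 0%N. Qed.

Lemma posf_cover_nonempty A : [set C | posf_cover A C] !=set0.
Proof.
exists (p (fun=> 2)); apply: posf_cover_cts; [exact: cts_cst|by []|].
by move=> x _; rewrite ltr1n.
Qed.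

Lemma posf_outer_le_posf_cover A C : posf_cover A C -> (posf_outer A <= C%:E)%E.
Proof.
move=> AC; rewrite lee_fin ge_inf//; exists 0 => C' /= /posf_cover_ge0; exact.
Qed.

Lemma posf_outer_adherent A (e : R) : 0 < e -> exists2 C, posf_cover A C & (C%:E <= posf_outer A + e%:E)%E.
Proof.
move=> e0; have [|C AC CA] := @inf_adherent _ [set C | posf_cover A C] e e0.
  by split; [exact: posf_cover_nonempty|exists 0 => C' /= /posf_cover_ge0].
by exists C => //; rewrite -EFinD lee_fin ltW.
Qed.

Lemma posf_outer_ge0 A : (0 <= posf_outer A)%E.
Proof.
rewrite lee_fin lb_le_inf//; [exact: posf_cover_nonempty|by move=> C /= /posf_cover_ge0].
Qed.

Lemma posf_outer_le A B : A `<=` B -> (posf_outer A <= posf_outer B)%E.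
Proof.
move=> AB; rewrite lee_fin lb_le_inf//; first exact: posf_cover_nonempty.
move=> C /= [f [cf f0 fi fC fB]]; rewrite -lee_fin; apply: posf_outer_le_posf_cover.
by exists f; split=> // x /AB; exact: fB.
Qed.

Lemma posf_outer_set0 : posf_outer set0 = 0%E.
Proof.
apply/eqP; rewrite eq_le posf_outer_ge0 andbT.
apply: (@le_trans _ _ (p (fun=> 0))%:E).
  by apply: posf_outer_le_posf_cover; apply: posf_cover_cts => //; exact: cts_cst.
by rewrite posf0.
Qed.

Lemma posf_outer_sigma_subadditive : sigma_subadditive posf_outer.
Proof.
move=> A; apply/lee_addgt0Pr => e e0.
have e0' i : 0 < e / (2 ^ i.+1)%:R by rewrite divr_gt0// ltr0n expn_gt0.
have /choice[C hC] i : exists C, posf_cover (A i) C /\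
    (C%:E <= posf_outer (A i) + (e / (2 ^ i.+1)%:R)%:E)%E.
  by have [C ? ?] := posf_outer_adherent (A i) (e0' i); exists C.
have /choice[f hf] i := (hC i).1.
apply: le_trans (epsilon_trick xpredT (fun i => posf_outer_ge0 (A i)) (ltW e0)).
set S := (\sum_(_ <oo) _)%E.
have CS k : ((\sum_(i < k) C i)%:E <= S)%E.
  rewrite -sumEFin.
  apply: (@le_trans _ _ (\sum_(i < k) (posf_outer (A i) + (e / (2 ^ i.+1)%:R)%:E))%E).
    by apply: lee_sum => i _; exact: (hC i).2.
  rewrite -(big_mkord xpredT (fun i => posf_outer (A i) + (e / (2 ^ i.+1)%:R)%:E)%E).
  apply: nneseries_lim_ge => i _ _.
  by rewrite adde_ge0 ?posf_outer_ge0// lee_fin ltW.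
have S0 : (0 <= S)%E by have := CS 0%N; rewrite big_ord0.
have [->|] := eqVneq S +oo%E; first by rewrite leey.
move=> Sy; have Sfin : S \is a fin_num by rewrite ge0_fin_numE// ltey.
rewrite -(fineK Sfin); apply: posf_outer_le_posf_cover.
(* A diagonal replaces the double series: the covers [f i] are summed at the common index [k], which
   increases both the number of terms and each term. *)
exists (fun k x => \sum_(i < k.+1) f i k x); split.
- by move=> k; apply: cts_sum => i; have [] := hf i.
- by move=> k x; apply: sumr_ge0 => i _; have [_ ->] := hf i.
- move=> k x; rewrite [leRHS]big_ord_recr /= -[leLHS]addr0 lerD//.
    by apply: ler_sum => i _; have [_ _ ->] := hf i.
  by have [_ ->] := hf k.+1.
- move=> k; rewrite (@posf_sum (fun i => f i k))//.
  + apply: (@le_trans _ _ (\sum_(i < k.+1) C i)).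
      by apply: ler_sum => i _; have [_ _ _ ->] := hf i.
    by rewrite -lee_fin fineK.
  + by move=> i; have [] := hf i.
  + by move=> i x; have [_ ->] := hf i.
- move=> x [i _ Aix]; have [_ fi0 fii _ /(_ x Aix)[k fk]] := hf i.
  have mono a b : (a <= b)%N -> f i a x <= f i b x.
    by have /nondecreasing_seqP := fii ^~ x; exact.
  exists (maxn i k); apply: (lt_le_trans fk).
  apply: le_trans (mono _ _ (leq_maxr i k)) _.
  have ik : (i < (maxn i k).+1)%N by rewrite ltnS leq_maxl.
  rewrite (bigD1 (Ordinal ik))//= lerDl; apply: sumr_ge0 => j _.
  by have [_ ->] := hf j.
Qed.

HB.instance Definition _ := @isOuterMeasure.Build R T posf_outer posf_outer_set0 posf_outer_ge0 posf_outer_le posf_outer_sigma_subadditive.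

(* The functions [u k] increase to the indicator of [0 < g]: multiplying a cover
   [f] of [E] by them gives the cover [f k * u k] of the part of [E] inside, while
   [f k * (1 - u j)], [k] varying, covers the part outside. *)
Lemma posf_outer_caratheodory g : continuous g -> posf_outer.-caratheodory [set x | 0 < g x].
Proof.
move=> cg; apply: le_caratheodory_measurable => E /=.
set U := [set x | _].
apply/lee_addgt0Pr => e e0.
have [C [f [cf f0 fi fC fE]] CE] := posf_outer_adherent E e0.
apply: le_trans CE.
pose u k x := Num.min 1 (k%:R * Num.max (g x) 0).
have u0 k x : 0 <= u k x by rewrite le_min ler01 mulr_ge0 ?ler0n// le_max lexx orbT.
have u1 k x : u k x <= 1 by rewrite ge_min lexx.
have cu k : continuous (u k).
  by apply: cts_min; [exact: cts_cst|apply: ctsM; [exact: cts_cst|apply: cts_max => //; exact: cts_cst]].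
have ui k x : u k x <= u k.+1 x.
  rewrite le_min u1 ge_min ler_wpM2r ?orbT// ?ler_nat//.
  by rewrite le_max lexx orbT.
have uU x : U x -> exists k, forall j, (k <= j)%N -> u j x = 1.
  rewrite /U /= => gx; exists (Num.truncn (g x)^-1).+1 => j hj.
  apply/min_idPl; rewrite max_l ?(ltW gx)// -ler_pdivrMr// mul1r.
  apply: (@le_trans _ _ (Num.truncn (g x)^-1).+1%:R); last by rewrite ler_nat.
  by rewrite ltW// truncnS_gt.
have uN x k : ~ U x -> u k x = 0.
  rewrite /U /= => /negP; rewrite -leNgt => gx.
  by rewrite /u max_r// mulr0 min_r.
have mono x a b : (a <= b)%N -> f a x <= f b x.
  by have /nondecreasing_seqP := fi ^~ x; exact.
have split k j : p (f k) = p (fun x => f k x * u j x) + p (fun x => f k x * (1 - u j x)).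
  rewrite -posfD//.
  - by congr (p _); apply/funext => x; rewrite -mulrDr addrC subrK mulr1.
  - exact: ctsM.
  - by apply: ctsM => //; apply: ctsB => //; exact: cts_cst.
  - by move=> x; rewrite mulr_ge0.
  - by move=> x; rewrite mulr_ge0// subr_ge0.
(* The cover starts at [f j], through [maxn k j]: its members must dominate [f j] for
   [p (f j * u j)] to be saved from the cost [C]. *)
have outU j : (posf_outer (E `&` ~` U) <= (C - p (fun x => f j x * u j x))%:E)%E.
  apply: posf_outer_le_posf_cover; exists (fun k x => f (maxn k j) x * (1 - u j x)); split.
  - by move=> k; apply: ctsM => //; apply: ctsB => //; exact: cts_cst.
  - by move=> k x; rewrite mulr_ge0// subr_ge0.
  - move=> k x; rewrite ler_wpM2r ?subr_ge0//; apply: mono.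
    by rewrite geq_max !leq_max leqnn leqnSn orbT.
  - move=> k; rewrite lerBrDr (le_trans _ (fC (maxn k j)))// (split (maxn k j) j) addrC lerD2r.
    apply: posf_le; [exact: ctsM|exact: ctsM|by move=> x; rewrite mulr_ge0|].
    by move=> x; rewrite ler_wpM2r// mono// leq_maxr.
  - move=> x [/fE[k fk] Ux]; exists k; rewrite uN// subr0 mulr1.
    by rewrite (lt_le_trans fk)// mono// leq_maxl.
rewrite -leeBrDr//; apply: le_trans (posf_outer_le_posf_cover _) _; last first.
  rewrite -EFinB; exact: lexx.
exists (fun k x => f k x * u k x); split.
- by move=> k; exact: ctsM.
- by move=> k x; rewrite mulr_ge0.
- by move=> k x; rewrite ler_pM.
(* Read backwards, [outU k] bounds the cost of the inner cover by [C] minus the outer measure of the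
   part outside. *)
- move=> k; have := outU k; rewrite /posf_outer lee_fin; lra.
- move=> x [/fE[k fk] /uU[k' hk']]; exists (maxn k k').
  by rewrite hk' ?leq_maxr// mulr1 (lt_le_trans fk)// mono// leq_maxl.
Qed.

End posf_theory.

(** Scaling [f] by a factor slightly above 1 turns [1 <= f] into the strict inequality of a cover;
    the denominator [p f + 1] keeps the added cost at most [e], also when [p f = 0]. *)
Lemma posf_outer_le_posf (R : realType) (T : topologicalType) (p : positive_functional R T)
    (A : set T) (f : T -> R) : continuous f -> (forall x, 0 <= f x) ->
  (forall x, A x -> 1 <= f x) -> (posf_outer p A <= (p f)%:E)%E.
Proof.
move=> cf f0 fA; apply/lee_addgt0Pr => e e0.
have pf0 : 0 <= p f by exact: posf_ge0.
have d0 : 0 < e / (p f + 1) by rewrite divr_gt0// ltr_wpDl.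
apply: (@le_trans _ _ (p (fun x => (1 + e / (p f + 1)) * f x))%:E).
  apply: posf_outer_le_posf_cover; apply: posf_cover_cts.
  - by apply: ctsM => //; exact: cts_cst.
  - by move=> x; rewrite mulr_ge0// addr_ge0// ltW.
  - move=> x /fA fx; rewrite (lt_le_trans (y := 1 + e / (p f + 1)))//.
      by rewrite ltrDl.
    by rewrite ler_peMr// addr_ge0// ltW.
rewrite posfZ//; last by rewrite addr_ge0// ltW.
rewrite -EFinD lee_fin mulrDl mul1r lerD2l mulrAC ler_pdivrMr ?ltr_wpDl//.
by rewrite ler_wpM2l ?(ltW e0)// lerDl.
Qed.

Lemma compact_nondecreasing_cover (T : ptopologicalType) (U : nat -> set T) :
  compact [set: T] -> (forall k, open (U k)) ->
  (forall i j, (i <= j)%N -> U i `<=` U j) -> (forall x, exists k, U k x) ->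
  exists k, forall x, U k x.
Proof.
rewrite compact_cover => cT oU Umono Ucov.
have [|x _|D _ DU] := cT nat setT U; first by move=> i _; exact: oU.
  by have [k Uk] := Ucov x; exists k.
exists (\max_(i <- finmap.enum_fset D) i)%N => x.
have [i /= iD Uix] := DU x I; apply: Umono Uix.
by apply: (@leq_bigmax_seq _ (finmap.enum_fset D) xpredT id).
Qed.

Notation borel_type T := (g_sigma_algebraType (@open T)).

Lemma cts_measurable (R : realType) (T : ptopologicalType) (f : T -> R) :
  continuous f -> measurable_fun [set: borel_type T] (f : borel_type T -> R).
Proof.
move=> cf; apply: (measurability _ (RGenOInfty.measurableE R)) => /= _ [_ [a ->] <-].
rewrite setTI; apply: sub_sigma_algebra.
suff -> : f @^-1` `]a, +oo[ = [set x | a < f x] by exact: open_gt.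
by apply/seteqP; split=> x /=; rewrite in_itv/= andbT.
Qed.

Section posf_measure.
Context (R : realType) (T : ptopologicalType) (p : positive_functional R T).
Context (cT : compact [set: T]).
Context (cozero : forall U : set T, open U ->
  exists2 g : T -> R, continuous g & U = [set x | 0 < g x]).

(** The argument records the cozero hypothesis in the term itself, so that the measure instance
    declared below, whose proof depends on it, can be inferred from the set function alone. *)
Definition posf_measure (_ : forall U : set T, open U ->
  exists2 g : T -> R, continuous g & U = [set x | 0 < g x]) :
  set (borel_type T) -> \bar R := posf_outer p.

Local Notation mu := (posf_measure cozero).

Lemma borel_caratheodory (A : set (borel_type T)) :
  measurable A -> (posf_outer p).-caratheodory A.
Proof.
apply: smallest_sub; first exact: (@sigma_algebra_measurable _ (caratheodory_type (posf_outer p))).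
by move=> U /cozero[g cg ->]; exact: posf_outer_caratheodory.
Qed.

Let mu_sigma_additive : semi_sigma_additive mu.
Proof.
move=> F mF tF mUF.
apply: (@caratheodory_measure_sigma_additive R T (posf_outer p)) => //.
  by move=> i; exact: borel_caratheodory.
exact: borel_caratheodory.
Qed.

HB.instance Definition _ := isMeasure.Build _ _ _ mu
  (posf_outer_set0 p) (posf_outer_ge0 p) mu_sigma_additive.

Let mu_finite : fin_num_fun mu.
Proof. by []. Qed.

HB.instance Definition _ := @Measure_isFinite.Build _ _ _ mu mu_finite.

(** By compactness the increasing open sets [1 < f k] exhaust the space at a finite stage, so some
    [f k] dominates the constant 1; this bounds every cost from below. *)
Lemma posf_outer_setT : posf_outer p setT = (p (fun=> 1))%:E.
Proof.
apply/eqP; rewrite eq_le posf_outer_le_posf//=; last exact: cts_cst.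
rewrite lee_fin lb_le_inf//; first exact: posf_cover_nonempty.
move=> C [f [cf f0 fi fC fE]].
have [k fk] : exists k, forall x, 1 < f k x.
  apply: (@compact_nondecreasing_cover _ (fun k => [set x | 1 < f k x])) => //.
  - by move=> k; exact: open_gt.
  - move=> i j ij x /= /lt_le_trans; apply.
    by have /nondecreasing_seqP := fi ^~ x; exact.
  - by move=> x; exact: fE.
apply: le_trans (fC k); apply: posf_le => //; first exact: cts_cst.
by move=> x; exact/ltW.
Qed.

Lemma cts_bounded (f : T -> R) : continuous f -> exists2 M, 0 < M & forall x, f x <= M.
Proof.
move=> cf; have [k fk] : exists k, forall x, 0 < k%:R - f x.
  apply: (@compact_nondecreasing_cover _ (fun k => [set x | 0 < k%:R - f x])) => //.
  - by move=> k; apply: open_gt; apply: ctsB => //; exact: cts_cst.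
  - move=> i j ij x /= /lt_le_trans; apply.
    by rewrite lerD2r ler_nat.
  - move=> x; exists (Num.truncn (f x)).+1.
    by rewrite /= subr_gt0 truncnS_gt.
exists k.+1%:R; first by rewrite ltr0n.
move=> x; have := fk x; rewrite subr_gt0 => /ltW /le_trans; apply.
by rewrite ler_nat.
Qed.

(* The [i]-th horizontal slice of [n * f]. *)
Let phi (f : T -> R) (n i : nat) (x : T) : R := Num.max 0 (Num.min 1 (n%:R * f x - i%:R)).

Let phi_cts (f : T -> R) n i : continuous f -> continuous (phi f n i).
Proof.
move=> cf; apply: cts_max; first exact: cts_cst.
apply: cts_min; first exact: cts_cst.
by apply: ctsB; [apply: ctsM => //; exact: cts_cst|exact: cts_cst].
Qed.

Let phi_ge0 (f : T -> R) n i x : 0 <= phi f n i x.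
Proof. by rewrite le_max lexx. Qed.

Let phi_sum (f : T -> R) n x : 0 <= f x <= 1 -> \sum_(i < n) phi f n i x = n%:R * f x.
Proof.
move=> /andP[f0 f1].
have y0 : 0 <= n%:R * f x by rewrite mulr_ge0.
have yn : n%:R * f x <= n%:R by rewrite ler_piMr.
suff H m : \sum_(i < m) phi f n i x = Num.min (n%:R * f x) m%:R.
  by rewrite H min_l.
elim: m => [|m IH]; first by rewrite big_ord0 min_r.
rewrite big_ord_recr /= IH /phi -natr1.
have m0 : 0 <= m%:R :> R by [].
move: (m%:R : R) m0 (n%:R * f x) y0 => a a0 y y0 {yn IH}.
by rewrite /Num.max /Num.min; repeat case: ifPn; rewrite -?leNgt => *; lra.
Qed.

(** Slice [i.+1] is carried by a set on which slice [i] equals 1, so its integral is at most [p] of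
    slice [i]. After this shift only slice 0 is left over; it costs at most [p 1], which gets
    divided by [n]. *)
Let integral_le (f : T -> R) : continuous f -> (forall x, 0 <= f x <= 1) ->
  (\int[mu]_x (f x)%:E <= (p f)%:E)%E.
Proof.
move=> cf f01; apply/lee_addgt0Pr => e e0.
have p1 : 0 <= p (fun=> 1) by apply: posf_ge0 => //; exact: cts_cst.
set n := (Num.truncn (p (fun=> 1) / e)).+1.
have n0 : 0 < n%:R :> R by rewrite ltr0n.
have mf (g : T -> R) : continuous g -> measurable_fun [set: borel_type T]
    (EFin \o (g : borel_type T -> R)).
  by move=> cg; apply/measurable_EFinP; exact: cts_measurable.
have lev i : (\int[mu]_x (phi f n i x)%:E <= mu [set x | (0 < n%:R * f x - i%:R)%R])%E.
  have mU : measurable ([set x | 0 < n%:R * f x - i%:R] : set (borel_type T)).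
    apply: sub_sigma_algebra; apply: open_gt.
    by apply: ctsB; [apply: ctsM => //; exact: cts_cst|exact: cts_cst].
  rewrite -[X in (_ <= mu X)%E]setIT -integral_indic//.
  apply: ge0_le_integral => //.
  - by move=> x _; rewrite lee_fin phi_ge0.
  - by apply: mf; exact: phi_cts.
  - by apply/measurable_EFinP; exact: measurable_indic.
  - move=> x _; rewrite lee_fin indicE.
    case: (boolP (x \in _)) => [_|]; first by rewrite ge_max ler01 ge_min lexx.
    rewrite notin_setE /= => /negP; rewrite -leNgt => h.
    by rewrite ge_max lexx ge_min h orbT.
have lev' i : (\int[mu]_x (phi f n i.+1 x)%:E <= (p (phi f n i))%:E)%E.
  apply: le_trans (lev _) _; apply: posf_outer_le_posf => //.
    exact: phi_cts.
  move=> x /=; rewrite subr_gt0 -natr1 => h.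
  by rewrite le_max le_min lexx/= lerBrDl (ltW h) orbT.
have H : (n%:R%:E * \int[mu]_x (f x)%:E <= n%:R%:E * (p f)%:E + (p (fun=> 1))%:E)%E.
  rewrite -(ge0_integralZl mu measurableT (mf _ cf)) ?lee_fin//; last first.
    by move=> x _; rewrite lee_fin; have /andP[] := f01 x.
  under eq_integral do rewrite -EFinM -phi_sum// -sumEFin.
  rewrite (@ge0_integral_sum _ _ _ mu setT measurableT _ (fun i x => (phi f n (nat_of_ord i) x)%:E)) //=; last 2 first.
    by move=> i; apply: mf; exact: phi_cts.
    by move=> i x _; rewrite lee_fin phi_ge0.
  rewrite big_ord_recl /= addeC; apply: leeD; last first.
    by apply: le_trans (lev _) _; rewrite -posf_outer_setT; exact: posf_outer_le.
  apply: (@le_trans _ _ (\sum_(i < n.-1) (p (phi f n i))%:E)%E).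
    by apply: lee_sum => i _; exact: lev'.
  rewrite sumEFin -(@posf_sum _ _ p (phi f n)) -?EFinM ?lee_fin//; last first.
    by move=> i; exact: phi_cts.
  rewrite -posfZ//; last by move=> x; have /andP[] := f01 x.
  apply: posf_le.
  - by apply: cts_sum => i; exact: phi_cts.
  - by apply: ctsM => //; exact: cts_cst.
  - by move=> x; exact: sumr_ge0.
  - by move=> x; rewrite -(phi_sum _ (f01 x)) [leRHS]big_ord_recr/= lerDl.
have I0 : (\int[mu]_x (f x)%:E)%E \is a fin_num.
  rewrite ge0_fin_numE; last by apply: integral_ge0 => x _; rewrite lee_fin; have /andP[] := f01 x.
  by rewrite ltey; apply/negP => /eqP E; move: H; rewrite E gt0_muley ?lte_fin//.
rewrite -(fineK I0) in H *; rewrite -!EFinM -!EFinD !lee_fin in H *.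
rewrite -(ler_pM2l n0); apply: le_trans H _; rewrite mulrDr lerD2l.
by rewrite -ler_pdivrMr// ltW// truncnS_gt.
Qed.

(** The lower bound is the upper bound for [1 - f], as [mu] has total mass [p 1]. *)
Let integral_posf01 (f : T -> R) : continuous f -> (forall x, 0 <= f x <= 1) ->
  (\int[mu]_x (f x)%:E = (p f)%:E)%E.
Proof.
move=> cf f01; apply/eqP; rewrite eq_le integral_le//=.
have c1f : continuous (fun x => 1 - f x) by apply: ctsB => //; exact: cts_cst.
have f0 x : 0 <= f x by have /andP[] := f01 x.
have f1 x : 0 <= 1 - f x by rewrite subr_ge0; have /andP[] := f01 x.
have /integral_le : forall x, 0 <= 1 - f x <= 1.
  by move=> x; rewrite f1 lerBlDr lerDl f0.
move=> /(_ c1f) H.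
have E1 : p (fun=> 1) = p f + p (fun x => 1 - f x).
  by rewrite -posfD//; congr (p _); apply/funext => x; rewrite addrC subrK.
have mf (g : T -> R) : continuous g -> measurable_fun [set: borel_type T]
    (EFin \o (g : borel_type T -> R)).
  by move=> cg; apply/measurable_EFinP; exact: cts_measurable.
have E2 : (\int[mu]_x (f x)%:E + \int[mu]_x (1 - f x)%:E = (p (fun=> 1%R))%:E)%E.
  rewrite -ge0_integralD//; try (exact: mf).
  - rewrite -posf_outer_setT -[RHS]mul1e -(@integral_cst _ _ _ mu setT measurableT 1%E).
    by apply: eq_integral => x _; rewrite -EFinD addrC subrK.
  - by move=> x _; rewrite lee_fin.
  - by move=> x _; rewrite lee_fin.
have I0 : (0 <= \int[mu]_x (f x)%:E)%E.
  by apply: integral_ge0 => x _; rewrite lee_fin.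
have I1 : (0 <= \int[mu]_x (1 - f x)%:E)%E.
  by apply: integral_ge0 => x _; rewrite lee_fin.
move: H E2 I0 I1 (integral_le cf f01).
case: (integral mu setT (fun x => (f x)%:E)) => [a| |] //.
case: (integral mu setT (fun x => (1 - f x)%:E)) => [b| |] //.
rewrite -EFinD !lee_fin => h1 [h2]; lra.
Qed.

Lemma integral_posf (f : T -> R) : continuous f -> (forall x, 0 <= f x) ->
  (\int[mu]_x (f x)%:E = (p f)%:E)%E.
Proof.
move=> cf f0; have [M M0 fM] := cts_bounded cf.
have cg : continuous (fun x => M^-1 * f x) by apply: ctsM => //; exact: cts_cst.
have g0 x : 0 <= M^-1 * f x by rewrite mulr_ge0// invr_ge0 ltW.
have -> : f = (fun x => M * (M^-1 * f x)).
  by apply/funext => x; rewrite mulrA divff ?mul1r// gt_eqF.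
rewrite posfZ ?(ltW M0)// EFinM -integral_posf01//; last first.
  by move=> x; rewrite g0 ler_pdivrMl// mulr1 fM.
under eq_integral do rewrite EFinM.
rewrite ge0_integralZl ?lee_fin ?(ltW M0)//.
  by apply/measurable_EFinP; exact: cts_measurable.
by move=> x _; rewrite lee_fin.
Qed.

Lemma posf_measure_outer_regular (A : set T) (e : R) : 0 < e ->
  exists U, [/\ open U, A `<=` U & (mu U <= mu A + e%:E)%E].
Proof.
move=> e0; have [C [f [cf f0 fi fC fA]] CA] := posf_outer_adherent p A e0.
exists (\bigcup_k [set x | 1 < f k x]); split.
- by apply: bigcup_open => k _; exact: open_gt.
- by move=> x /fA[k fk]; exists k.
- apply: le_trans CA; apply: posf_outer_le_posf_cover; exists f; split=> // x [k _]; by exists k.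
Qed.

End posf_measure.

Record bounded_functional (R : realType) (T : topologicalType) := BoundedFunctional {
  bndf_fun :> (T -> R) -> R ;
  bndfD : forall f g : T -> R, continuous f -> continuous g ->
    bndf_fun (fun x => f x + g x) = bndf_fun f + bndf_fun g ;
  bndfZ : forall (c : R) (f : T -> R), continuous f ->
    bndf_fun (fun x => c * f x) = c * bndf_fun f ;
  bndf_bounded : exists K : R, forall (f : T -> R) (M : R), continuous f ->
    (forall x, `|f x| <= M) -> bndf_fun f <= K * M }.

(** * Riesz representation on an interval *)

Section bounded_functional_decomposition.
Context (R : realType) (T : ptopologicalType) (l : bounded_functional R T).
Context (cT : compact [set: T]).
Implicit Types f g u v : T -> R.

Let dom f := [set u : T -> R | continuous u /\ forall x, 0 <= u x <= f x].
(** The positive part of [l] in the sense of Riesz, meaningful for nonnegative [f]; hence a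
    [positive_functional] obeys its laws on such functions only. *)
Let pos f : R := sup [set l u | u in dom f].

Let l0 : l (fun=> 0) = 0.
Proof.
rewrite -[RHS](mul0r (l (fun=> 0))) -bndfZ; last exact: cts_cst.
by congr (l _); apply/funext => x; rewrite mul0r.
Qed.

Let dom0 f : (forall x, 0 <= f x) -> dom f (fun=> 0).
Proof. by move=> f0; split=> [|x]; [exact: cts_cst|rewrite lexx f0]. Qed.

Let pos_has_sup f : continuous f -> (forall x, 0 <= f x) ->
  has_sup [set l u | u in dom f].
Proof.
move=> cf f0; split; first by exists (l (fun=> 0)), (fun=> 0) => //; exact: dom0.
have [M M0 fM] := cts_bounded cT cf; have [K hK] := bndf_bounded l.
exists (K * M) => _ [u [cu uf] <-]; apply: hK => // x.
by have /andP[u0 ufx] := uf x; rewrite ger0_norm// (le_trans ufx).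
Qed.

Let le_pos f u : continuous f -> (forall x, 0 <= f x) -> dom f u -> l u <= pos f.
Proof. by move=> cf f0 fu; apply: sup_upper_bound; [exact: pos_has_sup|exists u]. Qed.

Let pos_le f (M : R) : continuous f -> (forall x, 0 <= f x) ->
  (forall u, dom f u -> l u <= M) -> pos f <= M.
Proof.
move=> cf f0 h; apply: ge_sup; first exact: (pos_has_sup cf f0).1.
by move=> _ [u fu <-]; exact: h.
Qed.

Let posD f g : continuous f -> continuous g ->
  (forall x, 0 <= f x) -> (forall x, 0 <= g x) ->
  pos (fun x => f x + g x) = pos f + pos g.
Proof.
move=> cf cg f0 g0; have cfg := ctsD cf cg.
have fg0 x : 0 <= f x + g x by rewrite addr_ge0.
apply/eqP; rewrite eq_le; apply/andP; split.
  apply: pos_le => // u [cu uf].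
  (* Riesz decomposition property: a function between 0 and [f + g] is the sum of one between 0 and
     [f] and one between 0 and [g]. *)
  have -> : u = (fun x => Num.min (u x) (f x) + (u x - Num.min (u x) (f x))).
    by apply/funext => x; rewrite addrC subrK.
  have cm : continuous (fun x => Num.min (u x) (f x)) by exact: cts_min.
  rewrite bndfD//; last exact: ctsB.
  apply: lerD; apply: le_pos => //; split=> //.
  - move=> x; have /andP[u0 _] := uf x.
    by rewrite le_min u0 f0 ge_min lexx orbT.
  - exact: ctsB.
  - move=> x; rewrite subr_ge0 ge_min lexx/= lerBlDr.
    have /andP[u0 ufg] := uf x; have := g0 x.
    by rewrite /Num.min; case: ifP => _ ?; lra.
rewrite -lerBrDr; apply: pos_le => // u fu; rewrite lerBrDl -lerBrDr.
apply: pos_le => // v gv; rewrite lerBrDr -bndfD; [|exact: gv.1|exact: fu.1].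
apply: le_pos => //; split; first by apply: ctsD; [exact: gv.1|exact: fu.1].
move=> x; have /andP[u0 u1] := fu.2 x; have /andP[v0 v1] := gv.2 x.
by rewrite addr_ge0//= [leRHS]addrC lerD.
Qed.

Let posZ_le (c : R) f : 0 < c -> continuous f -> (forall x, 0 <= f x) ->
  pos (fun x => c * f x) <= c * pos f.
Proof.
move=> c0 cf f0; apply: pos_le.
- by apply: ctsM => //; exact: cts_cst.
- by move=> x; rewrite mulr_ge0// ltW.
- move=> u [cu uf]; rewrite -ler_pdivrMl// -bndfZ//; apply: le_pos => //; split.
    by apply: ctsM => //; exact: cts_cst.
  move=> x; have /andP[u0 u1] := uf x.
  by rewrite mulr_ge0 ?invr_ge0 ?(ltW c0)//= ler_pdivrMl.
Qed.

Let posZ (c : R) f : 0 <= c -> continuous f -> (forall x, 0 <= f x) ->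
  pos (fun x => c * f x) = c * pos f.
Proof.
rewrite le_eqVlt => /predU1P[<- cf f0|c0 cf f0].
  rewrite mul0r; apply/eqP; rewrite eq_le; apply/andP; split.
    apply: pos_le => //.
    - by apply: ctsM => //; exact: cts_cst.
    - by move=> x; rewrite mul0r.
    - move=> u [_ u0]; suff -> : u = fun=> 0 by rewrite l0.
      apply/funext => x; apply/eqP; rewrite eq_le andbC.
      by have := u0 x; rewrite mul0r.
  rewrite -[X in X <= _]l0; apply: le_pos.
  - by apply: ctsM => //; exact: cts_cst.
  - by move=> x; rewrite mul0r.
  - by apply: dom0 => x; rewrite mul0r.
apply/eqP; rewrite eq_le posZ_le//= -ler_pdivlMl//.
(* The converse inequality is [posZ_le] for the factor [c^-1] and the function [c * f]. *)
apply: le_trans (posZ_le _ _ _); rewrite ?invr_gt0//.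
- rewrite le_eqVlt; apply/orP; left; apply/eqP; congr pos.
  by apply/funext => x; rewrite mulrA mulVf ?mul1r// gt_eqF.
- by apply: ctsM => //; exact: cts_cst.
- by move=> x; rewrite mulr_ge0// ltW.
Qed.

Let pos_ge0 f : continuous f -> (forall x, 0 <= f x) -> 0 <= pos f.
Proof. by move=> cf f0; rewrite -[X in X <= _]l0; apply: le_pos => //; exact: dom0. Qed.

Let neg f : R := pos f - l f.

Let negD f g : continuous f -> continuous g ->
  (forall x, 0 <= f x) -> (forall x, 0 <= g x) ->
  neg (fun x => f x + g x) = neg f + neg g.
Proof. by move=> cf cg f0 g0; rewrite /neg posD// bndfD// opprD addrACA. Qed.

Let negZ (c : R) f : 0 <= c -> continuous f -> (forall x, 0 <= f x) ->
  neg (fun x => c * f x) = c * neg f.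
Proof. by move=> c0 cf f0; rewrite /neg posZ// bndfZ// mulrBr. Qed.

Let neg_ge0 f : continuous f -> (forall x, 0 <= f x) -> 0 <= neg f.
Proof.
move=> cf f0; rewrite /neg subr_ge0; apply: le_pos => //; split=> // x.
by rewrite f0 lexx.
Qed.

Lemma bounded_functional_decomposition :
  exists p q : positive_functional R T, forall f, l f = p f - q f.
Proof.
exists (PositiveFunctional posD posZ pos_ge0).
exists (PositiveFunctional negD negZ neg_ge0) => f.
by rewrite /= /neg opprB addrC subrK.
Qed.

End bounded_functional_decomposition.

Definition outer_regular (R : realType) (T : ptopologicalType)
    (mu : set (borel_type T) -> \bar R) :=
  forall (A : set (borel_type T)) (e : R), measurable A -> 0 < e ->
    exists U, [/\ open U, A `<=` U & (mu U <= mu A + e%:E)%E].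

Lemma bounded_integrable d (T : measurableType d) (R : realType)
    (mu : {finite_measure set T -> \bar R}) (f : T -> R) (M : R) :
  measurable_fun setT f -> (forall x, `|f x| <= M) ->
  mu.-integrable setT (EFin \o f).
Proof.
move=> mf fM; apply: measurable_bounded_integrable => //.
  by rewrite fin_num_fun_lty//; exact: fin_num_measure.
by exists M; split; [exact: num_real|move=> x /ltW Mx y _; exact: le_trans (fM y) Mx].
Qed.

Section riesz_real.
Context (R : realType) (T : ptopologicalType) (l : bounded_functional R T).
Context (cT : compact [set: T]).
Context (cozero : forall U : set T, open U ->
  exists2 g : T -> R, continuous g & U = [set x | 0 < g x]).

Lemma cts_integrable (mu : {finite_measure set (borel_type T) -> \bar R}) (f : T -> R) :
  continuous f -> mu.-integrable setT (EFin \o (f : borel_type T -> R)).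
Proof.
move=> cf; have [M M0 fM] := cts_bounded cT cf.
have [M' M'0 fM'] : exists2 M, 0 < M & forall x, - f x <= M.
  apply: (cts_bounded cT (f := fun x => - f x)).
  by move=> x; apply: cvgN; exact: cf.
apply: (@bounded_integrable _ _ _ _ _ (M + M')); first exact: cts_measurable.
move=> x; have := fM x; have := fM' x; rewrite ler_norml => *.
by apply/andP; split; lra.
Qed.

Lemma riesz_real : exists m1 m2 : {finite_measure set (borel_type T) -> \bar R},
  [/\ outer_regular m1, outer_regular m2
    & forall f : T -> R, continuous f ->
        l f = \int[m1]_x f x - \int[m2]_x f x].
Proof.
have [p [q pq]] := bounded_functional_decomposition l cT.
exists (posf_measure p cozero), (posf_measure q cozero).
have regular (r : positive_functional R T) : outer_regular (posf_measure r cozero).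
  by move=> A e _; exact: posf_measure_outer_regular.
split; [exact: regular|exact: regular|].
(* [integral_posf] speaks of nonnegative functions only, hence the split of [f] into positive and
   negative part. *)
move=> f cf; pose fp x := Num.max (f x) 0; pose fn x := Num.max (- f x) 0.
have cN : continuous (fun x => - f x) by move=> x; apply: cvgN; exact: cf.
have cfp : continuous fp by apply: cts_max => //; exact: cts_cst.
have cfn : continuous fn by apply: cts_max => //; exact: cts_cst.
have fp0 x : 0 <= fp x by rewrite /fp le_max lexx orbT.
have fn0 x : 0 <= fn x by rewrite /fn le_max lexx orbT.
have fE x : f x = fp x - fn x.
  by rewrite /fp /fn /Num.max; repeat case: ifPn; rewrite -?leNgt => *; lra.
have lE : l f = l fp - l fn.
  apply/eqP; rewrite eq_sym subr_eq -bndfD//; apply/eqP; congr (l _).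
  by apply/funext => x; rewrite fE subrK.
have int (r : positive_functional R T) :
    \int[posf_measure r cozero]_x f x = r fp - r fn.
  have E (g : T -> R) : continuous g -> (forall x, 0 <= g x) ->
      \int[posf_measure r cozero]_x g x = r g.
    by move=> cg g0; rewrite /Rintegral integral_posf.
  rewrite -!E// -RintegralB//; try exact: cts_integrable.
  by apply: eq_Rintegral => x _; exact: fE.
by rewrite !int lE !pq; lra.
Qed.

End riesz_real.

Lemma lipschitz1_continuous (R : realType) (g : R -> R) :
  (forall x y, g x <= g y + `|x - y|) -> continuous g.
Proof.
move=> gL x; apply/cvgrPdist_le => e e0.
near=> y; have xy : `|x - y| <= e.
  by near: y; apply: cvgr_dist_le.
rewrite ler_norml; have := gL x y; have := gL y x.
rewrite (distrC y x) => h1 h2; apply/andP; split; lra.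
Unshelve. all: by end_near. Qed.

(** [sup (S x)] is the distance from [x] to the complement of [V], capped at 1 so that it stays
    finite when [V] is the whole line. Such a function is 1-Lipschitz. *)
Lemma open_cozero (R : realType) (V : set R) : open V ->
  exists2 g : R -> R, continuous g & V = [set x | 0 < g x].
Proof.
move=> oV; pose S x := [set r : R | 0 <= r <= 1 /\ forall y, `|y - x| < r -> V y].
have S0 x : S x 0.
  by split; [rewrite lexx ler01|move=> y; rewrite ltNge normr_ge0].
have supS x : has_sup (S x).
  by split; [exists 0|exists 1 => r [/andP[]]].
exists (fun x => sup (S x)).
  apply: lipschitz1_continuous => x y; apply: ge_sup; first by exists 0.
  move=> r [/andP[r0 r1] hr]; rewrite -lerBlDr.
  have [h|h] := leP (r - `|x - y|) 0.
    by apply: le_trans h _; exact: sup_upper_bound.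
  apply: sup_upper_bound => //; split.
    by rewrite (ltW h) (le_trans _ r1)// lerBlDr lerDl.
  move=> z hz; apply: hr; rewrite -(subrKA y) (le_lt_trans (ler_normD _ _))//.
  by rewrite distrC [`|y - x|]distrC -ltrBrDr [`|y - z|]distrC.
apply/seteqP; split => x /=.
  move=> Vx; have /nbhs_ballP[e /= e0 eV] : nbhs x V by exact: open_nbhs_nbhs.
  apply: (@lt_le_trans _ _ (Num.min 1 e)); first by rewrite lt_min ltr01.
  apply: sup_upper_bound => //; split; first by rewrite le_min ler01 (ltW e0) ge_min lexx.
  by move=> y; rewrite lt_min => /andP[_ ?]; apply: eV; rewrite /ball/= distrC.
move=> /(@sup_gt R) [|r [_ hr] r0]; first by exists 0.
by apply: hr; rewrite subrr normr0.
Qed.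

Section interval_topology.
Context (R : realType) (h : {posnum R}).

Lemma Ival_continuous : continuous (@Ival R h).
Proof. exact: initial_continuous. Qed.

Lemma Ival_itv (s : I_ h) : - h%:num <= Ival s <= 0.
Proof. by have := set_valP s; rewrite /= in_itv. Qed.

Lemma clampI_subproof (t : R) : Num.max (- h%:num) (Num.min t 0) \in `[- h%:num, 0]%classic.
Proof.
by rewrite inE /= in_itv /= le_max lexx/= ge_max oppr_le0 ge0 ge_min lexx orbT.
Qed.

(** The nearest-point retraction of the line onto the interval. It transports compactness and cozero
    sets to [I_ h], and later extends initial maps by constants to the line. *)
Definition clampI (t : R) : I_ h :=
  exist _ (Num.max (- h%:num) (Num.min t 0)) (clampI_subproof t).

Lemma Ival_clampI t : Ival (clampI t) = Num.max (- h%:num) (Num.min t 0).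
Proof. by []. Qed.

Lemma clampI_id t : - h%:num <= t <= 0 -> Ival (clampI t) = t.
Proof. by move=> /andP[h1 h2]; rewrite Ival_clampI (min_l h2) max_r. Qed.

Lemma IvalK : cancel (@Ival R h) clampI.
Proof. by move=> s; apply: val_inj; exact: clampI_id (Ival_itv s). Qed.

Lemma clampI_continuous : continuous clampI.
Proof.
apply: continuous_comp_initial => t.
have : continuous (fun t : R => Num.max (- h%:num) (Num.min t 0)).
  by apply: cts_max; [exact: cts_cst|apply: cts_min; [by move=> ?|exact: cts_cst]].
exact.
Qed.

Lemma compactI : compact [set: I_ h].
Proof.
have -> : [set: I_ h] = clampI @` `[- h%:num, 0]%classic.
  apply/seteqP; split=> // s _; exists (Ival s); last exact: IvalK.
  by rewrite /= in_itv/= Ival_itv.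
apply: continuous_compact; last exact: segment_compact.
by apply: continuous_subspaceT; exact: clampI_continuous.
Qed.

Lemma cozeroI (U : set (I_ h)) : open U ->
  exists2 g : I_ h -> R, continuous g & U = [set x | 0 < g x].
Proof.
move=> oU; have [|g cg gE] := @open_cozero R (clampI @^-1` U).
  by apply: open_comp => // t _; exact: clampI_continuous.
exists (g \o @Ival R h).
  by move=> s; apply: continuous_comp; [exact: Ival_continuous|exact: cg].
apply/seteqP; split=> s /=; have /seteqP[h1 h2] := gE.
  by move=> Us; apply: h1; rewrite /= IvalK.
by move/h2; rewrite /= IvalK.
Qed.

End interval_topology.

Lemma fin_num_subr_eq (R : realDomainType) (a b c d : \bar R) :
  a \is a fin_num -> b \is a fin_num -> c \is a fin_num -> d \is a fin_num ->
  (a - b = c - d)%E -> (c + b = a + d)%E.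
Proof.
move=> /fineK <- /fineK <- /fineK <- /fineK <-.
rewrite -!EFinN -!EFinD => -[e]; congr (_%:E).
have -> : fine c = fine a - fine b + fine d by rewrite e subrK.
by rewrite addrAC subrK.
Qed.

Section charge_integral.
Context (R : realType) (h : {posnum R}).
Local Notation T := (BorelI h).

Definition charge_diff (m1 m2 : {finite_measure set T -> \bar R}) :
    {charge set T -> \bar R} :=
  cadd (charge_of_finite_measure m1) (copp (charge_of_finite_measure m2)).

(* The Hahn decomposition chosen in [charge_integral] is irrelevant: with [jp], [jn]
   the Jordan parts, [jp + m2] and [m1 + jn] are the same measure. *)
Lemma charge_integral_diff (m1 m2 : {finite_measure set T -> \bar R})
    (f : T -> R) (M : R) : measurable_fun setT f -> (forall x, `|f x| <= M) ->
  charge_integral (charge_diff m1 m2) f = \int[m1]_x f x - \int[m2]_x f x.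
Proof.
move=> mf fM; rewrite /charge_integral.
set HP := cid _; set HN := cid _; set nuPN := projT2 HN.
have intf (mu : {finite_measure set T -> \bar R}) : mu.-integrable setT (EFin \o f).
  exact: bounded_integrable fM.
set jp := jordan_pos nuPN; set jn := jordan_neg nuPN.
have E : (\int[measure_add jp m2]_x (f x)%:E = \int[measure_add m1 jn]_x (f x)%:E)%E.
  apply: eq_measure_integral => A mA _.
  suff EA : (jp A + m2 A = m1 A + jn A)%E.
    exact: etrans (measure_addE jp m2 A) (etrans EA (esym (measure_addE m1 jn A))).
  apply: fin_num_subr_eq; try exact: fin_num_measure.
  by have := jordan_decomp nuPN mA; rewrite /cadd/= cscaleN1.
have E' := etrans (esym (integral_measure_add measurableT (intf jp) (intf m2)))
  (etrans E (integral_measure_add measurableT (intf m1) (intf jn))).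
have F (mu : {finite_measure set T -> \bar R}) : (\int[mu]_x (f x)%:E)%E \is a fin_num.
  by apply: integrable_fin_num => //; exact: intf.
rewrite /Rintegral.
move: (F jp) (F jn) (F m1) (F m2) E' => /fineK <- /fineK <- /fineK <- /fineK <-.
by rewrite -!EFinD => -[e] /=; lra.
Qed.

End charge_integral.

(** * Complex norms and coordinates *)

Local Open Scope complex_scope.
Local Notation normc := Normc.normc.

Section complex_norm.
Context (R : realType).
Implicit Types z : R[i].

Lemma rnorm_CplxE (z : Cplx R) : rnorm z = normc z.
Proof. by []. Qed.

Lemma normc_ge0 z : 0 <= normc z.
Proof. exact: (@rnorm_ge0 R (Cplx R) z). Qed.

Lemma normRe_le z : `|complex.Re z| <= normc z.
Proof.
case: z => a b /=; rewrite -sqrtr_sqr ler_wsqrtr// lerDl; exact: sqr_ge0.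
Qed.

Lemma normIm_le z : `|complex.Im z| <= normc z.
Proof.
case: z => a b /=; rewrite -sqrtr_sqr ler_wsqrtr// lerDr; exact: sqr_ge0.
Qed.

Lemma normc_real (x : R) : normc x%:C = `|x|.
Proof. by rewrite /= expr0n /= addr0 sqrtr_sqr. Qed.

Lemma normc_le z : normc z <= `|complex.Re z| + `|complex.Im z|.
Proof.
case: z => a b; have -> : Complex a b = Complex a 0 + Complex 0 b.
  by rewrite [RHS]/GRing.add /= addr0 add0r.
rewrite (le_trans (le_normcD _ _))//= addr0 add0r.
by rewrite expr0n/= addr0 add0r !sqrtr_sqr.
Qed.

End complex_norm.

Section rnorm_cvg.
Context (R : realType) (X : normedModType R[i]).

Lemma rnorm0 : rnorm (0 : X) = 0.
Proof. by rewrite /rnorm normr0. Qed.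

Lemma rnormN (x : X) : rnorm (- x) = rnorm x.
Proof. by rewrite /rnorm normrN. Qed.

Lemma rnormB (x y : X) : rnorm (x - y) = rnorm (y - x).
Proof. by rewrite -rnormN opprB. Qed.

Lemma cvg_rnormP T (F : set_system T) {FF : Filter F} (f : T -> X) (l : X) :
  f @ F --> l <-> rnorm (f x - l) @[x --> F] --> (0 : R).
Proof.
split=> [/cvgrPdist_lt fl|/cvgrPdist_lt fl].
  apply/cvgrPdist_lt => e e0; have := fl e%:C; rewrite ltcR => /(_ e0).
  apply: filterS => x; rewrite sub0r normrN ger0_norm ?rnorm_ge0//.
  by rewrite -rnormE ltcR rnormB.
apply/cvgrPdist_lt => -[e e'] /[dup] e0; rewrite ltcE /= => /andP[/eqP ? e0'].
have := fl e e0'; apply: filterS => x.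
rewrite sub0r normrN ger0_norm ?rnorm_ge0// => fe.
by rewrite -rnormE rnormB ltcE /=; apply/andP; split=> //; apply/eqP.
Qed.

End rnorm_cvg.

Lemma cvg_ReIm (R : realType) T (F : set_system T) {FF : Filter F}
    (f : T -> Cplx R) (l : Cplx R) :
  f @ F --> l <->
  (complex.Re (f x : R[i]) @[x --> F] --> complex.Re (l : R[i])) /\
  (complex.Im (f x : R[i]) @[x --> F] --> complex.Im (l : R[i])).
Proof.
split=> [/cvg_rnormP/cvgrPdist_lt fl|[/cvgrPdist_lt fr /cvgrPdist_lt fi]].
  have dist e : 0 < e -> \forall x \near F, normc (f x - l) < e.
    move=> e0; have := fl e e0; apply: filterS => x.
    by rewrite sub0r normrN ger0_norm ?rnorm_ge0.
  split; apply/cvgrPdist_lt => e /dist; apply: filterS => x; apply: le_lt_trans.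
    by rewrite distrC; have := normRe_le (f x - l : R[i]); rewrite raddfB.
  by rewrite distrC; have := normIm_le (f x - l : R[i]); rewrite raddfB.
apply/cvg_rnormP/cvgrPdist_lt => e e0; have e20 : 0 < e / 2 by rewrite divr_gt0.
near=> x; rewrite sub0r normrN ger0_norm ?rnorm_ge0//.
apply: (le_lt_trans (normc_le _)).
rewrite !raddfB /= [ltRHS](splitr e) -(distrC (complex.Re l)) -(distrC (complex.Im l)).
by apply: ltrD; near: x; [exact: fr|exact: fi].
Unshelve. all: by end_near. Qed.

Lemma cvg_realC (R : realType) T (F : set_system T) {FF : Filter F}
    (f : T -> R) (l : R) :
  f @ F --> l -> (fun x => (f x)%:C : Cplx R) @ F --> (l%:C : Cplx R).
Proof. by move=> fl; apply/cvg_ReIm; split=> //=; exact: cvg_cst. Qed.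

Lemma Lc_bounded (R : realType) (X Y : normedModType R[i]) (L : Lc X Y) :
  exists2 K : R, 0 <= K & forall x, rnorm (L x) <= K * rnorm x.
Proof.
have /linear_bounded_continuous/linear_boundedP/pinfty_ex_gt0[r r0 Lr] :=
  @Lc_continuous _ _ _ L.
exists (normc r); first exact: normc_ge0.
move=> x; rewrite -lecR rmorphM /= !rnormE (_ : (normc r)%:C = `|r|)//.
by rewrite gtr0_norm.
Qed.

Section Cn_coordinates.
Context (R : realType) (n : nat) (N : cnorm R n).
Local Notation V := 'rV[R[i]]_n.
Implicit Types x y : V.

Lemma cnorm_ge0 x : 0 <= N x.
Proof. exact: (@rnorm_ge0 R (Cn N) x). Qed.

Lemma cnorm0 : N 0 = 0.
Proof. exact: (@rnorm0 R (Cn N)). Qed.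

Lemma cnorm_dist x y : `|N x - N y| <= N (x - y).
Proof. exact: (@rnorm_dist R (Cn N)). Qed.

Lemma cnorm_sum (I : Type) (s : seq I) (F : I -> V) :
  N (\sum_(i <- s) F i) <= \sum_(i <- s) N (F i).
Proof.
elim: s => [|i s IH]; first by rewrite !big_nil cnorm0.
by rewrite !big_cons (le_trans (cnormD _ _ _))// lerD2l.
Qed.

Lemma cnorm_le_coord : exists2 C, 0 <= C & forall x (M : R),
  (forall k, normc (x 0 k) <= M) -> N x <= C * M.
Proof.
exists (\sum_(k < n) N (delta_mx 0 k)); first by apply: sumr_ge0 => k _; exact: cnorm_ge0.
move=> x M xM; rewrite {1}(row_sum_delta x) (le_trans (cnorm_sum _ _))// mulr_suml.
apply: ler_sum => k _; rewrite cnormZ mulrC ler_wpM2l//; exact: cnorm_ge0.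
Qed.

Let c (u : 'rV[R]_(n + n)) : V := \row_k (u 0 (lshift n k) +i* u 0 (rshift n k)).

Let cB u v : c (u - v) = c u - c v.
Proof. by apply/rowP => k; rewrite !mxE. Qed.

Let cZ (a : R) u : c (a *: u) = a%:C *: c u.
Proof. by apply/rowP => k; rewrite !mxE; simpc. Qed.

Let coord_le_norm (u : 'rV[R]_(n + n)) i : `|u 0 i| <= `|u|.
Proof.
rewrite [leRHS]/Num.norm /= mx_normrE.
by apply/bigmax_geP; right => /=; exists (0, i).
Qed.

(* Equivalence of norms, by compactness of the unit sphere of R^(2n). *)
Lemma coord_le_cnorm : exists2 C, 0 <= C & forall x k, normc (x 0 k) <= C * N x.
Proof.
have [C C0 hC] := cnorm_le_coord.
pose g u := N (c u).
have cg : continuous g.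
  move=> u; apply/(@cvgrPdist_le _ _ _ (nbhs u) (nbhs_filter u)) => e e0.
  have d0 : 0 < e / (C * 2 + 1) by rewrite divr_gt0// ltr_wpDl// mulr_ge0.
  have := nbhsx_ballx u _ d0; apply: filterS => v uv.
  rewrite /g (le_trans (cnorm_dist _ _))// -cB.
  apply: (@le_trans _ _ (C * (2 * (e / (C * 2 + 1))))).
    apply: hC => k; rewrite mxE (le_trans (normc_le _))//= mulrDl mul1r !mxE.
    by apply: lerD; apply: ltW; exact: (uv.2 0).
  have de : (C * 2 + 1) * (e / (C * 2 + 1)) = e.
    by rewrite mulrC divfK// gt_eqF// ltr_wpDl// mulr_ge0.
  by rewrite -[leRHS]de; move: (e / _) d0 => d d0; nra.
pose S := [set u : 'rV[R]_(n + n) | `|u| = 1].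
have cS : compact S.
  apply: bounded_closed_compact.
    by exists 1; split; [exact: num_real|move=> M /ltW M1 u /= ->].
  rewrite (_ : S = (fun u => `|u|) @^-1` [set 1])//.
  by apply: closed_comp => [u _|]; [exact: norm_continuous|exact: closed_eq].
have sphere (u : 'rV[R]_(n + n)) : u != 0 -> S (`|u|^-1 *: u).
  move=> u0; rewrite /S /= normrZ normfV normr_id mulVf// normr_eq0//.
pose x2u (x : V) : 'rV[R]_(n + n) := row_mx (map_mx (@complex.Re R) x) (map_mx (@complex.Im R) x).
have cK x : c (x2u x) = x.
  apply/rowP => k; rewrite !mxE.
  case: splitP => [j /= /val_inj <-|j /= E]; last by have := ltn_ord k; rewrite E ltnNge leq_addr.
  case: splitP => [j' /= E|j' /= /addnI/val_inj <-].
    by have := ltn_ord j'; rewrite -E ltnNge leq_addr.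
  by rewrite !mxE; case: (x _ _).
(* An empty unit sphere, as for [n = 0], has no minimum of [g]; then every vector is zero. *)
have [S0|/set0P S0] := eqVneq S set0.
  exists 0 => // x k; rewrite -[x]cK.
  have [->|/sphere] := eqVneq (x2u x) 0; last by rewrite S0.
  by rewrite !mxE /= expr0n addr0 sqrtr0 mul0r.
have [u0 Su0 min] := compact_EVT_min S0 cS (continuous_subspaceT cg).
have g0 : 0 < g u0.
  rewrite lt_neqAle cnorm_ge0 andbT eq_sym; apply/eqP => /cnorm_eq0 E.
  have : u0 = 0.
    have E0 k : c u0 0 k = 0 by rewrite E mxE.
    apply/rowP => i; rewrite -(splitK i) /unsplit.
    by case: (fintype.split i) => j; have := E0 j; rewrite !mxE => -[].
  by move=> u00; move: Su0; rewrite inE /S u00 /= normr0 => /esym/eqP; rewrite oner_eq0.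
(* By homogeneity the minimum [g u0] on the sphere gives [|u| * g u0 <= N x]; the 2 bounds the
   modulus of a coordinate by its real and imaginary parts. *)
exists (2 / g u0); first by rewrite divr_ge0// ltW.
move=> x k; set u := x2u x.
have ux : `|u| * g u0 <= N x.
  have [->|un0] := eqVneq u 0; first by rewrite normr0 mul0r cnorm_ge0.
  have := min (`|u|^-1 *: u); rewrite inE => /(_ (sphere _ un0)).
  rewrite /g cZ cK cnormZ normc_real normfV normr_id mulrC.
  by rewrite ler_pdivlMr ?normr_gt0// mulrC.
rewrite mulrAC ler_pdivlMr// -{1}(cK x) -/u.
apply: (@le_trans _ _ (2 * `|u| * g u0)); last by rewrite -mulrA ler_wpM2l.
rewrite ler_wpM2r ?(ltW g0)// mxE (le_trans (normc_le _))//= mulrDl mul1r.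
by apply: lerD; exact: coord_le_norm.
Unshelve. all: by end_near. Qed.

End Cn_coordinates.

(** * Regular complex measures and the complex Riesz representation *)

Section total_variation_theory.
Context (R : realType) (h : {posnum R}) (mu : cmeasure h).
Local Notation T := (BorelI h).
Local Notation TV := (Defs.total_variation mu).
Implicit Types A B : set T.

Let nv A : \bar R := (normc (cm_val mu A))%:E.

Let nv_ge0 A : (0 <= nv A)%E.
Proof. by rewrite lee_fin normc_ge0. Qed.

Lemma cm_valDI A B : measurable A -> measurable B ->
  cm_val mu A = cm_val mu (A `\` B) + cm_val mu (A `&` B).
Proof.
move=> mA mB; have fin (nu : {charge set T -> \bar R}) :
    fine (nu A) = fine (nu (A `\` B)) + fine (nu (A `&` B)).
  rewrite (chargeDI nu mA mB) fineD//; apply: fin_num_measure.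
    exact: measurableD.
  exact: measurableI.
by rewrite /cm_val !fin.
Qed.

Lemma total_variation_mono A B : measurable A -> measurable B -> A `<=` B ->
  (TV A <= TV B)%E.
Proof.
move=> mA mB AB; apply: ge_ereal_sup => _ [F [mF tF UF] <-].
(* A partition of [A] becomes one of [B] by prepending the difference of [B] and [A]. *)
pose G k := if k is k'.+1 then F k' else B `\` A.
have mG k : measurable (G k) by case: k => [|k]; [exact: measurableD|exact: mF].
have FA k x : F k x -> A x by move=> Fx; rewrite -UF; exists k.
apply: (@le_trans _ _ (\sum_(0 <= k <oo) nv (G k))%E); last first.
  apply: ereal_sup_ubound; exists G => //; split=> //.
    apply/trivIsetP => -[|i] [|j] _ _ //= ij.
    - by apply/seteqP; split=> // x [[_ Ax] /FA].
    - by apply/seteqP; split=> // x [/FA ? []].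
    - by move/trivIsetP: tF; apply.
  apply/seteqP; split=> x.
    by case=> -[|k] _ /=; [case|move/FA/AB].
  move=> Bx; have [Ax|Ax] := pselect (A x); last by exists 0%N.
  by move: Ax; rewrite -UF => -[k _ Fx]; exists k.+1.
apply: lime_le; first by apply: is_cvg_nneseries => k _ _; exact: nv_ge0.
apply: nearW => k; apply: le_trans (nneseries_lim_ge k.+1 _); last first.
  by move=> *; exact: nv_ge0.
by rewrite big_nat_recl//= -[leLHS]add0e; apply: leeD.
Qed.

Lemma total_variation_splitD A B : measurable A -> measurable B -> A `<=` B ->
  (TV B <= TV A + TV (B `\` A))%E.
Proof.
move=> mA mB AB; apply: ge_ereal_sup => _ [F [mF tF UF] <-].
apply: (@le_trans _ _ (\sum_(0 <= k <oo) (nv (F k `&` A) + nv (F k `\` A)))%E).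
  apply: lee_nneseries => [k _ _|k _]; first exact: nv_ge0.
  rewrite -EFinD lee_fin (cm_valDI (mF k) mA) addrC; exact: le_normcD.
rewrite nneseriesD; last 2 first.
- by move=> k _ _; exact: nv_ge0.
- by move=> k _ _; exact: nv_ge0.
have tsub (G : nat -> set T) : (forall k, G k `<=` F k) -> trivIset setT G.
  move=> GF; apply/trivIsetP => i j _ _ ij; apply/seteqP; split=> // x [/GF Fi /GF Fj].
  by have /trivIsetP/(_ i j I I ij)/seteqP[+ _] := tF; exact.
apply: leeD; apply: ereal_sup_ubound.
- exists (fun k => F k `&` A) => //; split.
  + by move=> k; exact: measurableI.
  + by apply: tsub => k; exact: subIsetl.
  + by rewrite -setI_bigcupl UF; apply/setIidr.
- exists (fun k => F k `\` A) => //; split.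
  + by move=> k; exact: measurableD.
  + by apply: tsub => k; exact: subDsetl.
  + by rewrite -setD_bigcupl UF.
Qed.

Lemma total_variation_le (m : {finite_measure set T -> \bar R}) A :
  (forall B, measurable B -> ((normc (cm_val mu B))%:E <= m B)%E) ->
  (TV A <= m A)%E.
Proof.
move=> mum; apply: ge_ereal_sup => _ [F [mF tF UF] <-].
rewrite -UF measure_semi_bigcup//; last exact: bigcup_measurable.
by apply: lee_nneseries => [k _ _|k _]; [exact: nv_ge0|exact: mum].
Qed.

(** Regularity is inherited from a finite measure [m] that dominates the moduli: differences that
    are small for [m] are small for the total variation. Inner regularity is outer regularity of the
    complement, because complements of open sets are compact here. *)
Lemma regular_total_variation (m : {finite_measure set T -> \bar R}) :
  outer_regular m ->
  (forall B, measurable B -> ((normc (cm_val mu B))%:E <= m B)%E) ->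
  regular_measure TV.
Proof.
move=> rm mum A mA.
have mopen (U : set T) : open (U : set (I_ h)) -> measurable U.
  by move=> oU; exact: sub_sigma_algebra.
have diff (B C : set T) e : measurable B -> measurable C -> B `<=` C -> 0 < e ->
    (m C <= m B + e%:E)%E -> (TV (C `\` B) <= e%:E)%E.
  move=> mB mC BC e0 CBe; apply: (le_trans (total_variation_le _ mum)).
  rewrite measureD//; last by rewrite -ge0_fin_numE// fin_num_measure.
  by rewrite (setIidr BC) leeBlDl// fin_num_measure.
split; apply/eqP; rewrite eq_le; apply/andP; split.
- apply: le_ereal_inf_tmp => _ [U [oU AU] <-].
  by apply: total_variation_mono => //; exact: mopen.
- apply/lee_addgt0Pr => e e0; have [U [oU AU UAe]] := rm A e mA e0.
  apply: (@le_trans _ _ (TV U)).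
    by apply: ereal_inf_lbound; exists U.
  apply: le_trans (total_variation_splitD mA (mopen _ oU) AU) _.
  by apply: leeD => //; apply: diff => //; exact: mopen.
- apply/lee_addgt0Pr => e e0.
  have [U [oU AU UAe]] := rm (~` A) e (measurableC mA) e0.
  have cK : compact (~` U : set (I_ h)).
    by apply: (subclosed_compact _ (@compactI R h)) => //; exact: open_closedC.
  have KA : ~` U `<=` A by move=> x Ux; apply: contrapT => Ax; exact/Ux/AU.
  have mK : measurable (~` U : set T) by apply: measurableC; exact: mopen.
  apply: le_trans (total_variation_splitD mK mA KA) _.
  apply: leeD; first by apply: ereal_sup_ubound; exists (~` U).
  rewrite setDE setCK setIC -[A]setCK -setDE.
  by apply: diff => //; [exact: measurableC|exact: mopen].
- apply: ge_ereal_sup => _ [K [cK KA] <-].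
  apply: total_variation_mono => //; rewrite -[K]setCK; apply: measurableC.
  apply: mopen; apply: closed_openC.
  (* Compact sets are Borel: [K] is the preimage of its image in the line, which is compact and
     therefore closed. *)
  have -> : K = @Ival R h @^-1` (@Ival R h @` K).
    apply/seteqP; split=> [x Kx|x [y Ky /(can_inj (@IvalK R h)) <-]//]; by exists x.
  apply: closed_comp => [x _|]; first exact: Ival_continuous.
  apply: compact_closed; first exact: norm_hausdorff.
  apply: continuous_compact => //.
  by apply: continuous_subspaceT; exact: Ival_continuous.
Qed.

End total_variation_theory.

Section riesz_complex.
Context (R : realType) (h : {posnum R}).

Lemma realC_subproof (f : I_ h -> R) : continuous f ->
  continuous (fun s => (f s)%:C : Cplx R).
Proof. by move=> cf s; apply: (@cvg_realC _ _ (nbhs s)); exact: cf. Qed.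

Definition realC (f : I_ h -> R) (cf : continuous f) : C_c h :=
  mkcts (realC_subproof cf).

Lemma cfunP (X : normedModType R[i]) (f g : cfun h X) : f =1 g -> f = g.
Proof. by move=> fg; apply/continuousEP. Qed.

Section real_part.
Context (lam : dual (C_c h)) (part : R[i] -> R).
Context (partD : forall x y, part (x + y) = part x + part y).
Context (partZ : forall (c : R) x, part (c%:C * x) = c * part x).
Context (part_le : forall x, `|part x| <= normc x).

(** A [bounded_functional] acts on all functions, while [lam] wants a proof of continuity, hence the
    case distinction; the default value 0 is arbitrary. *)
Let l (f : I_ h -> R) : R :=
  if pselect (continuous f) is left cf then part (lam (realC cf)) else 0.

Let lE (f : I_ h -> R) (cf : continuous f) : l f = part (lam (realC cf)).
Proof.
by rewrite /l; case: pselect => // cf'; congr (part (lam _)); exact: cfunP.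
Qed.

Let lD (f g : I_ h -> R) : continuous f -> continuous g ->
  l (fun x => f x + g x) = l f + l g.
Proof.
move=> cf cg; rewrite (lE cf) (lE cg) (lE (ctsD cf cg)) -partD.
congr part; rewrite -[RHS](linearD lam); congr (lam _).
by apply: cfunP => s; exact: (rmorphD (real_complex R)).
Qed.

Let lZ (c : R) (f : I_ h -> R) : continuous f -> l (fun x => c * f x) = c * l f.
Proof.
move=> cf; have ccf : continuous (fun x => c * f x).
  by apply: ctsM => //; exact: cts_cst.
rewrite (lE cf) (lE ccf) -partZ; congr part.
have := linearZ_LR lam c%:C (realC cf); rewrite /GRing.scale /= => <-.
by congr (lam _); apply: cfunP => s; exact: (rmorphM (real_complex R)).
Qed.

Let l_bounded : exists K : R, forall (f : I_ h -> R) (M : R), continuous f ->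
  (forall x, `|f x| <= M) -> l f <= K * M.
Proof.
have [K K0 lamK] := Lc_bounded lam; exists K => f M cf fM.
rewrite (lE cf) (le_trans (ler_norm _))// (le_trans (part_le _))//.
apply: le_trans (lamK _) _; rewrite ler_wpM2l// rnorm_cfunE.
by apply: cfun_supnorm_le => s; rewrite rnorm_CplxE normc_real.
Qed.

Lemma riesz_part : exists m1 m2 : {finite_measure set (BorelI h) -> \bar R},
  [/\ outer_regular m1, outer_regular m2
    & forall (f : I_ h -> R) (cf : continuous f),
        part (lam (realC cf)) = charge_integral (charge_diff m1 m2) f].
Proof.
have [m1 [m2 [r1 r2 E]]] := riesz_real (BoundedFunctional lD lZ l_bounded)
  (@compactI R h) (@cozeroI R h).
exists m1, m2; split=> // f cf.
have [M M0 fM] := cts_bounded (@compactI R h) (f := fun x => `|f x|)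
  (fun x => cvg_norm (cf x)).
rewrite -(lE cf) (charge_integral_diff m1 m2 (cts_measurable cf) fM).
exact: E.
Qed.

End real_part.

Lemma outer_regularD (m1 m2 m : {finite_measure set (BorelI h) -> \bar R}) :
  (forall A, m A = m1 A + m2 A)%E ->
  outer_regular m1 -> outer_regular m2 -> outer_regular m.
Proof.
move=> mE r1 r2 A e mA e0; have e20 : 0 < e / 2 by rewrite divr_gt0.
have [U1 [oU1 AU1 U1e]] := r1 A _ mA e20; have [U2 [oU2 AU2 U2e]] := r2 A _ mA e20.
have oU := openI oU1 oU2.
exists (U1 `&` U2); split=> //; first by move=> x Ax; split; [exact: AU1|exact: AU2].
rewrite !mE [e in (_ <= _ + e%:E)%E]splitr EFinD addeACA; apply: leeD.
- apply: le_trans U1e; apply: le_measure; rewrite ?inE; try exact: sub_sigma_algebra.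
  exact: subIsetl.
- apply: le_trans U2e; apply: le_measure; rewrite ?inE; try exact: sub_sigma_algebra.
  exact: subIsetr.
Qed.

Lemma finite_measureD (m1 m2 : {finite_measure set (BorelI h) -> \bar R}) :
  outer_regular m1 -> outer_regular m2 ->
  exists2 m : {finite_measure set (BorelI h) -> \bar R},
    (forall A, m A = m1 A + m2 A)%E & outer_regular m.
Proof.
move=> r1 r2.
have fm : fin_num_fun (measure_add m1 m2).
  move=> A mA; rewrite (measure_addE m1 m2 A).
  by rewrite fin_numD !fin_num_measure.
pose m : {finite_measure set (BorelI h) -> \bar R} := HB.pack (measure_add m1 m2 : set _ -> _)
   (Measure.class (measure_add m1 m2)) (@Measure_isFinite.Build _ _ _ (measure_add m1 m2) fm).
have mE A : (m A = m1 A + m2 A)%E by exact: measure_addE.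
by exists m => //; exact: outer_regularD mE r1 r2.
Qed.

(** On real functions, the real and the imaginary part of [lam] are each given by a difference of
    two measures. The sum of these four measures dominates the moduli of the complex measure, which
    makes its total variation regular. Complex functions follow by splitting [chi] into
    [u + i v]. *)
Lemma riesz_complex (lam : dual (C_c h)) : exists2 mu : cmeasure h,
  regular_measure (Defs.total_variation mu) &
  forall chi, lam chi = cm_integral mu chi.
Proof.
have [a1 [a2 [ra1 ra2 aE]]] := riesz_part lam (raddfD (@complex.Re R))
  (fun c x => ltac:(by case: x => a b; simpc)) (@normRe_le R).
have [b1 [b2 [rb1 rb2 bE]]] := riesz_part lam (raddfD (@complex.Im R))
  (fun c x => ltac:(by case: x => a b; simpc)) (@normIm_le R).
exists (CMeasure (charge_diff a1 a2) (charge_diff b1 b2)).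
  have [a amE ra] := finite_measureD ra1 ra2.
  have [b bmE rb] := finite_measureD rb1 rb2.
  have [m mE rm] := finite_measureD ra rb.
  apply: (regular_total_variation rm) => B mB.
  have bound (m1 m2 : {finite_measure set (BorelI h) -> \bar R}) :
      (`|fine (charge_diff m1 m2 B)|%:E <= m1 B + m2 B)%E.
    rewrite (_ : charge_diff m1 m2 B = m1 B - m2 B)%E//.
    have := fin_num_measure m1 B mB; have := fin_num_measure m2 B mB.
    have := fine_ge0 (measure_ge0 m1 B); have := fine_ge0 (measure_ge0 m2 B).
    move=> h2 h1 /fineK <- /fineK <-; rewrite -EFinN -!EFinD /= lee_fin.
    by rewrite ler_norml; apply/andP; split; lra.
  rewrite mE amE bmE (le_trans _ (leeD (bound _ _) (bound _ _)))//.
  by rewrite -EFinD lee_fin; exact: (normc_le (cm_val _ B)).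
move=> chi; pose u s := complex.Re (chi s : R[i]); pose v s := complex.Im (chi s : R[i]).
have cuv s : (u x @[x --> s] --> u s) /\ (v x @[x --> s] --> v s).
  by apply/(@cvg_ReIm _ _ (nbhs s)); exact: (@cts_fun _ _ chi).
have cu : continuous u by move=> s; exact: (cuv s).1.
have cv : continuous v by move=> s; exact: (cuv s).2.
have chiE : chi = realC cu + 'i *: realC cv.
  by apply: cfunP => s; exact: (complexE (chi s)).
transitivity (lam (realC cu) + 'i * lam (realC cv) : R[i]).
  by rewrite {1}chiE linearD linearZ_LR.
rewrite /cm_integral /= -/u -/v -(aE u cu) -(aE v cv) -(bE u cu) -(bE v cv).
by case: (lam (realC cu)) => x1 x2; case: (lam (realC cv)) => y1 y2; simpc; rewrite [x2 + _]addrC.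
Qed.

End riesz_complex.

Section riesz_measure_theory.
Context (R : realType) (n : nat) (N : cnorm R n) (h : {posnum R}).

Let Ekl (k : 'I_n) : linear (@Ek R n N h k).
Proof.
move=> a f g; apply: cfunP => s; apply/rowP => j.
by rewrite !mxE /= mulrDl mulrA.
Qed.

HB.instance Definition _ (k : 'I_n) :=
  GRing.isLinear.Build R[i] (C_c h) (C_cn h N) *:%R (@Ek R n N h k) (@Ekl k).

Let Ekc (k : 'I_n) : continuous (@Ek R n N h k).
Proof.
apply/linear_bounded_continuous/linear_boundedP.
near=> r => f; apply: (@le_trans _ _ ((N (delta_mx 0 k))%:C * `|f|)).
  rewrite -!rnormE -rmorphM lecR rnorm_cfunE; apply: cfun_supnorm_le => s.
  rewrite rnorm_CnE cnormZ mulrC ler_wpM2l ?cnorm_ge0//.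
  by rewrite -rnorm_CplxE cfun_le_supnorm.
rewrite ler_wpM2r//; near: r; apply: nbhs_pinfty_ge.
by rewrite ger0_real// ler0c cnorm_ge0.
Unshelve. all: by end_near. Qed.

(** As soon as one representing measure exists, the choice made by [xget] is a representing measure
    as well. *)
Lemma riesz_measureP (lam : dual (C_cn h N)) k (chi : C_c h) :
  lam (Ek N k chi) = cm_integral (riesz_measure lam k) chi.
Proof.
have [mu mu_reg muE] := riesz_complex (Lc_comp lam (mkLc (@Ekc k))).
have muP : riesz_representing lam k mu by split.
by have [_ ->] := xgetPex (cm_zero h) (ex_intro (riesz_representing lam k) mu muP).
Qed.

End riesz_measure_theory.

Lemma Rintegral_bounded_cvg d (T : measurableType d) (R : realType)
    (mu : {measure set T -> \bar R}) (D : set T) (g_ : nat -> T -> R) (g : T -> R) (M : R) :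
  measurable D -> (mu D < +oo)%E -> (forall j, measurable_fun D (g_ j)) ->
  (forall j x, D x -> `|g_ j x| <= M) -> (forall x, D x -> g_ ^~ x @ \oo --> g x) ->
  mu.-integrable D (EFin \o g) /\
  (\int[mu]_(x in D) g_ j x) @[j --> \oo] --> \int[mu]_(x in D) g x.
Proof.
move=> mD Dfin mg gM gg.
have mEg j : measurable_fun D (EFin \o g_ j) by exact/measurable_EFinP.
have Egg x : D x -> (EFin \o g_ j) x @[j --> \oo] --> (EFin \o g) x.
  by move=> Dx; apply: cvg_EFin; [exact: nearW|exact: gg].
have iM : mu.-integrable D (EFin \o cst M).
  apply: measurable_bounded_integrable => //.
  by exists `|M|; split; [exact: num_real|move=> y /ltW yM x _ /=].
have EgM j x : D x -> (`|(EFin \o g_ j) x| <= (EFin \o cst M) x)%E.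
  by move=> Dx; rewrite /= lee_fin gM.
have mEg' : measurable_fun D (EFin \o g).
  exact: (emeasurable_fun_cvg (fun j => EFin \o g_ j)).
have [ig _ cvgI] := @dominated_convergence _ _ _ mu D mD (fun j => EFin \o g_ j) _
  (EFin \o cst M) mEg mEg' (aeW _ Egg) iM (aeW _ (fun x j => @EgM j x)).
by split=> //; apply: fine_cvg; rewrite fineK//; exact: integrable_fin_num.
Qed.

(** * The extended functionals on Baire-one maps *)

Section ext_functional_theory.
Context (R : realType) (n : nat) (N : cnorm R n) (h : {posnum R}).
Local Notation V := (Cn N).
Local Notation T := (BorelI h).
Implicit Types (lam : dual (C_cn h N)) (phi psi : I_ h -> V).

Lemma cvg_coord S (F : set_system S) {FF : Filter F} (f : S -> V) (l : V) :
  f @ F --> l <-> forall k, (fun x => (f x 0 k : Cplx R)) @ F --> (l 0 k : Cplx R).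
Proof.
split=> [/cvg_rnormP/cvgrPdist_lt fl k|fl].
  have [C C0 hC] := coord_le_cnorm N.
  apply/cvg_rnormP/cvgrPdist_lt => e e0.
  have d0 : 0 < e / (C + 1) by rewrite divr_gt0// ltr_wpDl.
  have := fl _ d0; apply: filterS => x.
  rewrite !sub0r !normrN !ger0_norm ?rnorm_ge0// rnorm_CnE => h1.
  have := hC (f x - l : 'rV_n) k; rewrite !mxE rnorm_CplxE => h2.
  apply: le_lt_trans h2 _; move: h1; rewrite ltr_pdivlMr ?ltr_wpDl//.
  by apply: le_lt_trans; rewrite mulrC ler_wpM2l ?cnorm_ge0// lerDl.
have [C C0 hC] := cnorm_le_coord N.
apply/cvg_rnormP/cvgrPdist_lt => e e0.
have d0 : 0 < e / (C + 1) by rewrite divr_gt0// ltr_wpDl.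
have : \forall x \near F, forall k, normc (f x 0 k - l 0 k) < e / (C + 1).
  apply: filter_forall => k; have /cvg_rnormP/cvgrPdist_lt := fl k.
  move=> /(_ _ d0); apply: filterS => x.
  by rewrite !sub0r !normrN !ger0_norm ?rnorm_ge0.
apply: filterS => x fx; rewrite sub0r normrN ger0_norm ?rnorm_ge0// rnorm_CnE.
apply: (@le_lt_trans _ _ (C * (e / (C + 1)))).
  by apply: hC => k; rewrite !mxE ltW.
by rewrite mulrCA gtr_pMr// ltr_pdivrMr ?ltr_wpDl// mul1r ltrDl.
Qed.

Lemma cvgn_ReIm (u : nat -> V) (l : V) : u @ \oo --> l -> forall k,
  (complex.Re (u j 0 k : R[i]) @[j --> \oo] --> complex.Re (l 0 k)) /\
  (complex.Im (u j 0 k : R[i]) @[j --> \oo] --> complex.Im (l 0 k)).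
Proof. by move=> /cvg_coord ul k; apply/cvg_ReIm; exact: ul. Qed.

Definition coordC (f : C_cn h N) (k : 'I_n) : C_c h :=
  mkcts (fun s => (@cvg_coord _ (nbhs s) _ f (f s)).1 (@cts_fun _ _ f s) k).

Lemma sum_Ek (f : C_cn h N) : f = \sum_(k < n) Ek N k (coordC f k).
Proof.
have E (r : seq 'I_n) s : (\sum_(k <- r) Ek N k (coordC f k)) s =
    \sum_(k <- r) Ek N k (coordC f k) s.
  by elim: r => [|k r IH]; rewrite ?big_nil// !big_cons -IH.
by apply: cfunP => s; rewrite E; exact: row_sum_delta.
Qed.

Lemma ext_functionalE lam (f : C_cn h N) : ext_functional lam f = lam f.
Proof.
rewrite [in RHS](sum_Ek f) raddf_sum; apply: eq_bigr => k _.
exact: esym (riesz_measureP lam k (coordC f k)).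
Qed.

Definition coord_measurable phi := forall k,
  measurable_fun setT ((fun s => complex.Re (phi s 0 k)) : T -> R) /\
  measurable_fun setT ((fun s => complex.Im (phi s 0 k)) : T -> R).

Lemma cts_coord_measurable (f : C_cn h N) : coord_measurable f.
Proof.
have H k s := (@cvg_ReIm _ _ (nbhs s) (nbhs_filter s) _ _).1 (@cts_fun _ _ (coordC f k) s).
by move=> k; split; apply: cts_measurable => s; [exact: (H k s).1|exact: (H k s).2].
Qed.

Lemma cvg_coord_measurable (phi_ : nat -> I_ h -> V) phi : (forall j, coord_measurable (phi_ j)) ->
  (forall s, phi_ ^~ s @ \oo --> phi s) -> coord_measurable phi.
Proof.
move=> mphi cphi k.
have H s := cvgn_ReIm (cphi s) k.
split.
- apply: (measurable_fun_cvg (h := fun j => (fun s => complex.Re (phi_ j s 0 k)) : T -> R)).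
    by move=> j; exact: (mphi j k).1.
  by move=> s _; exact: (H s).1.
- apply: (measurable_fun_cvg (h := fun j => (fun s => complex.Im (phi_ j s 0 k)) : T -> R)).
    by move=> j; exact: (mphi j k).2.
  by move=> s _; exact: (H s).2.
Qed.

Lemma charge_integral_cvg (nu : {charge set T -> \bar R}) (g_ : nat -> T -> R) g M :
  (forall j, measurable_fun setT (g_ j)) -> (forall j x, `|g_ j x| <= M) ->
  (forall x, g_ ^~ x @ \oo --> g x) ->
  charge_integral nu (g_ j) @[j --> \oo] --> charge_integral nu g.
Proof.
move=> mg gM gg; rewrite /charge_integral; set HP := cid _; set HN := cid _.
have H (mu : {finite_measure set T -> \bar R}) :
    \int[mu]_x g_ j x @[j --> \oo] --> \int[mu]_x g x.
  apply: (Rintegral_bounded_cvg (M := M) _ _ mg (fun j x _ => gM j x) (fun x _ => gg x)).2 => //.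
  by rewrite fin_num_fun_lty//; exact: fin_num_measure.
by apply: cvgB; [exact: (H (jordan_pos (projT2 HN)))|exact: (H (jordan_neg (projT2 HN)))].
Qed.

Lemma ext_functional_cvg lam (phi_ : nat -> I_ h -> V) phi M :
  (forall j, coord_measurable (phi_ j)) -> (forall j s, N (phi_ j s) <= M) ->
  (forall s, phi_ ^~ s @ \oo --> phi s) ->
  (ext_functional lam (phi_ j) : Cplx R) @[j --> \oo] --> (ext_functional lam phi : Cplx R).
Proof.
move=> mphi phiM cphi; have [C C0 hC] := coord_le_cnorm N.
rewrite /ext_functional; apply: (@cvg_big _ _ +%R) => //.
  by move=> x; apply: (@add_continuous (Cplx R)).
move=> k _.
have H s := cvgn_ReIm (cphi s) k.
have B j s : normc (phi_ j s 0 k) <= C * M.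
  by rewrite (le_trans (hC _ _))// ler_wpM2l.
have cRe nu : charge_integral nu (fun s => complex.Re (phi_ j s 0 k)) @[j --> \oo]
    --> charge_integral nu (fun s => complex.Re (phi s 0 k)).
  apply: (charge_integral_cvg (M := C * M)) => [j|j x|x]; first exact: (mphi j k).1.
    exact: le_trans (normRe_le _) _.
  exact: (H x).1.
have cIm nu : charge_integral nu (fun s => complex.Im (phi_ j s 0 k)) @[j --> \oo]
    --> charge_integral nu (fun s => complex.Im (phi s 0 k)).
  apply: (charge_integral_cvg (M := C * M)) => [j|j x|x]; first exact: (mphi j k).2.
    exact: le_trans (normIm_le _) _.
  exact: (H x).2.
by apply/cvg_ReIm; split=> /=; [apply: cvgB|apply: cvgD].
Qed.

End ext_functional_theory.

Section cvg_rnorm.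
Context (R : realType) (X : normedModType R[i]).

Lemma cvg_rnorm T (F : set_system T) {FF : Filter F} (f : T -> X) (l : X) :
  f @ F --> l -> rnorm (f x) @[x --> F] --> rnorm l.
Proof.
move=> /cvg_rnormP/cvgrPdist_lt fl; apply/cvgrPdist_lt => e /fl; apply: filterS => x.
rewrite sub0r normrN ger0_norm ?rnorm_ge0//; apply: le_lt_trans.
by rewrite distrC rnorm_dist.
Qed.

Lemma cvgn_rnorm_le (u : nat -> X) (l : X) M : u @ \oo --> l ->
  (forall j, rnorm (u j) <= M) -> rnorm l <= M.
Proof.
move=> /cvg_rnorm ul uM; rewrite -(cvg_lim _ ul)//.
by apply: limr_le; [apply/cvg_ex; exists (rnorm l)|exact: nearW].
Qed.

Lemma cvgn_unique (u : nat -> X) (l l' : X) : u @ \oo --> l -> u @ \oo --> l' -> l = l'.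
Proof. exact: (cvg_unique (@norm_hausdorff _ X)). Qed.

End cvg_rnorm.

Section Baire_one_maps.
Context (R : realType) (n : nat) (N : cnorm R n) (h : {posnum R}).
Local Notation V := (Cn N).
Implicit Types (lam : dual (C_cn h N)) (phi psi : I_ h -> V).

(** The radial retraction onto the ball of radius [K]; the maximum in the denominator makes it one
    formula, continuous also at [x = 0]. *)
Definition truncate (K : R) (x : V) : V := (K / Num.max K (N x))%:C *: x.

Lemma truncate_le K x : 0 < K -> N (truncate K x) <= K.
Proof.
move=> K0; rewrite /truncate cnormZ normc_real.
have m0 : 0 < Num.max K (N x) by rewrite lt_max K0.
rewrite ger0_norm ?divr_ge0 ?(ltW K0) ?(ltW m0)// mulrAC ler_pdivrMr//.
by rewrite ler_wpM2l ?(ltW K0)// le_max lexx orbT.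
Qed.

Lemma truncate_id K x : 0 < K -> N x <= K -> truncate K x = x.
Proof.
by move=> K0 xK; rewrite /truncate max_l// divff ?gt_eqF//; exact: scale1r.
Qed.

Lemma cvg_truncate T (F : set_system T) {FF : Filter F} K (f : T -> V) (l : V) :
  0 < K -> f @ F --> l -> truncate K (f x) @[x --> F] --> truncate K l.
Proof.
move=> K0 fl; apply: cvgZ => //; apply: cvg_realC.
apply: cvgM; first exact: cvg_cst.
apply: cvgV; first by rewrite gt_eqF// lt_max K0.
have cm : continuous (fun t : R => Num.max K t).
  by apply: cts_max; [exact: cts_cst|move=> ?].
exact: (cvg_comp _ (fun t : R => Num.max K t) (cvg_rnorm fl) (cm _)).
Qed.

(** Membership in [B_nA] gives approximants and bounds coordinate by coordinate only. Truncating the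
    assembled rows imposes the bound [K] in the norm [N], and leaves the limit alone because [phi]
    already takes its values in that ball. *)
Lemma B_nA_approx phi K : B_nA phi -> 0 < K -> (forall s, N (phi s) <= K) ->
  exists psi : nat -> C_cn h N, (forall m s, N (psi m s) <= K) /\
    forall s, (fun m => psi m s) @ \oo --> phi s.
Proof.
move=> /choice[w hw] K0 phiK.
pose v m s : V := \row_k (w k m s : R[i]).
have cv m : continuous (v m).
  move=> s; apply/(@cvg_coord _ _ _ _ (nbhs s) (nbhs_filter s)) => k.
  have wk : continuous (w k m).
    by have [cw _ _] := hw k; apply/continuous_subspace_setT; exact: cw.
  have vE t : v m t 0 k = w k m t by rewrite mxE.
  rewrite vE; have -> : (fun t => (v m t 0 k : Cplx R)) = w k m by apply/funext.
  exact: wk.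
have ctv m : continuous (fun s => truncate K (v m s)).
  by move=> s; apply: (@cvg_truncate _ (nbhs s)) => //; exact: cv.
exists (fun m => mkcts (ctv m)); split=> [j s|s]; first exact: truncate_le.
rewrite -[X in _ --> X](truncate_id K0 (phiK s)).
apply: cvg_truncate => //; apply/cvg_coord => k.
have [_ _ /(_ s I)] := hw k.
have vE : (fun m => v m s 0 k) = w k ^~ s by apply/funext => m; rewrite mxE.
by move=> ws; rewrite -vE in ws.
Qed.

Lemma B_nA_bounded phi : B_nA phi -> exists2 K, 0 < K & forall s, N (phi s) <= K.
Proof.
move=> phiA; have /choice[M hM] k : exists M : R, forall s, normc (phi s 0 k) <= M.
  have [w [_ [M wM] wphi]] := phiA k; exists M => s.
  by apply: (cvgn_rnorm_le (wphi s I)) => j; exact: wM.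
have [C C0 hC] := cnorm_le_coord N.
pose K := \sum_k `|M k|; have K0 : 0 <= K by exact: sumr_ge0.
exists (C * K + 1); first by rewrite ltr_wpDl// mulr_ge0.
move=> s; apply: (@le_trans _ _ (C * K)); last by rewrite lerDl.
apply: hC => k; apply: le_trans (hM k s) _; rewrite /K (bigD1 k)//=.
by rewrite (le_trans (ler_norm _))// lerDl sumr_ge0.
Qed.

Lemma propertyA_B_nA phi : propertyA setT phi -> B_nA phi.
Proof.
move=> [w [cw [M wM] wphi]] k; have [C C0 hC] := coord_le_cnorm N.
exists (fun m s => w m s 0 k); split.
- move=> m; apply: continuous_subspaceT => s.
  have cwm : continuous (w m) by apply/continuous_subspace_setT; exact: cw.
  by have := cwm s; move=> /(@cvg_coord _ _ _ _ (nbhs s) (nbhs_filter s)); exact.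
- exists (C * M) => m s _; apply: le_trans (hC _ _) _.
  by rewrite ler_wpM2l//; exact: wM.
- by move=> s _; exact: (@cvg_coord _ _ _ _ \oo _ _ _).1 (wphi s I) k.
Qed.

Lemma cvg_B_nA (psi : nat -> C_cn h N) phi K : (forall m s, N (psi m s) <= K) ->
  (forall s, (fun m => psi m s) @ \oo --> phi s) -> propertyA setT phi.
Proof.
move=> psiK psiphi; exists (fun m => psi m); split.
- by move=> m; apply: continuous_subspaceT; exact: (@cts_fun _ _ (psi m)).
- by exists K => m s _; exact: psiK.
- by move=> s _; exact: psiphi.
Qed.

Lemma B_nA_coord_measurable phi : B_nA phi -> coord_measurable phi.
Proof.
move=> phiA; have [K K0 phiK] := B_nA_bounded phiA.
have [psi [_ psiphi]] := B_nA_approx phiA K0 phiK.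
by apply: cvg_coord_measurable psiphi => j; exact: cts_coord_measurable.
Qed.

Lemma cts_B_nA (f : C_cn h N) : B_nA f.
Proof.
have fs s : N (f s) <= rnorm f by rewrite rnorm_cfunE; exact: (cfun_le_supnorm f s).
by apply/propertyA_B_nA/(cvg_B_nA (psi := fun=> f)) => [_ s|s]; [exact: fs|exact: cvg_cst].
Qed.

End Baire_one_maps.

Section ext_functional_B_nA.
Context (R : realType) (n : nat) (N : cnorm R n) (h : {posnum R}).
Local Notation V := (Cn N).
Implicit Types (lam : dual (C_cn h N)) (phi psi : I_ h -> V).

Lemma ext_functional_approx lam phi (psi : nat -> C_cn h N) K :
  (forall m s, N (psi m s) <= K) ->
  (forall s, (fun m => psi m s) @ \oo --> phi s) ->
  (lam (psi m) : Cplx R) @[m --> \oo] --> (ext_functional lam phi : Cplx R).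
Proof.
move=> psiK psiphi; under eq_fun do rewrite -ext_functionalE.
apply: (ext_functional_cvg (M := K)) => //.
by move=> j; exact: cts_coord_measurable.
Qed.

Lemma ext_functional_bound lam : exists2 K : R, 0 <= K &
  forall phi M, B_nA phi -> (forall s, N (phi s) <= M) ->
    normc (ext_functional lam phi) <= K * M.
Proof.
have [K K0 lamK] := Lc_bounded lam; exists K => // phi M phiA phiM.
have M0 : 0 <= M by rewrite (le_trans _ (phiM Izero))// cnorm_ge0.
(* [M] may be 0, whereas truncation needs a positive radius. *)
have pos e : 0 < e -> normc (ext_functional lam phi) <= K * (M + e).
  move=> e0; have Me0 : 0 < M + e by rewrite ltr_wpDl.
  have phiMe s : N (phi s) <= M + e by rewrite (le_trans (phiM s))// lerDl ltW.
  have [psi [psiK psiphi]] := B_nA_approx phiA Me0 phiMe.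
  rewrite -(rnorm_CplxE (ext_functional lam phi)).
  apply: (@cvgn_rnorm_le _ (Cplx R) (fun m => lam (psi m))) => [|j].
    exact: ext_functional_approx psiphi.
  apply: le_trans (lamK _) _; rewrite ler_wpM2l// rnorm_cfunE.
  by apply: cfun_supnorm_le => s; exact: psiK.
apply/ler_addgt0Pr => e e0.
have d0 : 0 < e / (K + 1) by rewrite divr_gt0// ltr_wpDl.
apply: le_trans (pos _ d0) _; rewrite mulrDr lerD2l mulrCA ler_piMr ?(ltW e0)//.
by rewrite ler_pdivrMr ?ltr_wpDl// mul1r lerDl.
Qed.

(** Linearity of [lam] on continuous approximants passes to the limit; the differences of
    approximants stay bounded by [K + K']. *)
Lemma ext_functionalB lam phi psi : B_nA phi -> B_nA psi ->
  ext_functional lam (fun s => phi s - psi s) =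
  ext_functional lam phi - ext_functional lam psi.
Proof.
move=> phiA psiA.
have [K K0 phiK] := B_nA_bounded phiA; have [K' K'0 psiK] := B_nA_bounded psiA.
have [f [fK fphi]] := B_nA_approx phiA K0 phiK.
have [g [gK gpsi]] := B_nA_approx psiA K'0 psiK.
have fgK m s : N ((f m - g m) s) <= K + K'.
  apply: le_trans (@rnormD _ (Cn N) (f m s) (- g m s)) _.
  by rewrite rnormN; apply: lerD; [exact: fK|exact: gK].
apply: (@cvgn_unique _ (Cplx R) (fun m => lam (f m - g m))).
  by apply: ext_functional_approx fgK _ => s; exact: (cvgB (fphi s) (gpsi s)).
under eq_fun do rewrite linearB.
by apply: cvgB; exact: ext_functional_approx.
Qed.

Let coord_fun (k : 'I_n) (x : V) : Cplx R := x 0 k.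

Let coord_linear k : linear (coord_fun k).
Proof. by move=> a x y; rewrite /coord_fun !mxE. Qed.

HB.instance Definition _ k :=
  GRing.isLinear.Build R[i] V (Cplx R) *:%R (coord_fun k) (coord_linear k).

Let coord_fun_continuous k : continuous (coord_fun k).
Proof. by move=> x; apply: (@cvg_coord _ _ _ _ (nbhs x) _ id x).1 => //; exact: cvg_id. Qed.

Definition coordinate (k : 'I_n) : dual V := mkLc (@coord_fun_continuous k).

Lemma dual_coordinates (ys : dual V) x :
  ys x = \sum_(k < n) ys (delta_mx 0 k) * (x 0 k : R[i]).
Proof.
rewrite {1}(row_sum_delta x) raddf_sum; apply: eq_bigr => k _.
by rewrite mulrC; exact: linearZ_LR.
Qed.

(** The measures of [Lc_comp ys L] and of each [Lc_comp (coordinate k) L] are chosen independently.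
    On continuous approximants both sides agree by linearity, and both converge. *)
Lemma ext_functional_coordinates (L : Lc (C_cn h N) V) (ys : dual V) phi : B_nA phi ->
  ext_functional (Lc_comp ys L) phi =
  \sum_(k < n) ys (delta_mx 0 k) * ext_functional (Lc_comp (coordinate k) L) phi.
Proof.
move=> phiA; have [K K0 phiK] := B_nA_bounded phiA.
have [f [fK fphi]] := B_nA_approx phiA K0 phiK.
apply: (@cvgn_unique _ (Cplx R) (fun m => Lc_comp ys L (f m))).
  exact: ext_functional_approx fphi.
have E m : Lc_comp ys L (f m) =
    \sum_(k < n) ys (delta_mx 0 k) * (Lc_comp (coordinate k) L (f m) : R[i]).
  exact: dual_coordinates.
under eq_fun do rewrite E.
apply: (@cvg_big _ _ +%R) => //; first by move=> x; apply: (@add_continuous (Cplx R)).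
move=> k _; apply: (@cvgZl_tmp _ (Cplx R)).
exact: ext_functional_approx fphi.
Qed.

(* [L] ignores the values of a continuous map after time [- d], so the map may be
   frozen there; this passes to the limit. *)
Lemma ext_functional_delay (L : Lc (C_cn h N) V) (lam : dual V) (d : R) :
  0 < d < h%:num ->
  (forall f : C_cn h N, (forall s : I_ h, Ival s <= - d -> f s = 0) -> L f = 0) ->
  exists2 K : R, 0 <= K & forall phi M, B_nA phi ->
    (forall s : I_ h, Ival s <= - d -> N (phi s) <= M) ->
    normc (ext_functional (Lc_comp lam L) phi) <= K * M.
Proof.
move=> /andP[d0 dh] Ld; have [K K0 hK] := ext_functional_bound (Lc_comp lam L).
exists K => // phi M phiA phiM.
pose c (s : I_ h) : I_ h := clampI h (Num.min (Ival s) (- d)).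
have cs s : Ival (c s) <= - d.
  rewrite Ival_clampI ge_max !lerN2 (ltW dh)/= ge_min; apply/orP; left.
  by rewrite ge_min lexx orbT.
have c_id s : Ival s <= - d -> c s = s.
  by move=> sd; rewrite /c min_l// IvalK.
have cc : continuous c.
  move=> s; apply: (@continuous_comp _ _ _ (fun s : I_ h => Num.min (Ival s) (- d))).
    by apply: (cts_min _ (cts_cst (- d))); exact: Ival_continuous.
  exact: clampI_continuous.
have [K' K'0 phiK] := B_nA_bounded phiA.
have [f [fK fphi]] := B_nA_approx phiA K'0 phiK.
have cfc m : continuous (f m \o c).
  by move=> s; apply: continuous_comp; [exact: cc|exact: (@cts_fun _ _ (f m))].
pose g m : C_cn h N := mkcts (cfc m).
have gc s : (fun m => g m s) @ \oo --> phi (c s) by exact: fphi.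
have gK m s : N (g m s) <= K' by exact: fK.
have -> : ext_functional (Lc_comp lam L) phi = ext_functional (Lc_comp lam L) (phi \o c).
  apply: (@cvgn_unique _ (Cplx R) (fun m => Lc_comp lam L (f m))).
    exact: ext_functional_approx fphi.
  have E m : Lc_comp lam L (f m) = Lc_comp lam L (g m).
    apply/eqP; rewrite -subr_eq0 -linearB /=; apply/eqP.
    rewrite Ld ?raddf0// => s sd.
    by rewrite (_ : (f m - g m) s = f m s - f m (c s))// c_id// subrr.
  under eq_fun do rewrite E.
  exact: ext_functional_approx gc.
apply: hK; last by move=> s; exact: phiM.
by apply/propertyA_B_nA/(cvg_B_nA gK).
Qed.

End ext_functional_B_nA.

Section lebesgue_Rintegral.
Context (R : realType).
Local Notation mu := (@lebesgue_measure R).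

Lemma lebesgue_itvoo_fin (t : R) : (mu `]0%R, t[%classic < +oo)%E.
Proof. by rewrite lebesgue_measure_itv /=; case: ifP; rewrite ltry. Qed.

Lemma expR_integrable (g t : R) : mu.-integrable `]0, t[%classic (EFin \o (fun s => expR (g * s))).
Proof.
have cexp : continuous (fun s : R => expR (g * s)).
  move=> s; apply: continuous_comp; last exact: continuous_expR.
  exact: mulrl_continuous.
apply: integrableS (_ : mu.-integrable `[0, t]%classic _) => //.
  by apply: subset_itvW.
apply: continuous_compact_integrable; first exact: segment_compact.
exact: continuous_subspaceT.
Qed.

Lemma Rintegral_expR_le (g t : R) : 0 < g -> 0 <= t ->
  \int[mu]_(s in `]0, t[%classic) expR (g * s) <= g^-1 * expR (g * t).
Proof.
move=> g0; rewrite le_eqVlt => /predU1P[<-|t0].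
  by rewrite set_itv_ge ?bnd_simp ?ltxx// Rintegral_set0 mulr_ge0 ?invr_ge0 ?ltW// expR_gt0.
have cexp : continuous (fun s : R => expR (g * s)).
  move=> s; apply: continuous_comp; last exact: continuous_expR.
  exact: mulrl_continuous.
have int0 : mu.-integrable `[0, t]%classic (EFin \o (fun s => expR (g * s))).
  apply: continuous_compact_integrable; first exact: segment_compact.
  exact: continuous_subspaceT.
rewrite Rintegral_itv_obnd_cbnd; last exact: expR_integrable.
rewrite Rintegral_itv_bndo_bndc; last first.
  apply: integrableS int0 => // s /=.
  by rewrite !in_itv/= => /andP[-> /ltW ->].
pose F (s : R) := g^-1 * expR (g * s).
have dF (s : R) : is_derive s 1 F (expR (g * s)).
  have -> : expR (g * s) = g^-1 * (g * expR (g * s)).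
    by rewrite mulrA mulVf ?mul1r// gt_eqF.
  have d1 : is_derive s 1 (fun s => g * s) g.
    by apply: is_derive_eq; rewrite /GRing.scale/= mulr1.
  have d2 : is_derive s 1 (fun s => expR (g * s)) (g * expR (g * s)).
    have := @is_derive1_comp _ (@expR R) (fun s => g * s) s _ _ (is_derive_expR _) d1.
    by rewrite mulrC.
  exact: is_deriveZ.
have cF : continuous F.
  move=> s; apply: differentiable_continuous.
  by apply/derivable1_diffP; case: (dF s).
rewrite /Rintegral (@continuous_FTC2 _ _ F)//.
- by rewrite -EFinB /= gerBl mulr_ge0 ?expR_ge0// invr_ge0 ltW.
- exact: continuous_subspaceT.
- split.
  + by move=> s _; case: (dF s).
  + by apply: cvg_at_right_filter; exact: cF.
  + by apply: cvg_at_left_filter; exact: cF.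
- by move=> s _; rewrite derive1E; case: (dF s).
Qed.

End lebesgue_Rintegral.

(** * Integrals along segments *)

Section complex_integral.
Context (R : realType).
Local Notation mu := (@lebesgue_measure R).
Local Notation Re := (@complex.Re R).
Local Notation Im := (@complex.Im R).
Implicit Types (f : R -> R) (g : R -> R[i]).

(** Shaped like [weak_star_integral] on the interval from 0 to [t], so that the value of the latter
    at a functional is a [Cint] by conversion. *)
Definition Cint g (t : R) : R[i] :=
  (\int[mu]_(s in `]0, t[%classic) Re (g s)) +i*
  (\int[mu]_(s in `]0, t[%classic) Im (g s)).

Definition Cintegrable g (t : R) :=
  mu.-integrable `]0, t[%classic (EFin \o (fun s => Re (g s))) /\
  mu.-integrable `]0, t[%classic (EFin \o (fun s => Im (g s))).

Lemma eq_Cint g1 g2 t : (forall s, 0 < s < t -> g1 s = g2 s) -> Cint g1 t = Cint g2 t.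
Proof.
move=> g12; rewrite /Cint.
by congr Complex; apply: eq_Rintegral => s; rewrite inE /= in_itv/= => /g12 ->.
Qed.

Lemma CintB g1 g2 t : Cintegrable g1 t -> Cintegrable g2 t ->
  Cint (fun s => g1 s - g2 s) t = Cint g1 t - Cint g2 t.
Proof.
move=> [r1 i1] [r2 i2]; rewrite /Cint [RHS]/GRing.add /= -!RintegralB//.
by congr (_ +i* _); apply: eq_Rintegral => s _; rewrite raddfB.
Qed.

Lemma CintZ (c : R[i]) g t : Cintegrable g t ->
  Cintegrable (fun s => c * g s) t /\ Cint (fun s => c * g s) t = c * Cint g t.
Proof.
case: c => a b [rg ig].
have E s : Complex a b * g s = Complex (a * Re (g s) - b * Im (g s)) (a * Im (g s) + b * Re (g s)).
  by case: (g s).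
have ZI (k : R) f : mu.-integrable `]0, t[%classic (EFin \o f) ->
    mu.-integrable `]0, t[%classic (EFin \o (fun s => k * f s)).
  by move=> fi; exact: (integrableZl _ k fi).
rewrite /Cint /Cintegrable.
have -> : (fun s => Re (Complex a b * g s)) = (fun s => a * Re (g s) - b * Im (g s)).
  by apply/funext => s; rewrite E.
have -> : (fun s => Im (Complex a b * g s)) = (fun s => a * Im (g s) + b * Re (g s)).
  by apply/funext => s; rewrite E.
split.
  split; first exact: (integrableB _ (ZI _ _ rg) (ZI _ _ ig)).
  exact: (integrableD _ (ZI _ _ ig) (ZI _ _ rg)).
rewrite RintegralB//; try exact: ZI.
rewrite RintegralD//; try exact: ZI.
by rewrite !RintegralZl.
Qed.

Lemma CintD g1 g2 t : Cintegrable g1 t -> Cintegrable g2 t ->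
  Cintegrable (fun s => g1 s + g2 s) t /\
  Cint (fun s => g1 s + g2 s) t = Cint g1 t + Cint g2 t.
Proof.
move=> [r1 i1] [r2 i2]; rewrite /Cint /Cintegrable [in X in _ /\ X]/GRing.add /=.
have -> : (fun s => Re (g1 s + g2 s)) = (fun s => Re (g1 s) + Re (g2 s)).
  by apply/funext => s; rewrite raddfD.
have -> : (fun s => Im (g1 s + g2 s)) = (fun s => Im (g1 s) + Im (g2 s)).
  by apply/funext => s; rewrite raddfD.
rewrite !RintegralD//; split=> //; split.
  exact: (integrableD _ r1 r2).
exact: (integrableD _ i1 i2).
Qed.

Lemma Cint_sum (I : Type) (r : seq I) (G : I -> R -> R[i]) t :
  (forall i, Cintegrable (G i) t) ->
  Cintegrable (fun s => \sum_(i <- r) G i s) t /\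
  Cint (fun s => \sum_(i <- r) G i s) t = \sum_(i <- r) Cint (G i) t.
Proof.
move=> Gi; elim: r => [|i r [IHr IH]].
  have -> : (fun s => \sum_(i <- [::]) G i s) = cst 0.
    by apply/funext => s; rewrite big_nil.
  split; first by split; exact: integrable0.
  by rewrite big_nil /Cint /= !Rintegral_cst// mul0r.
have -> : (fun s => \sum_(i <- i :: r) G i s) = (fun s => G i s + \sum_(i <- r) G i s).
  by apply/funext => s; rewrite big_cons.
by rewrite big_cons -IH; exact: CintD.
Qed.

(** The factor 2 comes from bounding real and imaginary part separately, [a^-1] from integrating the
    exponential. *)
Lemma Cint_expR_le g (a B t : R) : 0 < a -> 0 <= t -> 0 <= B -> Cintegrable g t ->
  (forall s, 0 < s < t -> normc (g s) <= B * expR (a * s)) ->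
  normc (Cint g t) <= 2 * B * a^-1 * expR (a * t).
Proof.
move=> a0 t0 B0 [rg ig] gB; apply: le_trans (normc_le _) _ => /=.
have eI : mu.-integrable `]0, t[%classic (EFin \o (fun s => B * expR (a * s))).
  exact: (integrableZl _ B (expR_integrable a t)).
have bound f : mu.-integrable `]0, t[%classic (EFin \o f) ->
    (forall s, 0 < s < t -> `|f s| <= B * expR (a * s)) ->
    `|\int[mu]_(s in `]0, t[%classic) f s| <= B * a^-1 * expR (a * t).
  move=> fi fB; apply: le_trans (le_normr_Rintegral _ fi) _ => //.
  apply: (@le_trans _ _ (\int[mu]_(s in `]0, t[%classic) (B * expR (a * s)))).
    by apply: le_Rintegral => //; exact: integrable_norm fi.
  rewrite RintegralZl//; last exact: expR_integrable.
  by rewrite -mulrA ler_wpM2l// Rintegral_expR_le.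
have -> : 2 * B * a^-1 * expR (a * t) = B * a^-1 * expR (a * t) + B * a^-1 * expR (a * t).
  by ring.
apply: lerD; apply: bound => // s /gB; apply: le_trans.
  exact: normRe_le.
exact: normIm_le.
Qed.

Definition locally_bounded_measurable g :=
  [/\ measurable_fun setT (fun s => Re (g s)), measurable_fun setT (fun s => Im (g s))
    & forall T, exists M, forall s, s <= T -> normc (g s) <= M].

Lemma Cint_cvg (g_ : nat -> R -> R[i]) g t M :
  (forall j, locally_bounded_measurable (g_ j)) ->
  (forall j s, s <= t -> normc (g_ j s) <= M) ->
  (forall s, s <= t -> (g_ j s : Cplx R) @[j --> \oo] --> (g s : Cplx R)) ->
  Cintegrable g t /\ (Cint (g_ j) t : Cplx R) @[j --> \oo] --> (Cint g t : Cplx R).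
Proof.
move=> mg gM gg.
have t_lt s : `]0, t[%classic s -> s <= t by rewrite /= in_itv/= => /andP[_ /ltW].
have [rI rc] : mu.-integrable `]0, t[%classic (EFin \o (fun s => Re (g s))) /\
    (\int[mu]_(s in `]0, t[%classic) Re (g_ j s)) @[j --> \oo] -->
    \int[mu]_(s in `]0, t[%classic) Re (g s).
  apply: (Rintegral_bounded_cvg (mu := mu) (g_ := fun j s => Re (g_ j s)) (M := M)) => //.
  - exact: lebesgue_itvoo_fin.
  - by move=> j; apply: (measurable_funS measurableT) => //; have [] := mg j.
  - by move=> j s /t_lt st; apply: le_trans (normRe_le _) (gM j s st).
  - by move=> s /t_lt /gg /cvg_ReIm[].
have [iI ic] : mu.-integrable `]0, t[%classic (EFin \o (fun s => Im (g s))) /\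
    (\int[mu]_(s in `]0, t[%classic) Im (g_ j s)) @[j --> \oo] -->
    \int[mu]_(s in `]0, t[%classic) Im (g s).
  apply: (Rintegral_bounded_cvg (mu := mu) (g_ := fun j s => Im (g_ j s)) (M := M)) => //.
  - exact: lebesgue_itvoo_fin.
  - by move=> j; apply: (measurable_funS measurableT) => //; have [] := mg j.
  - by move=> j s /t_lt st; apply: le_trans (normIm_le _) (gM j s st).
  - by move=> s /t_lt /gg /cvg_ReIm[].
by split=> //; apply/cvg_ReIm.
Qed.

Lemma locally_bounded_Cintegrable g t : locally_bounded_measurable g -> Cintegrable g t.
Proof.
move=> gl; have [_ _ /(_ t)[M gM]] := gl.
by have [] := @Cint_cvg (fun=> g) g t M (fun=> gl) (fun=> gM) (fun _ _ => cvg_cst _).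
Qed.

Lemma Rintegral_lipschitz f (M a b : R) : mu.-integrable `]0, b[%classic (EFin \o f) ->
  0 <= a -> a <= b -> (forall s, s <= b -> `|f s| <= M) ->
  `|\int[mu]_(s in `]0, b[%classic) f s - \int[mu]_(s in `]0, a[%classic) f s| <= M * (b - a).
Proof.
move=> fi a0; rewrite le_eqVlt => /predU1P[<- _|ab fM].
  by rewrite !subrr normr0 mulr0.
rewrite [X in _ - X]Rintegral_itv_bndo_bndc; last first.
  by apply: integrableS fi => //; apply: subset_itvl; rewrite bnd_simp ltW.
rewrite Rintegral_itvB ?bnd_simp//.
have fiab : mu.-integrable `]a, b[%classic (EFin \o f).
  by apply: integrableS fi => //; apply: subset_itvr; rewrite bnd_simp.
apply: le_trans (le_normr_Rintegral _ fiab) _ => //.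
have mab : fine (mu `]a, b[%classic) = b - a by rewrite lebesgue_measure_itv/= lte_fin ab.
have muab : (mu `]a, b[%classic < +oo)%E.
  by rewrite lebesgue_measure_itv/= lte_fin ab -EFinB ltry.
rewrite -mab -Rintegral_cst//; apply: le_Rintegral => //.
- exact: integrable_norm fiab.
- apply: measurable_bounded_integrable => //.
  by exists `|M|; split; [exact: num_real|move=> y /ltW yM x _ /=].
- by move=> s; rewrite /= in_itv/= => /andP[_ /ltW]; exact: fM.
Qed.

Lemma Cint_continuous g : locally_bounded_measurable g ->
  continuous (fun t : R => Cint g (Num.max t 0) : Cplx R).
Proof.
move=> gl t; have [_ _ /(_ (Num.max (t + 1) 0))[M gM]] := gl.
have t1 : 0 <= Num.max (t + 1) 0 by rewrite le_max lexx orbT.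
have M0 : 0 <= M by apply: le_trans (gM _ t1); exact: normc_ge0.
have lip f : (forall b, mu.-integrable `]0, b[%classic (EFin \o f)) ->
    (forall s, s <= Num.max (t + 1) 0 -> `|f s| <= M) ->
    {for t, continuous (fun t : R => \int[mu]_(s in `]0, Num.max t 0[%classic) f s)}.
  move=> fi fM.
  have L x y : x <= y -> y <= t + 1 ->
      `|\int[mu]_(s in `]0, Num.max y 0[%classic) f s -
        \int[mu]_(s in `]0, Num.max x 0[%classic) f s| <= M * (y - x).
    move=> xy yt; apply: le_trans (Rintegral_lipschitz (fi _) _ _ _) _.
    - by rewrite le_max lexx orbT.
    - by rewrite ge_max !le_max xy lexx !orbT.
    - by move=> s sy; apply: fM; apply: le_trans sy _; rewrite ge_max !le_max yt lexx !orbT.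
    - rewrite ler_wpM2l//; rewrite /Num.max; repeat case: ifPn; rewrite -?leNgt => *; lra.
  apply/cvgrPdist_le => e e0.
  have d0 : 0 < Num.min 1 (e / (M + 1)) by rewrite lt_min ltr01 divr_gt0// ltr_wpDl.
  near=> x.
  have : `|t - x| <= Num.min 1 (e / (M + 1)) by near: x; exact: cvgr_dist_le.
  rewrite le_min => /andP[tx1 txe].
  have step : M * `|t - x| <= e.
    move: txe; rewrite ler_pdivlMr ?ltr_wpDl// => txe.
    by apply: le_trans txe; rewrite mulrC ler_wpM2l// lerDl.
  have [xt|/ltW tx] := leP x t.
    apply: le_trans (L _ _ xt _) _; first by rewrite lerDl.
    by apply: le_trans step; rewrite ler_wpM2l// ler_norm.
  rewrite distrC; apply: le_trans (L _ _ tx _) _.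
    by move: tx1; rewrite distrC => /(le_trans (ler_norm _)); rewrite lerBlDl.
  by apply: le_trans step; rewrite ler_wpM2l// distrC ler_norm.
have gI b := locally_bounded_Cintegrable b gl.
apply/(@cvg_ReIm _ _ (nbhs t) (nbhs_filter t)); split; apply: lip => /=.
- by move=> b; exact: (gI b).1.
- by move=> s st; apply: le_trans (normRe_le _) (gM s st).
- by move=> b; exact: (gI b).2.
- by move=> s st; apply: le_trans (normIm_le _) (gM s st).
Unshelve. all: by end_near. Qed.

End complex_integral.

(** Continuity is tested on sequences because dominated convergence is about sequences. *)
Lemma seq_continuousC (R : realType) (F : R -> Cplx R) :
  (forall (u : nat -> R) (p : R), u @ \oo --> p -> (F \o u) @ \oo --> F p) -> continuous F.
Proof.
move=> Fu p; apply/(@cvg_ReIm _ _ (nbhs p) (nbhs_filter p)); split.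
- apply/(@cvg_nbhsP _ R^o (fun x => complex.Re (F x : R[i]) : R^o) p) => u up.
  by have /cvg_ReIm[] := Fu u p up.
- apply/(@cvg_nbhsP _ R^o (fun x => complex.Im (F x : R[i]) : R^o) p) => u up.
  by have /cvg_ReIm[] := Fu u p up.
Qed.

Section locally_Baire_one.
Context (R : realType) (n : nat) (N : cnorm R n) (h : {posnum R}).
Local Notation V := (Cn N).
Local Notation seg y t := (segment y t : I_ h -> V).
Implicit Types (lam : dual (C_cn h N)) (y z : R -> V).

(** Property (A) for maps of the line, with bounds uniform on each half-line [t <= T]: growth to the
    right is allowed, while the maps in question are constant to the left of [- h]. It yields
    property (A) on compact intervals and along segments at once. *)
Definition locally_Baire_one y := exists y_ : nat -> R -> V,
  [/\ forall m, continuous (y_ m),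
      forall T, exists M, forall m t, t <= T -> N (y_ m t) <= M
    & forall t, (fun m => y_ m t) @ \oo --> y t].

Lemma segment_continuous y t : continuous y -> continuous (seg y t).
Proof.
move=> cy s; apply: (@continuous_comp _ _ _ (fun s : I_ h => t + Ival s)); last exact: cy.
by apply: (ctsD (cts_cst t)); exact: Ival_continuous.
Qed.

Definition csegment y t (cy : continuous y) : C_cn h N := mkcts (@segment_continuous y t cy).

Lemma segment_arg_le (t : R) (s : I_ h) : t + Ival s <= t.
Proof. by have /andP[_] := Ival_itv s; rewrite gerDl. Qed.

Lemma locally_Baire_one_segment y t : locally_Baire_one y -> propertyA setT (seg y t).
Proof.
move=> [y_ [cy yM yy]]; have [M hM] := yM t.
apply: (@cvg_B_nA _ _ _ _ (fun m => csegment t (cy m)) _ M) => [m s|s].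
  by apply: hM; exact: segment_arg_le.
exact: yy.
Qed.

Lemma locally_Baire_one_B_nA y t : locally_Baire_one y -> B_nA (seg y t).
Proof. by move=> yB; exact/propertyA_B_nA/locally_Baire_one_segment. Qed.

Lemma locally_Baire_one_bounded y (T : R) : locally_Baire_one y ->
  exists2 M, 0 <= M & forall t, t <= T -> N (y t) <= M.
Proof.
move=> [y_ [_ /(_ T)[M yM] yy]].
have yM' t : t <= T -> N (y t) <= M.
  move=> tT; apply: (@cvgn_rnorm_le _ V (fun m => y_ m t) (y t) M (yy t)) => j.
  exact: yM.
exists M => //; apply: le_trans (yM' _ (lexx T)); exact: cnorm_ge0.
Qed.

Lemma locally_Baire_one_cts y : continuous y -> (forall T, exists M, forall t, t <= T -> N (y t) <= M) ->
  locally_Baire_one y.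
Proof.
move=> cy yM; exists (fun=> y); split=> // [T|t]; last exact: cvg_cst.
by have [M hM] := yM T; exists M => _; exact: hM.
Qed.

Lemma locally_Baire_one_sub y z : locally_Baire_one y -> locally_Baire_one z ->
  locally_Baire_one (fun t => y t - z t).
Proof.
move=> [y_ [cy yM yy]] [z_ [cz zM zz]]; exists (fun m t => y_ m t - z_ m t); split.
- by move=> m t; apply: (@cvgB _ _ _ (nbhs t)); [exact: cy|exact: cz].
- move=> T; have [M hM] := yM T; have [M' hM'] := zM T; exists (M + M') => m t tT.
  apply: le_trans (@rnormD _ V (y_ m t) (- z_ m t)) _; rewrite rnormN.
  by apply: lerD; [exact: hM|exact: hM'].
- by move=> t; exact: cvgB.
Qed.

Definition segfun lam y (t : R) : R[i] := ext_functional lam (seg y t).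

Lemma segfun_cvg lam (y_ : nat -> R -> V) y t M :
  (forall j, locally_Baire_one (y_ j)) -> (forall j s, s <= t -> N (y_ j s) <= M) ->
  (forall s, (fun j => y_ j s) @ \oo --> y s) ->
  (segfun lam (y_ j) t : Cplx R) @[j --> \oo] --> (segfun lam y t : Cplx R).
Proof.
move=> yB yM yy; apply: (@ext_functional_cvg _ _ _ _ lam (fun j => seg (y_ j) t) _ M).
- by move=> j; exact/B_nA_coord_measurable/locally_Baire_one_B_nA.
- by move=> j s; apply: yM; exact: segment_arg_le.
- by move=> s; exact: yy.
Qed.

(** Along a convergent sequence of times the segments of a continuous map converge pointwise and
    stay bounded, which is all that dominated convergence asks. *)
Lemma segfun_continuous lam y : continuous y ->
  (forall T, exists M, forall t, t <= T -> N (y t) <= M) ->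
  continuous (segfun lam y : R -> Cplx R).
Proof.
move=> cy yM; apply: seq_continuousC => u p up.
have [B uB] : exists B : R, forall j, u j <= B.
  have [|B [_ hB]] := @cvg_seq_bounded R R u; first by apply/cvg_ex; exists p.
  exists (B + 1) => j; rewrite (le_trans (ler_norm _))//.
  by apply: hB; rewrite // ltrDl.
have [M hM] := yM B.
apply: (@ext_functional_cvg _ _ _ _ lam (fun j => seg y (u j)) _ M).
- by move=> j; exact: (cts_coord_measurable (csegment (u j) cy)).
- by move=> j s; apply: hM; apply: le_trans (segment_arg_le _ _) _.
- move=> s; have us : u j + Ival s @[j --> \oo] --> p + Ival s.
    by apply: cvgD => //; exact: cvg_cst.
  exact: (cvg_comp _ y us (cy _)).
Qed.

(** The curve is a pointwise limit of the continuous curves that belong to the continuous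
    approximants of [y], hence Borel. *)
Lemma segfun_measurable lam y : locally_Baire_one y -> locally_bounded_measurable (segfun lam y).
Proof.
move=> yB; have [y_ [cy yM yy]] := yB.
have yM1 m T : exists M, forall t, t <= T -> N (y_ m t) <= M.
  by have [M hM] := yM T; exists M; exact: hM.
have cs t : (segfun lam (y_ j) t : Cplx R) @[j --> \oo] --> (segfun lam y t : Cplx R).
  have [M hM] := yM t; apply: (segfun_cvg (M := M)) => // j.
  exact: locally_Baire_one_cts (yM1 j).
have csm m : continuous (segfun lam (y_ m) : R -> Cplx R).
  exact: segfun_continuous (cy m) (yM1 m).
split.
- apply: (measurable_fun_cvg (h := fun m t => complex.Re (segfun lam (y_ m) t))).
    move=> m; apply: continuous_measurable_fun => t.
    by have /(@cvg_ReIm _ _ (nbhs t) (nbhs_filter t))[] := csm m t.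
  by move=> t _; have /cvg_ReIm[] := cs t.
- apply: (measurable_fun_cvg (h := fun m t => complex.Im (segfun lam (y_ m) t))).
    move=> m; apply: continuous_measurable_fun => t.
    by have /(@cvg_ReIm _ _ (nbhs t) (nbhs_filter t))[] := csm m t.
  by move=> t _; have /cvg_ReIm[] := cs t.
- move=> T; have [M M0 hM] := locally_Baire_one_bounded T yB.
  have [K K0 hK] := ext_functional_bound lam; exists (K * M) => s sT.
  apply: hK; first exact: locally_Baire_one_B_nA.
  by move=> r; apply: hM; apply: le_trans sT; exact: segment_arg_le.
Qed.

End locally_Baire_one.

Lemma uniform_constant (R : realType) (n : nat) (Q : 'I_n -> R -> Prop) :
  (forall i K K', K <= K' -> Q i K -> Q i K') ->
  (forall i, exists2 K, 0 <= K & Q i K) -> exists2 K, 0 <= K & forall i, Q i K.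
Proof.
move=> Qmono QK; have /choice[K hK] i : exists K, 0 <= K /\ Q i K.
  by have [K K0 QiK] := QK i; exists K.
exists (\sum_i K i); first by apply: sumr_ge0 => i _; exact: (hK i).1.
move=> i; apply: Qmono (hK i).2; rewrite (bigD1 i)//= lerDl.
by apply: sumr_ge0 => j _; exact: (hK j).1.
Qed.

(** * Contraction and Picard iteration *)

Section evolution.
Context (R : realType) (n : nat) (N : cnorm R n) (h : {posnum R}).
Context (Lop Rop : Lc (C_cn h N) (Cn N)).
Local Notation V := (Cn N).
Implicit Types (y z w : R -> V).

Definition Lcoord i := Lc_comp (coordinate N i) Lop.
Definition Rcoord i := Lc_comp (coordinate N i) Rop.

(* A solution satisfies [y t = phi 0 + evolution y t] for [t >= 0]. *)
Definition evolution y (t : R) : V :=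
  \row_i (segfun (Lcoord i) y t - segfun (Lcoord i) y 0 + Cint (segfun (Rcoord i) y) t).

Lemma evolution_sub y z t : locally_Baire_one y -> locally_Baire_one z ->
  evolution (fun s => y s - z s) t = evolution y t - evolution z t.
Proof.
move=> yB zB; have segB (lam : dual (C_cn h N)) s :
    segfun lam (fun s => y s - z s) s = segfun lam y s - segfun lam z s.
  by apply: ext_functionalB; exact: locally_Baire_one_B_nA.
apply/rowP => i; rewrite !mxE !segB (_ : segfun (Rcoord i) (fun s => y s - z s) =
    (fun s => segfun (Rcoord i) y s - segfun (Rcoord i) z s)); last first.
  by apply/funext => s; exact: segB.
rewrite CintB; [|exact/locally_bounded_Cintegrable/segfun_measurable|exact/locally_bounded_Cintegrable/segfun_measurable].
have comb (a b c d e f : R[i]) : a - c - (b - d) + (e - f) = a - b + e - (c - d + f) by ring.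
exact: comb.
Qed.

Lemma evolution0 y : evolution y 0 = 0.
Proof.
apply/rowP => i; rewrite !mxE subrr add0r /Cint.
by rewrite set_itv_ge ?bnd_simp ?ltxx// !Rintegral_set0.
Qed.

Lemma segfun_bound : exists2 K : R, 0 <= K & forall i y M t, locally_Baire_one y ->
  (forall s, s <= t -> N (y s) <= M) ->
  normc (segfun (Lcoord i) y t) <= K * M /\ normc (segfun (Rcoord i) y t) <= K * M.
Proof.
apply: uniform_constant => [i K K' KK' H y M t yB yM|i].
  have M0 : 0 <= M by apply: le_trans (yM t (lexx t)); exact: cnorm_ge0.
  have [h1 h2] := H y M t yB yM.
  by split; [apply: le_trans h1 _|apply: le_trans h2 _]; rewrite ler_wpM2r.
have [K K0 hK] := ext_functional_bound (Lcoord i).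
have [K' K'0 hK'] := ext_functional_bound (Rcoord i).
exists (K + K'); first by rewrite addr_ge0.
move=> y M t yB yM; have M0 : 0 <= M by apply: le_trans (yM t (lexx t)); exact: cnorm_ge0.
have sM (s : I_ h) : N (segment y t s) <= M by apply: yM; exact: segment_arg_le.
have yA := locally_Baire_one_B_nA h t yB.
split; rewrite /segfun.
  by rewrite (le_trans (hK _ M yA sM))// ler_wpM2r// lerDl.
by rewrite (le_trans (hK' _ M yA sM))// ler_wpM2r// lerDr.
Qed.

(** The exponential serves to measure the first Picard difference in the weighted norm: it is at
    least 1 for [t >= 0], and it absorbs the integral. *)
Lemma evolution_bound (a : R) : 0 < a -> exists2 c : R, 0 <= c &
  forall y M t, locally_Baire_one y -> 0 <= t -> (forall s, s <= t -> N (y s) <= M) ->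
    N (evolution y t) <= c * M * expR (a * t).
Proof.
move=> a0; have [K K0 hK] := segfun_bound; have [C C0 hC] := cnorm_le_coord N.
exists (C * (2 * K + 2 * K * a^-1)).
  by rewrite mulr_ge0// addr_ge0// !mulr_ge0// invr_ge0 ltW.
move=> y M t yB t0 yM; have M0 : 0 <= M.
  by apply: le_trans (yM t (lexx t)); exact: cnorm_ge0.
rewrite -!mulrA; apply: hC => i; rewrite mxE.
have exp1 s : 0 <= s -> 1 <= expR (a * s).
  by move=> s0; rewrite -[leLHS]expR0 ler_expR mulr_ge0// ltW.
apply: le_trans (le_normcD _ _) _.
have h1 := (hK i y M t yB yM).1.
have h2 := (hK i y M 0 yB (fun s s0 => yM s (le_trans s0 t0))).1.
have h3 : normc (Cint (segfun (Rcoord i) y) t) <= 2 * (K * M) * a^-1 * expR (a * t).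
  apply: Cint_expR_le => //; first by rewrite mulr_ge0.
    exact/locally_bounded_Cintegrable/segfun_measurable.
  move=> s /andP[s0 st]; apply: (@le_trans _ _ (K * M)).
    by apply: (hK i y M s yB _).2 => r rs; apply: yM; apply: le_trans rs (ltW st).
  by rewrite ler_peMr ?mulr_ge0// exp1// ltW.
have h4 : normc (segfun (Lcoord i) y t - segfun (Lcoord i) y 0) <= 2 * (K * M) * expR (a * t).
  apply: le_trans (le_normcD _ _) _; rewrite normcN.
  apply: (@le_trans _ _ (2 * (K * M))); first by lra.
  by rewrite ler_peMr ?exp1// !mulr_ge0.
apply: le_trans (lerD h4 h3) _.
by rewrite le_eqVlt; apply/orP; left; apply/eqP; ring.
Qed.

Lemma evolution_cvg (y_ : nat -> R -> V) y t M : 0 <= t ->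
  (forall j, locally_Baire_one (y_ j)) -> (forall j s, s <= t -> N (y_ j s) <= M) ->
  (forall s, (fun j => y_ j s) @ \oo --> y s) ->
  (fun j => evolution (y_ j) t) @ \oo --> evolution y t.
Proof.
move=> t0 yB yM yy; apply/cvg_coord => i.
have E (x : R -> V) : (evolution x t 0 i : Cplx R) =
    segfun (Lcoord i) x t - segfun (Lcoord i) x 0 + Cint (segfun (Rcoord i) x) t.
  by rewrite mxE.
have -> : (fun j => evolution (y_ j) t 0 i : Cplx R) = (fun j => segfun (Lcoord i) (y_ j) t -
    segfun (Lcoord i) (y_ j) 0 + Cint (segfun (Rcoord i) (y_ j)) t).
  by apply/funext => j; exact: E.
rewrite E; apply: (@cvgD _ (Cplx R)).
  apply: (@cvgB _ (Cplx R)); first exact: (segfun_cvg yB yM yy).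
  by apply: (segfun_cvg yB _ yy) => j s s0; apply: yM; exact: le_trans t0.
have [K K0 hK] := segfun_bound.
apply: (@Cint_cvg _ (fun j => segfun (Rcoord i) (y_ j)) (segfun (Rcoord i) y) t (K * M) _ _ _).2.
- by move=> j; exact: segfun_measurable.
- move=> j s st; apply: (hK i (y_ j) M s (yB j) _).2 => r rs.
  by apply: yM; exact: le_trans st.
- move=> s st; apply: (segfun_cvg yB _ yy) => j r rs; apply: yM; exact: le_trans st.
Qed.

Lemma evolution_continuous y : continuous y ->
  (forall T, exists M, forall t, t <= T -> N (y t) <= M) ->
  continuous (fun t : R => evolution y (Num.max t 0)).
Proof.
move=> cy yM t; have cm : continuous (fun t : R => Num.max t 0).
  by apply: cts_max; [move=> ?|exact: cts_cst].
apply/(@cvg_coord _ _ _ _ (nbhs t) (nbhs_filter t)) => i.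
have E (x : R) : (evolution y (Num.max x 0) 0 i : Cplx R) =
    segfun (Lcoord i) y (Num.max x 0) - segfun (Lcoord i) y 0
    + Cint (segfun (Rcoord i) y) (Num.max x 0) by rewrite mxE.
have -> : (fun x : R => evolution y (Num.max x 0) 0 i : Cplx R) =
   (fun x : R => segfun (Lcoord i) y (Num.max x 0) - segfun (Lcoord i) y 0
    + Cint (segfun (Rcoord i) y) (Num.max x 0)).
  by apply/funext => x; exact: E.
rewrite E; apply: (@cvgD _ (Cplx R) _ (nbhs t)); last first.
  by apply: Cint_continuous; exact/segfun_measurable/locally_Baire_one_cts.
apply: (@cvgB _ (Cplx R) _ (nbhs t)); last exact: cvg_cst.
apply: (@continuous_comp _ _ _ (fun t : R => Num.max t 0) (segfun (Lcoord i) y : R -> Cplx R)).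
  exact: cm.
exact: segfun_continuous.
Qed.

(* [a] is chosen so that the delayed term costs [expR (- a * d) <= (a * d)^-1] and
   the integral [a^-1], up to constants. *)
Lemma evolution_contraction (d : R) : 0 < d < h%:num ->
  (forall f : C_cn h N, (forall s : I_ h, Ival s <= - d -> f s = 0) -> Lop f = 0) ->
  exists2 a : R, 0 < a & forall w D t, locally_Baire_one w -> 0 <= t -> 0 <= D ->
    (forall s, s <= 0 -> w s = 0) ->
    (forall s, s <= t -> N (w s) <= D * expR (a * s)) ->
    N (evolution w t) <= D / 2 * expR (a * t).
Proof.
move=> dh Ld; have d0 : 0 < d by have /andP[] := dh.
have [K K0 hK] := segfun_bound; have [C C0 hC] := cnorm_le_coord N.
have [K' K'0 hK'] : exists2 K, 0 <= K & forall i phi M, B_nA phi ->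
    (forall s : I_ h, Ival s <= - d -> N (phi s) <= M) ->
    normc (ext_functional (Lcoord i) phi) <= K * M.
  apply: uniform_constant => [i K1 K2 K12 H phi M phiA phiM|i].
    apply: le_trans (H _ _ phiA phiM) _; rewrite ler_wpM2r//.
    (* As [d < h], the point [- h] lies in the part of the interval that is controlled, which forces
       [M] to be nonnegative. *)
    have hd : - h%:num <= - d :> R by rewrite lerN2 ltW//; have /andP[] := dh.
    have := phiM (clampI h (- h%:num)); rewrite clampI_id ?lexx ?oppr_le0 ?ge0//.
    by move=> /(_ hd); apply: le_trans; exact: cnorm_ge0.
  exact: (ext_functional_delay (coordinate N i) dh Ld).
(* In units of [D * expR (a * t)], the delayed term contributes [C * K' / (a * d)] and the integral
   [2 * C * K / a]; this [a] makes their sum at most 1/2, and the 1 keeps it positive. *)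
pose a := 2 * C * (K' / d + 2 * K) + 1.
have a0 : 0 < a by rewrite /a ltr_wpDl// !mulr_ge0// addr_ge0// ?mulr_ge0// invr_ge0 ltW.
exists a => // w D t wB t0 D0 w0 wD.
have wM s r : r <= s -> s <= t -> N (w r) <= D * expR (a * s).
  move=> rs st; apply: le_trans (wD r (le_trans rs st)) _.
  by rewrite ler_wpM2l// ler_expR ler_wpM2l// ltW.
have e0 : 0 <= expR (a * t) by exact: expR_ge0.
have h1 i : normc (segfun (Lcoord i) w t) <= K' * D * (a * d)^-1 * expR (a * t).
  apply: (@le_trans _ _ (K' * (D * expR (a * (t - d))))).
    apply: hK'; first exact: locally_Baire_one_B_nA.
    move=> s sd; apply: wM; first by rewrite lerD2l.
    by rewrite gerBl ltW.
  rewrite -!mulrA ler_wpM2l// ler_wpM2l// mulrBr expRD mulrC ler_wpM2r//.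
  rewrite expRN lef_pV2 ?posrE ?expR_gt0// ?mulr_gt0//.
  by apply: le_trans (expR_ge1Dx _); rewrite lerDr.
have h2 i : segfun (Lcoord i) w 0 = 0.
  apply/eqP; rewrite -normr_eq0; apply/eqP.
  have : normc (segfun (Lcoord i) w 0) <= K * 0.
    by apply: (hK i w 0 0 wB _).1 => s /w0 ->; rewrite cnorm0.
  rewrite mulr0 => H; have : normc (segfun (Lcoord i) w 0) = 0.
    by apply/eqP; rewrite eq_le H normc_ge0.
  by move/Normc.eq0_normc ->; rewrite normr0.
have h3 i : normc (Cint (segfun (Rcoord i) w) t) <= 2 * (K * D) * a^-1 * expR (a * t).
  apply: Cint_expR_le => //; first by rewrite mulr_ge0.
    exact/locally_bounded_Cintegrable/segfun_measurable.
  move=> s /andP[s0 st]; rewrite -mulrA; apply: (hK i w _ s wB _).2 => r rs.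
  by apply: wM => //; exact: ltW.
apply: (@le_trans _ _ (C * (K' * D * (a * d)^-1 * expR (a * t) +
    2 * (K * D) * a^-1 * expR (a * t)))).
  apply: hC => i; rewrite mxE h2 subr0.
  by apply: le_trans (le_normcD _ _) _; exact: lerD.
have aE : C * (K' / d + 2 * K) * a^-1 <= 2^-1.
  by rewrite ler_pdivrMr// ler_pdivlMl// /a !mulrA lerDl.
have -> : C * (K' * D * (a * d)^-1 * expR (a * t) + 2 * (K * D) * a^-1 * expR (a * t)) =
    C * (K' / d + 2 * K) * a^-1 * (D * expR (a * t)).
  by rewrite invfM; ring.
by rewrite [leRHS]mulrAC [leRHS]mulrC ler_wpM2r// mulr_ge0.
Qed.

End evolution.

Lemma le0_geometric (R : realType) (x B : R) : (forall k, x <= B * 2^-1 ^+ k) -> x <= 0.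
Proof.
move=> xB; have cB : (fun k => B * 2^-1 ^+ k) @ \oo --> (B * 0 : R).
  by apply: cvgM; [exact: cvg_cst|apply: cvg_expr; rewrite ger0_norm ?invr_ge0// invf_lt1// ltr1n].
rewrite -(mulr0 B) -(cvg_lim _ cB)//; apply: limr_ge; first by apply/cvg_ex; exists (B * 0).
exact: nearW.
Qed.

(** Nested intervals: [a] increases, [b] decreases, and [2 * B * 2^-1 ^+ k] is the tail of the
    geometric series. The limit thus comes together with its rate. *)
Lemma geometric_limit_real (R : realType) (r : nat -> R) (B : R) :
  (forall k, `|r k.+1 - r k| <= B * 2^-1 ^+ k) ->
  exists l, forall k, `|r k - l| <= 2 * B * 2^-1 ^+ k.
Proof.
move=> rB; pose a k := r k - 2 * B * 2^-1 ^+ k; pose b k := r k + 2 * B * 2^-1 ^+ k.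
have B0 k : 0 <= B * 2^-1 ^+ k by apply: le_trans (rB k); exact: normr_ge0.
have step k : a k <= a k.+1 /\ b k.+1 <= b k.
  have := rB k; rewrite ler_norml => /andP[h1 h2].
  by rewrite /a /b exprS; split; lra.
have ab k : a k <= b k by rewrite /a /b; have := B0 k; lra.
have amono : nondecreasing_seq a by apply/nondecreasing_seqP => k; exact: (step k).1.
have bmono : nonincreasing_seq b by apply/nonincreasing_seqP => k; exact: (step k).2.
have abkm k m : a k <= b m.
  apply: le_trans (amono _ _ (leq_maxl k m)) _; apply: le_trans (ab _) _.
  exact: bmono (leq_maxr k m).
have supa : has_sup (range a) by split; [exists (a 0%N), 0%N|exists (b 0%N) => _ [k _ <-]].
exists (sup (range a)) => k.
have h1 : a k <= sup (range a) by apply: sup_upper_bound => //; exists k.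
have h2 : sup (range a) <= b k.
  by apply: ge_sup; [exact: supa.1|move=> _ [m _ <-]].
by move: h1 h2; rewrite /a /b ler_norml => h1 h2; apply/andP; split; lra.
Qed.

(** The 4 is a 2 from the geometric tail times a 2 from real and imaginary part; [C] and [C']
    compare the norm with the coordinates. The constant does not depend on the sequence, which later
    makes rates uniform in the initial map. *)
Lemma geometric_limit (R : realType) (n : nat) (N : cnorm R n) : exists2 C : R, 0 <= C &
  forall (u : nat -> Cn N) (B : R),
    (forall k, N (u k.+1 - u k) <= B * 2^-1 ^+ k) ->
    exists l : Cn N, forall k, N (u k - l) <= C * B * 2^-1 ^+ k.
Proof.
have [C C0 hC] := cnorm_le_coord N; have [C' C'0 hC'] := coord_le_cnorm N.
exists (C * (4 * C')); first by rewrite !mulr_ge0.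
move=> u B uB.
have part (p : R[i] -> R) : (forall x y, p (x - y) = p x - p y) ->
    (forall x, `|p x| <= normc x) -> forall i,
    exists l, forall k, `|p (u k 0 i) - l| <= 2 * (C' * B) * 2^-1 ^+ k.
  move=> pB ple i; apply: geometric_limit_real => k; rewrite -pB.
  apply: le_trans (ple _) _; have := hC' (u k.+1 - u k) i; rewrite !mxE => /le_trans; apply.
  by rewrite -mulrA ler_wpM2l.
have /choice[lr hlr] := part (@complex.Re R) (raddfB _) (@normRe_le R).
have /choice[li hli] := part (@complex.Im R) (raddfB _) (@normIm_le R).
exists (\row_i (Complex (lr i) (li i))) => k; rewrite -!mulrA; apply: hC => i.
rewrite !mxE; apply: le_trans (normc_le _) _; rewrite !raddfB /=.
apply: le_trans (lerD (hlr i k) (hli i k)) _.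
by rewrite le_eqVlt; apply/orP; left; apply/eqP; ring.
Qed.

Section picard.
Context (R : realType) (n : nat) (N : cnorm R n) (h : {posnum R}).
Context (Lop Rop : Lc (C_cn h N) (Cn N)).
Local Notation V := (Cn N).
Local Notation ev := (evolution Lop Rop).
Implicit Types (phi : I_ h -> V) (y : R -> V).

(** One formula on the line: for [t <= 0] the second term vanishes by [evolution0] and [phi]
    remains, for [t >= 0] the first is frozen at [phi 0]. The pieces meet continuously at 0. *)
Definition picard_step phi y (t : R) : V := phi (clampI h t) + ev y (Num.max t 0).

Fixpoint picard phi k : R -> V :=
  if k is k'.+1 then picard_step phi (picard phi k') else phi \o clampI h.

Lemma picard_le0 phi k t : t <= 0 -> picard phi k t = phi (clampI h t).
Proof. by case: k => [//|k] t0 /=; rewrite /picard_step max_r// evolution0 addr0. Qed.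

Let cts_bound (f : C_cn h N) s : N (f s) <= rnorm f.
Proof. exact: (cfun_le_supnorm f s). Qed.

(** The three properties need a common induction: evolution estimates for the next iterate require
    the present one to be locally Baire-one, and this follows from continuity, bounds and
    convergence of the present iterates of continuous approximants. *)
Let picard_props k :
  [/\ forall f : C_cn h N, continuous (picard f k),
      forall M T, exists M', forall phi, B_nA phi -> (forall s, N (phi s) <= M) ->
        forall t, t <= T -> N (picard phi k t) <= M'
    & forall (phi_ : nat -> I_ h -> V) phi M, (forall j, B_nA (phi_ j)) ->
        (forall j s, N (phi_ j s) <= M) -> (forall s, phi_ ^~ s @ \oo --> phi s) ->
        forall t, (fun j => picard (phi_ j) k t) @ \oo --> picard phi k t].
Proof.
elim: k => [|k [IHc IHb IHl]].
  split.
  - move=> f t; apply: continuous_comp; first exact: clampI_continuous.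
    exact: (@cts_fun _ _ f).
  - by move=> M T; exists M => phi _ phiM t _; exact: phiM.
  - by move=> phi_ phi M _ _ phil t; exact: phil.
have PB1 phi : B_nA phi -> locally_Baire_one (picard phi k).
  move=> phiA; have [K K0 phiK] := B_nA_bounded phiA.
  have [f [fK fphi]] := B_nA_approx phiA K0 phiK.
  exists (fun m => picard (f m) k); split.
  - by move=> m; exact: IHc.
  - move=> T; have [M' hM'] := IHb K T; exists M' => m t tT.
    exact: (hM' (f m) (cts_B_nA (f m)) (fK m) t tT).
  - exact: (IHl (fun m => f m) phi K (fun j => cts_B_nA (f j)) fK fphi).
split.
- move=> f; have fB : forall T, exists M, forall t, t <= T -> N (picard f k t) <= M.
    move=> T; have [M' hM'] := IHb (rnorm f) T; exists M' => t.
    exact: (hM' f (cts_B_nA f) (cts_bound f) t).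
  move=> t; apply: (@cvgD _ _ _ (nbhs t)); last exact: (evolution_continuous (IHc f) fB).
  apply: (@continuous_comp _ _ _ (clampI h)); first exact: clampI_continuous.
  exact: (@cts_fun _ _ f).
- move=> M T; have [M' hM'] := IHb M (Num.max T 0).
  have [c c0 hc] := evolution_bound Lop Rop (@ltr01 R).
  exists (M + c * M' * expR (1 * Num.max T 0)) => phi phiA phiM t tT.
  apply: le_trans (cnormD _ _ _) _; apply: lerD; first exact: phiM.
  have tT0 : Num.max t 0 <= Num.max T 0 by rewrite ge_max !le_max tT lexx orbT.
  have M'0 : 0 <= M'.
    by apply: le_trans (hM' phi phiA phiM _ (lexx _)); exact: cnorm_ge0.
  apply: (@le_trans _ _ (c * M' * expR (1 * Num.max t 0))).
    apply: hc => [||s st]; [exact: PB1|by rewrite le_max lexx orbT|].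
    exact: (hM' phi phiA phiM s (le_trans st tT0)).
  by rewrite ler_wpM2l ?mulr_ge0// ler_expR !mul1r.
- move=> phi_ phi M phiA phiM phil t; apply: cvgD; first exact: phil.
  have [M' hM'] := IHb M (Num.max t 0).
  apply: (evolution_cvg (M := M')); first by rewrite le_max lexx orbT.
  + by move=> j; exact: PB1.
  + by move=> j s st; exact: (hM' (phi_ j) (phiA j) (phiM j) s st).
  + exact: (IHl phi_ phi M phiA phiM phil).
Qed.

Lemma picard_continuous (f : C_cn h N) k : continuous (picard f k).
Proof. by have [] := picard_props k. Qed.

Lemma picard_cvg (phi_ : nat -> I_ h -> V) phi M k t : (forall j, B_nA (phi_ j)) ->
  (forall j s, N (phi_ j s) <= M) -> (forall s, phi_ ^~ s @ \oo --> phi s) ->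
  (fun j => picard (phi_ j) k t) @ \oo --> picard phi k t.
Proof. by have [_ _ H] := picard_props k; move=> phiA phiM phil; exact: (H phi_ phi M phiA phiM phil t). Qed.

Lemma picard_locally_Baire_one phi k : B_nA phi -> locally_Baire_one (picard phi k).
Proof.
have [cP bP _] := picard_props k.
move=> phiA; have [K K0 phiK] := B_nA_bounded phiA.
have [f [fK fphi]] := B_nA_approx phiA K0 phiK.
exists (fun m => picard (f m) k); split.
- by move=> m; exact: picard_continuous.
- move=> T; have [M' hM'] := bP K T; exists M' => m t tT.
  exact: (hM' (f m) (cts_B_nA (f m)) (fK m) t tT).
- by move=> t; exact: (@picard_cvg (fun m => f m) phi K k t (fun j => cts_B_nA (f j)) fK fphi).
Qed.

End picard.

(** * Existence, continuous dependence and uniqueness *)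

Section solution.
Context (R : realType) (n : nat) (N : cnorm R n) (h : {posnum R}).
Context (Lop Rop : Lc (C_cn h N) (Cn N)).
Context (hDelta : condition_Delta Lop).
Local Notation V := (Cn N).
Local Notation ev := (evolution Lop Rop).
Local Notation picard := (picard Lop Rop).
Implicit Types (phi : I_ h -> V) (y z w : R -> V).

Let contraction : exists2 a : R, 0 < a & forall w D t, locally_Baire_one w -> 0 <= t -> 0 <= D ->
    (forall s, s <= 0 -> w s = 0) ->
    (forall s, s <= t -> N (w s) <= D * expR (a * s)) ->
    N (ev w t) <= D / 2 * expR (a * t).
Proof. by have [d [dh Ld]] := hDelta; exact: evolution_contraction dh Ld. Qed.

Let a : R := s2val (cid2 contraction).
Let a0 : 0 < a. Proof. exact: s2valP (cid2 contraction). Qed.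
Let ha w D t : locally_Baire_one w -> 0 <= t -> 0 <= D ->
    (forall s, s <= 0 -> w s = 0) ->
    (forall s, s <= t -> N (w s) <= D * expR (a * s)) ->
    N (ev w t) <= D / 2 * expR (a * t).
Proof. exact: s2valP' (cid2 contraction) w D t. Qed.

Let half_ge0 k : 0 <= 2^-1 ^+ k :> R. Proof. by rewrite exprn_ge0. Qed.

Let picard_geometric : exists2 c : R, 0 <= c &
  forall phi M k t, B_nA phi -> (forall s, N (phi s) <= M) -> 0 <= t ->
    N (picard phi k.+1 t - picard phi k t) <= c * M * 2^-1 ^+ k * expR (a * t).
Proof.
have [c c0 hc] := evolution_bound Lop Rop a0; exists c => // phi M k t phiA phiM.
have M0 : 0 <= M by apply: le_trans (phiM Izero); exact: cnorm_ge0.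
have B j := picard_locally_Baire_one Lop Rop j phiA.
elim: k t => [|k IH] t t0.
  have -> : picard phi 1 t - picard phi 0 t = ev (picard phi 0) t.
    by rewrite /= /picard_step (max_l t0) addrC addKr.
  rewrite expr0 mulr1; apply: (hc (picard phi 0) M t (B 0%N) t0) => s _.
  exact: phiM.
have -> : picard phi k.+2 t - picard phi k.+1 t =
    ev (fun s => picard phi k.+1 s - picard phi k s) t.
  rewrite (evolution_sub Lop Rop t (B k.+1) (B k)).
  rewrite -[picard phi k.+2 t]/(phi (clampI h t) + ev (picard phi k.+1) (Num.max t 0)).
  rewrite -[X in _ - X = _]/(phi (clampI h t) + ev (picard phi k) (Num.max t 0)).
  by rewrite (max_l t0) opprD addrACA subrr add0r.
have D0 : 0 <= c * M * 2^-1 ^+ k by rewrite !mulr_ge0.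
(* Consecutive iterates agree for [s <= 0], as the contraction requires; its factor 1/2 is the new
   power. *)
rewrite exprSr mulrA; apply: (ha (locally_Baire_one_sub (B k.+1) (B k)) t0 D0) => [s s0|s st].
  by rewrite !(picard_le0 _ _ _ _ s0) subrr.
have [s0|/ltW s0] := leP 0 s; first exact: IH.
by rewrite !(picard_le0 _ _ _ _ s0) subrr cnorm0 mulr_ge0// expR_ge0.
Qed.

Let c : R := s2val (cid2 picard_geometric).
Let c0 : 0 <= c. Proof. exact: s2valP (cid2 picard_geometric). Qed.
Let hc phi M k t : B_nA phi -> (forall s, N (phi s) <= M) ->
  N (picard phi k.+1 t - picard phi k t) <= c * M * expR (a * Num.max t 0) * 2^-1 ^+ k.
Proof.
move=> phiA phiM; have M0 : 0 <= M by apply: le_trans (phiM Izero); exact: cnorm_ge0.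
have [t0|/ltW t0] := leP 0 t.
  rewrite mulrAC; apply: (s2valP' (cid2 picard_geometric)) => //.
by rewrite !(picard_le0 _ _ _ _ t0) subrr cnorm0 !mulr_ge0// expR_ge0.
Qed.

(** [Y] has to be chosen from [phi] alone, whereas the rate must hold for every bound [M]. The limit
    is therefore taken with one bound [K] and identified with the limit for any other [M], since
    both are approached geometrically. Outside [B_nA] the value 0 is a default. *)
Let limit_ex : exists2 C : R, 0 <= C & exists Y : (I_ h -> V) -> R -> V,
  forall phi, B_nA phi -> forall M, (forall s, N (phi s) <= M) -> forall k t,
    N (picard phi k t - Y phi t) <= C * M * expR (a * Num.max t 0) * 2^-1 ^+ k.
Proof.
have [C C0 hC] := geometric_limit N; exists (C * c); first exact: mulr_ge0.
have lim phi M t : B_nA phi -> (forall s, N (phi s) <= M) -> exists l : V, forall k,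
    N (picard phi k t - l) <= C * c * M * expR (a * Num.max t 0) * 2^-1 ^+ k.
  move=> phiA phiM; have [l hl] := hC (fun k => picard phi k t) _ (fun k => hc k t phiA phiM).
  by exists l => k; have := hl k; rewrite !mulrA.
suff /choice[Y hY] : forall phi, exists y : R -> V, B_nA phi ->
    forall M, (forall s, N (phi s) <= M) -> forall k t,
    N (picard phi k t - y t) <= C * c * M * expR (a * Num.max t 0) * 2^-1 ^+ k.
  by exists Y.
move=> phi; have [phiA|phiA] := pselect (B_nA phi); last by exists (fun=> 0).
have [K K0 phiK] := B_nA_bounded phiA.
have /choice[y hy] t := lim phi K t phiA phiK.
exists y => _ M phiM k t; have [l hl] := lim phi M t phiA phiM.
suff -> : y t = l by exact: hl.
apply/eqP; rewrite -subr_eq0; apply/eqP/(@cnorm_eq0 _ _ N)/eqP.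
rewrite eq_le cnorm_ge0 andbT.
apply: (@le0_geometric _ _ (C * c * M * expR (a * Num.max t 0) + C * c * K * expR (a * Num.max t 0))).
move=> j; rewrite mulrDl; apply: le_trans (lerD (hl j) (hy t j)).
have -> : y t - l = (picard phi j t - l) + - (picard phi j t - y t).
  by rewrite opprB [RHS]addrC addrA subrK.
by have := @rnormD _ (Cn N) (picard phi j t - l) (- (picard phi j t - y t)); rewrite rnormN.
Qed.

Let C : R := s2val (cid2 limit_ex).
Let C0 : 0 <= C. Proof. exact: s2valP (cid2 limit_ex). Qed.
Let Y : (I_ h -> V) -> R -> V := projT1 (cid (s2valP' (cid2 limit_ex))).
Let hY phi M k t : B_nA phi -> (forall s, N (phi s) <= M) ->
  N (picard phi k t - Y phi t) <= C * M * expR (a * Num.max t 0) * 2^-1 ^+ k.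
Proof. by move=> phiA phiM; exact: (projT2 (cid (s2valP' (cid2 limit_ex))) phi phiA M phiM k t). Qed.

Let Y_le0 phi t : B_nA phi -> t <= 0 -> Y phi t = phi (clampI h t).
Proof.
move=> phiA t0; have [K K0 phiK] := B_nA_bounded phiA.
apply/esym/eqP; rewrite -subr_eq0; apply/eqP/(@cnorm_eq0 _ _ N)/eqP.
rewrite eq_le cnorm_ge0 andbT.
apply: (@le0_geometric _ _ (C * K * expR (a * Num.max t 0))) => k.
by have := hY k t phiA phiK; rewrite (picard_le0 _ _ _ _ t0).
Qed.

Let Y_bound phi M t : B_nA phi -> (forall s, N (phi s) <= M) ->
  N (Y phi t) <= (1 + C * expR (a * Num.max t 0)) * M.
Proof.
move=> phiA phiM; have := hY 0 t phiA phiM; rewrite expr0 mulr1 => H.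
rewrite mulrDl mul1r mulrAC.
have -> : Y phi t = phi (clampI h t) - (picard phi 0 t - Y phi t).
  by rewrite /= opprB addrC subrK.
apply: le_trans (@rnormD _ (Cn N) _ _) _; rewrite rnormN.
by apply: lerD => //; exact: phiM.
Qed.

(** The rate depends on the initial map only through its bound, so a single [k] serves the sequence
    and its limit; for that [k] the iterates converge. *)
Let Y_cvg (phi_ : nat -> I_ h -> V) phi M t : (forall j, B_nA (phi_ j)) -> B_nA phi ->
  (forall j s, N (phi_ j s) <= M) -> (forall s, phi_ ^~ s @ \oo --> phi s) ->
  (fun j => Y (phi_ j) t) @ \oo --> Y phi t.
Proof.
move=> phiA phiA' phiM phil.
have phiM' s : N (phi s) <= M.
  by apply: (@cvgn_rnorm_le _ V (phi_ ^~ s) (phi s) M (phil s)) => j; exact: phiM.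
apply/cvg_rnormP/cvgrPdist_le => e e0.
pose X := C * M * expR (a * Num.max t 0).
have [k hk] : exists k, X * 2^-1 ^+ k <= e / 3.
  apply/not_existsP => H; suff : e / 3 <= 0 by apply/negP; rewrite -ltNge divr_gt0.
  apply: (@le0_geometric _ _ X) => k.
  by have /negP := H k; rewrite -ltNge => /ltW.
have /cvg_rnormP/cvgrPdist_le/(_ (e / 3)) := @picard_cvg _ _ _ _ Lop Rop phi_ phi M k t phiA phiM phil.
rewrite divr_gt0// => /(_ isT); apply: filterS => j.
rewrite !sub0r !normrN !ger0_norm ?rnorm_ge0// => hj.
have h1 := hY k t (phiA j) (phiM j); have h2 := hY k t phiA' phiM'.
rewrite -/X in h1 h2.
have -> : Y (phi_ j) t - Y phi t = - (picard (phi_ j) k t - Y (phi_ j) t) +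
    (picard (phi_ j) k t - picard phi k t) + (picard phi k t - Y phi t).
  by rewrite opprB !addrA !subrK.
have h3 := rnormD (- (picard (phi_ j) k t - Y (phi_ j) t) +
    (picard (phi_ j) k t - picard phi k t)) (picard phi k t - Y phi t).
have h4 := rnormD (- (picard (phi_ j) k t - Y (phi_ j) t))
    (picard (phi_ j) k t - picard phi k t).
rewrite rnormN in h4; rewrite !rnorm_CnE in h1 h2 h3 h4 hj *; lra.
Qed.

(** The rate is uniform on [s <= t + 1], so continuity at [t] is inherited from the iterates. *)
Let Y_continuous (f : C_cn h N) : continuous (Y f).
Proof.
move=> t; have fA := cts_B_nA f.
have fM s : N (f s) <= rnorm f by exact: (cfun_le_supnorm f s).
apply/(@cvg_rnormP _ _ _ (nbhs t) (nbhs_filter t))/cvgrPdist_le => e e0.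
pose X := C * rnorm f * expR (a * Num.max (t + 1) 0).
have X0 : 0 <= C * rnorm f by rewrite mulr_ge0// rnorm_ge0.
have [k hk] : exists k, X * 2^-1 ^+ k <= e / 3.
  apply/not_existsP => H; suff : e / 3 <= 0 by apply/negP; rewrite -ltNge divr_gt0.
  apply: (@le0_geometric _ _ X) => k.
  by have /negP := H k; rewrite -ltNge => /ltW.
have hX s : s <= t + 1 -> N (picard f k s - Y f s) <= X * 2^-1 ^+ k.
  move=> st; apply: le_trans (hY k s fA fM) _.
  rewrite ler_wpM2r// ler_wpM2l// ler_expR ler_wpM2l ?(ltW a0)//.
  by rewrite ge_max !le_max st lexx orbT.
have e3 : 0 < e / 3 by rewrite divr_gt0.
have pc : picard f k s @[s --> t] --> picard f k t by exact: (@picard_continuous _ _ _ _ Lop Rop f k t).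
move/(@cvg_rnormP _ _ _ (nbhs t) (nbhs_filter t))/cvgrPdist_le/(_ _ e3) : pc => pc.
near=> s.
have st : s <= t + 1.
  have : `|t - s| <= 1 by near: s; exact: cvgr_dist_le.
  by rewrite ler_norml => /andP[+ _]; rewrite lerNl opprB lerBlDl.
have hj : `|0 - rnorm (picard f k s - picard f k t)| <= e / 3 by near: s.
move: hj; rewrite !sub0r !normrN !ger0_norm ?rnorm_ge0// => hj.
have h1 := hX s st; have h2 := hX t (ltac:(by rewrite lerDl)).
have -> : Y f s - Y f t = - (picard f k s - Y f s) +
    (picard f k s - picard f k t) + (picard f k t - Y f t).
  by rewrite opprB !addrA !subrK.
have h3 := rnormD (- (picard f k s - Y f s) + (picard f k s - picard f k t)) (picard f k t - Y f t).
have h4 := rnormD (- (picard f k s - Y f s)) (picard f k s - picard f k t).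
rewrite rnormN in h4; rewrite !rnorm_CnE in h1 h2 h3 h4 hj *; lra.
Unshelve. all: by end_near. Qed.

Let Y_locally_Baire_one phi : B_nA phi -> locally_Baire_one (Y phi).
Proof.
move=> phiA; have [K K0 phiK] := B_nA_bounded phiA.
have [f [fK fphi]] := B_nA_approx phiA K0 phiK.
exists (fun m => Y (f m)); split.
- by move=> m; exact: Y_continuous.
- move=> T; exists ((1 + C * expR (a * Num.max T 0)) * K) => m t tT.
  apply: le_trans (Y_bound t (cts_B_nA (f m)) (fK m)) _.
  rewrite ler_wpM2r ?(ltW K0)// lerD2l ler_wpM2l// ler_expR ler_wpM2l ?(ltW a0)//.
  by rewrite ge_max !le_max tT lexx orbT.
- by move=> t; exact: (@Y_cvg (fun m => f m) phi K t (fun j => cts_B_nA (f j)) phiA fK fphi).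
Qed.

(** The error [picard phi k - Y phi] vanishes for [s <= 0] and is of order [2^-1 ^+ k] in the
    weighted norm, so the contraction controls the difference of the evolutions. For this [Y phi]
    must already be known to be locally Baire-one. *)
Let Y_fixed phi t : B_nA phi -> 0 <= t -> Y phi t = phi Izero + ev (Y phi) t.
Proof.
move=> phiA t0; have [K K0 phiK] := B_nA_bounded phiA.
have clamp0 : clampI h t = Izero.
  have h0 : - h%:num <= 0 :> R by rewrite oppr_le0 ge0.
  by apply: (can_inj (@IvalK R h)); rewrite Ival_clampI (min_r t0) (max_r h0).
apply/eqP; rewrite -subr_eq0; apply/eqP/(@cnorm_eq0 _ _ N)/eqP.
rewrite eq_le cnorm_ge0 andbT.
pose X := C * K * expR (a * Num.max t 0).
apply: (@le0_geometric _ _ (2 * X)) => k.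
have B1 := picard_locally_Baire_one Lop Rop k phiA; have B2 := Y_locally_Baire_one phiA.
have h1 := hY k.+1 t phiA phiK.
have D0 : 0 <= C * K * 2^-1 ^+ k by rewrite !mulr_ge0// ltW.
have h2 : N (ev (fun s => picard phi k s - Y phi s) t) <= C * K * 2^-1 ^+ k / 2 * expR (a * t).
  apply: (ha (locally_Baire_one_sub B1 B2) t0 D0) => [s s0|s st].
    by rewrite (picard_le0 _ _ _ _ s0) (Y_le0 phiA s0) subrr.
  have [s0|/ltW s0] := leP 0 s.
    by have := hY k s phiA phiK; rewrite (max_l s0) mulrAC.
  by rewrite (picard_le0 _ _ _ _ s0) (Y_le0 phiA s0) subrr cnorm0 mulr_ge0// expR_ge0.
rewrite (evolution_sub Lop Rop t B1 B2) in h2.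
have E : picard phi k.+1 t = phi Izero + ev (picard phi k) t.
  by rewrite -[LHS]/(phi (clampI h t) + ev (picard phi k) (Num.max t 0)) (max_l t0) clamp0.
rewrite E in h1.
have -> : Y phi t - (phi Izero + ev (Y phi) t) =
    - (phi Izero + ev (picard phi k) t - Y phi t) + (ev (picard phi k) t - ev (Y phi) t).
  have comb (x p u v : V) : x - (p + v) = - (p + u - x) + (u - v).
    by rewrite opprB !opprD !addrA subrK.
  exact: comb.
apply: le_trans (cnormD _ _ _) _.
have -> : N (- (phi Izero + ev (picard phi k) t - Y phi t)) =
    N (phi Izero + ev (picard phi k) t - Y phi t) by exact: (@rnormN _ (Cn N)).
apply: le_trans (lerD h1 h2) _; rewrite -/X.
have -> : C * K * 2^-1 ^+ k / 2 * expR (a * t) = X * 2^-1 ^+ k / 2.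
  by rewrite /X (max_l t0); ring.
have X0 : 0 <= X * 2^-1 ^+ k by rewrite /X !mulr_ge0 ?expR_ge0// ltW.
by rewrite exprS mulrCA -mulrA; lra.
Qed.

Let Y_segment0 phi : B_nA phi -> segment (Y phi) 0 = phi.
Proof.
move=> phiA; apply/funext => s; rewrite /segment add0r.
have /andP[_ s0] := Ival_itv s.
by rewrite (Y_le0 phiA s0) IvalK.
Qed.

Let Y_solution phi : B_nA phi -> is_solution Lop Rop phi (Y phi).
Proof.
move=> phiA; have YB := Y_locally_Baire_one phiA; split.
- exact: Y_segment0.
- move=> u v hu uv; have [y_ [cy yM yy]] := YB; exists y_; split.
  + by move=> m; apply: continuous_subspaceT; exact: cy.
  + have [M hM] := yM v; exists M => m t /=; rewrite in_itv/= => /andP[_ tv].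
    exact: hM.
  + by move=> t _; exact: yy.
- by move=> s _; exact: locally_Baire_one_segment.
- by move=> t t0 ys; exact: (locally_bounded_Cintegrable t (segfun_measurable (Lc_comp ys Rop) YB)).
- move=> t t0; apply/funext => ys.
  have I k := locally_bounded_Cintegrable t (segfun_measurable (Rcoord Rop k) YB).
  have IZ k := CintZ (ys (delta_mx 0 k)) (I k).
  have [_ S] := Cint_sum (index_enum 'I_n) (fun k => (IZ k).1).
  (* By conversion the equation at [ys] is one between complex numbers. Expanding [ys] in
     coordinates, with the integral commuting with the finite sum, reduces it to the components of
     [Y_fixed]. *)
  change (ys (Y phi t) - segfun (Lc_comp ys Lop) (Y phi) t = ys (phi Izero) -
    ext_functional (Lc_comp ys Lop) phi + Cint (segfun (Lc_comp ys Rop) (Y phi)) t :> R[i]).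
  have -> : segfun (Lc_comp ys Rop) (Y phi) =
      (fun s => \sum_(k < n) ys (delta_mx 0 k) * segfun (Rcoord Rop k) (Y phi) s).
    by apply/funext => s; apply: ext_functional_coordinates; exact: locally_Baire_one_B_nA.
  rewrite S /segfun.
  rewrite (ext_functional_coordinates Lop ys (locally_Baire_one_B_nA h t YB)).
  rewrite (ext_functional_coordinates Lop ys phiA).
  rewrite (dual_coordinates ys (Y phi t)) (dual_coordinates ys (phi Izero)).
  rewrite -!sumrB -big_split /=; apply: eq_bigr => k _; rewrite (IZ k).2.
  rewrite (Y_fixed phiA (ltW t0)) !mxE /segfun (Y_segment0 phiA) -/(Lcoord Lop k).
  have comb (b p l1 l0 i : R[i]) : b * (p + (l1 - l0 + i)) - b * l1 = b * p - b * l0 + b * i by ring.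
  exact: comb.
Qed.

(* A given solution is only controlled on compact subintervals of [- h, oo[: it is
   frozen outside of [- h, T] before being compared. *)
Let clampT (T s : R) : R := Num.min (Num.max (- h%:num) s) T.

Let clampT_id T s : - h%:num <= s <= T -> clampT T s = s.
Proof. by move=> /andP[h1 h2]; rewrite /clampT (max_r h1) (min_l h2). Qed.

Let hneg : - h%:num <= 0 :> R. Proof. by rewrite oppr_le0 ge0. Qed.

Let clampT_itv T s : 0 <= T -> `[- h%:num, T]%classic (clampT T s).
Proof.
move=> T0; rewrite /= in_itv/= le_min le_max lexx (le_trans hneg T0)/=.
by rewrite ge_min lexx orbT.
Qed.

Let clampT_locally_Baire_one (T : R) z : 0 <= T -> propertyA `[- h%:num, T]%classic z ->
  locally_Baire_one (z \o clampT T).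
Proof.
move=> T0 [w [cw [M wM] wz]]; exists (fun m => w m \o clampT T); split.
(* [w m] is continuous only within the compact interval, but [clampT T] is continuous and takes all
   its values there. *)
- move=> m t; have := cw m; move/subspace_continuousP => /(_ _ (clampT_itv t T0)) cwt.
  apply: cvg_comp cwt; move=> P; rewrite /within /= => nP.
  have cc : continuous (clampT T).
    by apply: cts_min; [apply: cts_max; [exact: cts_cst|move=> ?]|exact: cts_cst].
  have H : nbhs t (clampT T @^-1` [set x | x \in `[- h%:num, T] -> P x]) := cc t _ nP.
  change (nbhs t (clampT T @^-1` P)); apply: filterS H => s /=; apply.
  exact: clampT_itv.
- by move=> T'; exists M => m t _; apply: wM; exact: clampT_itv.
- by move=> t; apply: wz; exact: clampT_itv.
Qed.

Let segment_clampT (T t : R) z : 0 <= t <= T -> segment (z \o clampT T) t = segment z t :> (I_ h -> V).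
Proof.
move=> /andP[t0 tT]; apply/funext => s; rewrite /segment /= clampT_id//.
have /andP[s0 s1] := Ival_itv s.
rewrite (le_trans s0) ?lerDr//= (le_trans _ tT)// gerDl.
exact: s1.
Qed.

Let solution_evolution phi z (T t : R) : is_solution Lop Rop phi z -> 0 < t <= T ->
  z t = phi Izero + ev (z \o clampT T) t.
Proof.
move=> [z0 _ _ _ zeq] /andP[t0 tT]; have T0 : 0 <= T := le_trans (ltW t0) tT.
(* Testing the identity of the bidual on the coordinate functional [i] gives its [i]-th
   component. *)
apply/rowP => i; have E := congr1 (fun f => f (coordinate N i)) (zeq t t0).
have {}E : (z t 0 i : R[i]) - segfun (Lcoord Lop i) z t = phi Izero 0 i -
    ext_functional (Lcoord Lop i) phi + Cint (segfun (Rcoord Rop i) z) t by exact: E.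
have seg (lam : dual (C_cn h N)) r : 0 <= r <= T -> segfun lam (z \o clampT T) r = segfun lam z r.
  by move=> rT; rewrite /segfun segment_clampT.
rewrite !mxE !seg ?lexx ?(ltW t0) ?T0//.
have -> : Cint (segfun (Rcoord Rop i) (z \o clampT T)) t = Cint (segfun (Rcoord Rop i) z) t.
  apply: eq_Cint => s /andP[s0 st]; apply: seg.
  by rewrite (ltW s0) (le_trans (ltW st)).
have -> : segfun (Lcoord Lop i) z 0 = ext_functional (Lcoord Lop i) phi.
  by rewrite /segfun z0.
move/eqP: E; rewrite subr_eq => /eqP ->.
have comb (p l0 l1 j : R[i]) : p - l0 + j + l1 = p + (l1 - l0 + j) by ring.
exact: comb.
Qed.

Let solution_initial phi z (s : R) : segment z 0 = phi -> - h%:num <= s <= 0 ->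
  z s = phi (clampI h s).
Proof. by move=> <- s0; rewrite /segment add0r clampI_id. Qed.

Let solution_unique phi z : B_nA phi -> is_solution Lop Rop phi z ->
  forall t : R, - h%:num <= t -> z t = Y phi t.
Proof.
move=> phiA zsol t ht; have ysol := Y_solution phiA.
have [t0|t0] := leP t 0.
  have [z0 _ _ _ _] := zsol; rewrite (Y_le0 phiA t0).
  by apply: solution_initial z0 _; rewrite ht.
have [z0 zA _ _ _] := zsol; have [y0 yA _ _ _] := ysol.
have T0 := ltW t0; have hT := le_trans hneg T0.
have zB := clampT_locally_Baire_one T0 (zA _ _ (lexx _) hT).
have yB := clampT_locally_Baire_one T0 (yA _ _ (lexx _) hT).
pose w s := (z \o clampT t) s - (Y phi \o clampT t) s.
have wB : locally_Baire_one w by exact: locally_Baire_one_sub zB yB.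
have w0 s : s <= 0 -> w s = 0.
  move=> s0; have hs : - h%:num <= clampT t s <= 0.
    have := clampT_itv s T0; rewrite /= in_itv/= => /andP[-> _]/=.
    by rewrite /clampT ge_min ge_max hneg s0.
  by rewrite /w /= (solution_initial z0 hs) (solution_initial y0 hs) subrr.
have wev s : 0 < s <= t -> w s = ev w s.
  move=> st; have /andP[s0 st1] := st.
  have cs : clampT t s = s by apply: clampT_id; rewrite st1 (le_trans hneg (ltW s0)).
  rewrite (evolution_sub Lop Rop s zB yB) /w /= cs.
  rewrite (solution_evolution zsol st) (solution_evolution ysol st).
  by rewrite opprD addrACA subrr add0r.
have [M M0 wM] := locally_Baire_one_bounded t wB.
(* From the crude bound [M], each application of the contraction to [w] gains a factor 1/2, which
   forces [w t = 0]. *)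
have wk k : forall s, s <= t -> N (w s) <= M * 2^-1 ^+ k * expR (a * s).
  elim: k => [|k IH] s st.
    have [s0|s0] := leP s 0.
      by rewrite (w0 s s0) cnorm0 !mulr_ge0// expR_ge0.
    apply: le_trans (wM s st) _; rewrite expr0 mulr1 ler_peMr//.
    by rewrite -[leLHS]expR0 ler_expR mulr_ge0// ltW.
  have [s0|s0] := leP s 0.
    by rewrite (w0 s s0) cnorm0 !mulr_ge0// expR_ge0.
  rewrite wev ?s0//; rewrite exprSr mulrA.
  apply: (ha wB (ltW s0) _ w0) => [|r rs]; first by rewrite mulr_ge0.
  by apply: IH; exact: le_trans st.
have wt : w t = 0.
  apply: (@cnorm_eq0 _ _ N); apply/eqP; rewrite eq_le cnorm_ge0 andbT.
  apply: (@le0_geometric _ _ (M * expR (a * t))) => k.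
  by rewrite mulrAC; exact: wk.
have ct : clampT t t = t by apply: clampT_id; rewrite ht lexx.
by move/eqP: wt; rewrite /w /= ct subr_eq0 => /eqP.
Qed.

Lemma fundamental_solution : exists Y : (I_ h -> V) -> R -> V,
  [/\ forall phi, B_nA phi -> is_solution Lop Rop phi (Y phi) /\
        forall z, is_solution Lop Rop phi z -> forall t : R, - h%:num <= t -> z t = Y phi t,
      forall T : R, exists2 c : R, 0 <= c & forall phi M, B_nA phi ->
        (forall s, N (phi s) <= M) -> forall t, t <= T -> N (Y phi t) <= c * M
    & forall (phi_ : nat -> I_ h -> V) phi M, (forall j, B_nA (phi_ j)) -> B_nA phi ->
        (forall j s, N (phi_ j s) <= M) -> (forall s, phi_ ^~ s @ \oo --> phi s) ->
        forall t, (fun j => Y (phi_ j) t) @ \oo --> Y phi t].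
Proof.
exists Y; split.
- move=> phi phiA; split; first exact: (Y_solution phiA).
  by move=> z zsol; exact: (solution_unique phiA zsol).
- move=> T; exists (1 + C * expR (a * Num.max T 0)).
    by rewrite addr_ge0// mulr_ge0// expR_ge0.
  move=> phi M phiA phiM t tT; apply: le_trans (Y_bound t phiA phiM) _.
  have M0 : 0 <= M by apply: le_trans (phiM Izero); exact: cnorm_ge0.
  rewrite ler_wpM2r// lerD2l ler_wpM2l// ler_expR ler_wpM2l ?(ltW a0)//.
  by rewrite ge_max !le_max tT lexx orbT.
- by move=> phi_ phi M phiA phiA' phiM phil t; exact: (@Y_cvg phi_ phi M t phiA phiA' phiM phil).
Qed.

End solution.

Local Close Scope complex_scope.

Theorem proposition5p8 (R : realType) (n : nat) (N : cnorm R n)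
    (h : {posnum R}) (Lop Rop : Lc (C_cn h N) (Cn N))
    (hDelta : condition_Delta Lop) :
  exists y : (I_ h -> Cn N) -> R -> Cn N,
    [/\ forall phi, B_nA phi ->
          is_solution Lop Rop phi (y phi) /\
          forall z, is_solution Lop Rop phi z ->
            forall t : R, - h%:num <= t -> z t = y phi t,
        forall t : R, 0 <= t -> exists2 c : R, 0 <= c &
          forall phi, B_nA phi ->
            (sup_norm [set s : R | - h%:num <= s <= t]%R (y phi) <= c%:E * sup_norm setT phi)%E
      & forall (phi_ : nat -> I_ h -> Cn N) (phi : I_ h -> Cn N),
          (forall j, B_nA (phi_ j)) -> B_nA phi ->
          (exists M : R, forall j, (sup_norm setT (phi_ j) <= M%:E)%E) ->
          (forall s, phi_ ^~ s @ \oo --> phi s) ->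
          forall t : R, - h%:num <= t ->
            (fun j => y (phi_ j) t) @ \oo --> y phi t].
Proof.
have [Y [Ysol Ybound Ycvg]] := fundamental_solution Rop hDelta.
exists Y; split; first exact: Ysol.
- move=> t t0; have [c c0 hc] := Ybound t; exists c => // phi phiA.
  have [K K0 phiK] := B_nA_bounded phiA.
  have ub s : ((N (phi s))%:E <= sup_norm setT phi)%E.
    by apply: ereal_sup_ubound; exists s.
  (* Baire-one maps in [B_nA] are bounded, so the extended-real norm is a real number and can serve
     as the bound in [hc]. *)
  have fin : sup_norm setT phi \is a fin_num.
    rewrite ge0_fin_numE; last by apply: le_trans (ub Izero); rewrite lee_fin cnorm_ge0.
    apply: (@le_lt_trans _ _ K%:E); last by rewrite ltry.
    by apply: ge_ereal_sup => _ [s _ <-]; rewrite lee_fin; exact: phiK.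
  rewrite -(fineK fin) -EFinM; apply: ge_ereal_sup => _ [s /andP[_ st] <-].
  rewrite lee_fin rnorm_CnE; apply: hc => // r.
  by rewrite -lee_fin fineK.
- move=> phi_ phi phiA phiA' [M hM] phil t _; apply: (Ycvg phi_ phi M phiA phiA' _ phil) => j s.
  rewrite -lee_fin; apply: le_trans (hM j).
  by apply: ereal_sup_ubound; exists s.
Qed.
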